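(* Let $F$ be a field of characteristic $p>0$ with $p\neq 2$, and let $n\geq 1$ be an integer. Let $H^2(W(n),W(n))$ be the second cohomology group of the Witt-Jacobson Lie algebra $W(n)$ with values in its adjoint representation. Then $$H^2(W(n),W(n))=\bigoplus_{i=1}^n F\cdot \langle \mathrm{Sq}(D_i)\rangle ,$$ that is, the classes of the $2$-cocycles $\mathrm{Sq}(D_1),\dots,\mathrm{Sq}(D_n)$ form an $F$-basis of $H^2(W(n),W(n))$, with the exception of the case $n=1$ and $p=3$, in which $H^2(W(n),W(n))=0$.
   Context: Let $A(n)=F[x_1,\dots,x_n]/(x_1^p,\dots,x_n^p)$. The Witt-Jacobson algebra $W(n)=\mathrm{Der}_F A(n)$ is the Lie algebra of $F$-derivations of $A(n)$; it is a free $A(n)$-module with basis $D_1,\dots,D_n$, where $D_j=\partial/\partial x_j$. For a Lie algebra $\mathfrak g$ over $F$ and a $\mathfrak g$-module $M$, $H^*(\mathfrak g,M)$ is the (Chevalley-Eilenberg) Lie algebra cohomology, computed by alternating multilinear cochains. Squaring: for a derivation $\gamma$ of a Lie algebra $\mathfrak g$ over $F$, define the $2$-cocycle with values in the adjoint representation $$\mathrm{Sq}(\gamma)(x,y)=\sum_{i=1}^{p-1}\frac{[\gamma^i(x),\gamma^{p-i}(y)]}{i!\,(p-i)!},$$ where $\gamma^i$ is the $i$-th iterate of $\gamma$. For an element $D\in\mathfrak g$, $\mathrm{Sq}(D)$ means $\mathrm{Sq}(\mathrm{ad}\,D)$. *)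

(* Defs.v *)
From HB Require Import structures.
From mathcomp Require Import all_boot all_order all_algebra generic_quotient.
From mathcomp Require Import ring_quotient boolp functions.
From mathcomp Require Import mpoly.

Set Implicit Arguments.
Unset Strict Implicit.
Unset Printing Implicit Defensive.

Import GRing.Theory.

Local Open Scope ring_scope.
Local Open Scope quotient_scope.

Section QuotientModule.
Variables (R : pzRingType) (V : lmodType R) (S : submodClosed V).

(* A copy of S carrying the closure under opposites that SubmodClosed, stated
   over semirings, does not provide. *)
Definition submod_pred : {pred V} := fun x => x \in S.

Fact submod_pred_zmod_closed : zmod_closed submod_pred.
Proof.
split=> [|x y Sx Sy]; first exact: (rpred0 S).
by rewrite unfold_in rpredD // -scaleN1r rpredZ.
Qed.

HB.instance Definition _ :=
  GRing.isZmodClosed.Build V submod_pred submod_pred_zmod_closed.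

Definition lmod_quot := Quotient.quot submod_pred.
Local Notation Q := lmod_quot.

HB.instance Definition _ :=
  ZmodQuotient.copy Q (Quotient.quot submod_pred).

Definition quot_scale (a : R) : Q -> Q := lift_op1 Q ( *:%R a).

Lemma pi_scale a : {morph \pi_Q : x / a *: x >-> quot_scale a x}.
Proof.
move=> x; unlock quot_scale; apply/eqP.
rewrite -[_ == _]Quotient.idealrBE -scalerBr; apply: (@rpredZ _ _ S).
by rewrite -[_ \in S]/(_ \in submod_pred) Quotient.idealrBE reprK.
Qed.

Fact quot_scaleA a b x : quot_scale a (quot_scale b x) = quot_scale (a * b) x.
Proof. by rewrite -[x]reprK -!pi_scale scalerA. Qed.

Fact quot_scale1 : left_id 1 quot_scale.
Proof. by move=> x; rewrite -[x]reprK -pi_scale scale1r. Qed.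

Fact quot_scaleDr : right_distributive quot_scale +%R.
Proof.
move=> a x y; rewrite -[x]reprK -[y]reprK.
by rewrite -raddfD -!pi_scale -raddfD scalerDr.
Qed.

Fact quot_scaleDl x : {morph quot_scale^~ x : a b / a + b}.
Proof. by move=> a b; rewrite -[x]reprK -!pi_scale -raddfD scalerDl. Qed.

HB.instance Definition _ := GRing.Zmodule_isLmodule.Build R Q
  quot_scaleA quot_scale1 quot_scaleDr quot_scaleDl.

Lemma pi_scaleE (a : R) (x : V) : \pi_Q (a *: x) = a *: (\pi_Q x : Q).
Proof. exact: pi_scale. Qed.

End QuotientModule.

Definition is_basis (F : fieldType) (V : lmodType F) (m : nat) (e : 'I_m -> V) :=
  forall v : V, exists! c : {ffun 'I_m -> F}, v = \sum_i c i *: e i.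

HB.mixin Record isLieAlgebra (F : fieldType) L of GRing.Lmodule F L := {
  lie : L -> L -> L;
  lie_linearl : forall y, linear (lie^~ y);
  lie_linearr : forall x, linear (lie x);
  liexx : forall x, lie x x = 0;
  lie_jacobi : forall x y z,
    lie x (lie y z) + lie y (lie z x) + lie z (lie x y) = 0
}.

#[short(type="lieAlgType")]
HB.structure Definition LieAlgebra (F : fieldType) :=
  {L of isLieAlgebra F L & GRing.Lmodule F L}.

Record lieModule (F : fieldType) (g : lieAlgType F) := LieModule {
  lie_carrier :> lmodType F;
  act : g -> lie_carrier -> lie_carrier;
  act_linearl : forall m, linear (act^~ m);
  act_linearr : forall x, linear (act x);
  act_lie : forall x y m, act (lie x y) m = act x (act y m) - act y (act x m)
}.

Section Adjoint.
Variables (F : fieldType) (g : lieAlgType F).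
Implicit Types x y z : g.

Lemma lieDl x y z : lie (x + y) z = lie x z + lie y z.
Proof. by have := lie_linearl z 1 x y; rewrite !scale1r. Qed.

Lemma lieDr x y z : lie x (y + z) = lie x y + lie x z.
Proof. by have := lie_linearr x 1 y z; rewrite !scale1r. Qed.

Lemma lieC x y : lie x y = - lie y x.
Proof.
apply/eqP; rewrite -addr_eq0 -(liexx (x + y)) lieDl !lieDr !liexx.
by rewrite add0r addr0.
Qed.

Lemma lieNr x y : lie x (- y) = - lie x y.
Proof.
have lie0 : lie x 0 = 0.
  by apply: (addrI (lie x 0)); rewrite -lieDr !addr0.
by apply/eqP; rewrite -addr_eq0 -lieDr addNr lie0.
Qed.

Fact adjoint_act_lie x y z :
  lie (lie x y) z = lie x (lie y z) - lie y (lie x z).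
Proof.
rewrite (lieC _ z) -[LHS]add0r -(lie_jacobi x y z) addrK.
by rewrite (lieC z x) lieNr.
Qed.

Definition adjoint : lieModule g :=
  @LieModule F g g (@lie F g) (@lie_linearl F g) (@lie_linearr F g)
    adjoint_act_lie.

End Adjoint.

Section Cohomology.
Variables (F : fieldType) (g : lieAlgType F) (M : lieModule g).

Definition set_arg k (v : {ffun 'I_k -> g}) (i : 'I_k) (x : g) :
  {ffun 'I_k -> g} :=
  [ffun t => if t == i then x else v t].

Definition multilinear k (f : {ffun 'I_k -> g} -> M) :=
  forall (v : {ffun 'I_k -> g}) i, linear (fun x => f (set_arg v i x)).

Definition alternating k (f : {ffun 'I_k -> g} -> M) :=
  forall (v : {ffun 'I_k -> g}) (i j : 'I_k), i != j -> v i = v j -> f v = 0.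

Definition is_cochain k (f : {ffun 'I_k -> g} -> M) :=
  multilinear f /\ alternating f.

(* (x_0, .., ^x_i, .., x_k) *)
Definition drop_arg k (v : {ffun 'I_k.+1 -> g}) (i : 'I_k.+1) :
  {ffun 'I_k -> g} :=
  [ffun t : 'I_k => v (lift i t)].

(* ([x_i, x_j], x_0, .., ^x_i, .., ^x_j, .., x_k) when i < j: the map
   t' |-> bump j (bump i t') enumerates the indices other than i and j. *)
Definition bracket_args k (v : {ffun 'I_k.+1 -> g}) (i j : 'I_k.+1) :
  {ffun 'I_k -> g} :=
  [ffun t : 'I_k =>
     if val t is t'.+1 return g then v (inord (bump j (bump i t')))
     else lie (v i) (v j)].

Definition ce_diff k (f : {ffun 'I_k -> g} -> M) (v : {ffun 'I_k.+1 -> g}) : M :=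
  \sum_(i < k.+1) (-1) ^+ i *: act (v i) (f (drop_arg v i))
  + \sum_(i < k.+1) \sum_(j < k.+1 | (i < j)%N)
      (-1) ^+ (i + j) *: f (bracket_args v i j).

Definition is_cocycle k (f : {ffun 'I_k -> g} -> M) :=
  is_cochain f /\ forall v, ce_diff f v = 0.

Definition is_coboundary k : ({ffun 'I_k -> g} -> M) -> Prop :=
  match k with
  | 0 => fun f => f = 0
  | k'.+1 => fun f => exists2 h : {ffun 'I_k' -> g} -> M,
      is_cochain h & f = ce_diff h
  end.

Lemma is_cochain0 k : @is_cochain k 0.
Proof.
split=> [v i b x y|v i j _ _] //.
by rewrite scaler0 addr0.
Qed.

Lemma is_cochainDZ k a (f h : {ffun 'I_k -> g} -> M) :
  is_cochain f -> is_cochain h -> is_cochain (a *: f + h).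
Proof.
move=> [fl fa] [hl ha]; split.
  move=> v i b x y; rewrite !fctE fl hl.
  by rewrite !scalerDr !scalerA [a * b]mulrC addrACA.
by move=> v i j ij vij; rewrite !fctE (fa v i j) // (ha v i j) // scaler0 addr0.
Qed.

Lemma ce_diff_linear k : linear (@ce_diff k).
Proof.
move=> a f h; apply/funext => v; rewrite /ce_diff !fctE.
have sc (b c : F) (m : M) : b *: (c *: m) = c *: (b *: m).
  by rewrite !scalerA mulrC.
rewrite scalerDr addrACA; congr (_ + _).
  rewrite scaler_sumr -big_split /=; apply: eq_bigr => i _.
  by rewrite act_linearr scalerDr sc.
rewrite scaler_sumr -big_split /=; apply: eq_bigr => i _.
rewrite scaler_sumr -big_split /=; apply: eq_bigr => j _.
by rewrite scalerDr sc.
Qed.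

Lemma ce_diff0 k : @ce_diff k 0 = 0.
Proof.
have := @ce_diff_linear k 1 0 0; rewrite !scale1r addr0.
by move=> /esym/(canRL (addKr _)); rewrite addNr.
Qed.

Definition cocycle_pred k : {pred {ffun 'I_k -> g} -> M} :=
  fun f => `[< is_cocycle f >].

Fact cocycle_closed k : GRing.subsemimod_closed (@cocycle_pred k).
Proof.
split; first split.
- by apply/asboolP; split=> [|v]; [exact: is_cochain0 | rewrite ce_diff0].
- move=> f h /asboolP[fc f0] /asboolP[hc h0]; apply/asboolP.
  rewrite -[f]scale1r; split; first exact: is_cochainDZ.
  by move=> v; rewrite ce_diff_linear !fctE f0 h0 scaler0 addr0.
move=> a f /asboolP[fc f0]; apply/asboolP; rewrite -[_ *: f]addr0; split.
  by apply: is_cochainDZ => //; exact: is_cochain0.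
by move=> v; rewrite ce_diff_linear ce_diff0 !fctE f0 scaler0 addr0.
Qed.

HB.instance Definition _ k := GRing.isSubmodClosed.Build F
  ({ffun 'I_k -> g} -> M) (@cocycle_pred k) (@cocycle_closed k).

Record cocycles k := Cocycle_subproof {
  cocycle_fun :> {ffun 'I_k -> g} -> M;
  _ : cocycle_pred cocycle_fun
}.

HB.instance Definition _ k := [isSub for @cocycle_fun k].
HB.instance Definition _ k := [Choice of cocycles k by <:].
HB.instance Definition _ k := [SubChoice_isSubLmodule of cocycles k by <:].

Definition Cocycle k (f : {ffun 'I_k -> g} -> M) (fP : is_cocycle f) :
  cocycles k := Cocycle_subproof (asboolT fP).

Definition coboundary_pred k : {pred cocycles k} :=
  fun z => `[< is_coboundary (z : {ffun 'I_k -> g} -> M) >].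

Fact coboundary_closed k : GRing.subsemimod_closed (@coboundary_pred k).
Proof.
split; first split.
- apply/asboolP; case: k => [|k] //=.
  by exists 0; [exact: is_cochain0 | rewrite ce_diff0].
- move=> x y /asboolP xB /asboolP yB; apply/asboolP; case: k x y xB yB => [|k] x y.
    by move=> /= x0 y0; rewrite x0 y0 addr0.
  move=> [f fc xE] [h hc yE]; exists (1 *: f + h); first exact: is_cochainDZ.
  by rewrite ce_diff_linear scale1r -xE -yE.
move=> a x /asboolP xB; apply/asboolP; case: k x xB => [|k] x.
  by move=> /= x0; rewrite x0 scaler0.
move=> [f fc xE]; exists (a *: f + 0).
  by apply: is_cochainDZ => //; exact: is_cochain0.
by rewrite ce_diff_linear ce_diff0 addr0 -xE.
Qed.

HB.instance Definition _ k := GRing.isSubmodClosed.Build F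
  (cocycles k) (@coboundary_pred k) (@coboundary_closed k).

(* The coboundaries are taken as a submodule of the cocycles, so the quotient
   can be formed without first proving that ce_diff squares to zero. *)
Definition cohomology k : lmodType F := lmod_quot (@coboundary_pred k).

Definition cohomology_class k (z : cocycles k) : cohomology k :=
  \pi_(lmod_quot (@coboundary_pred k)) z.

End Cohomology.

Section Squaring.
Variables (F : fieldType) (g : lieAlgType F).

Definition ad (D : g) : g -> g := lie D.

Definition Sq (p : nat) (gamma : g -> g) (v : {ffun 'I_2 -> g}) : g :=
  \sum_(1 <= i < p) ((i`! * (p - i)`!)%:R)^-1 *:
    lie (iter i gamma (v ord0)) (iter (p - i) gamma (v ord_max)).

End Squaring.

Section Derivations.
Variables (F : fieldType) (A : algType F).

Definition is_derivation (D : A -> A) :=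
  linear D /\ forall a b, D (a * b) = D a * b + a * D b.

Definition derivation_pred : {pred A -> A} := fun D => `[< is_derivation D >].

Fact derivation_closed : GRing.subsemimod_closed derivation_pred.
Proof.
split; first split.
- apply/asboolP; split=> [a x y|a b].
    by rewrite scaler0 addr0.
  by rewrite mul0r mulr0 addr0.
- move=> D E /asboolP[Dl DM] /asboolP[El EM]; apply/asboolP.
  split=> [a x y|a b]; rewrite !fctE.
    by rewrite Dl El scalerDr addrACA.
  by rewrite DM EM mulrDl mulrDr addrACA.
move=> c D /asboolP[Dl DM]; apply/asboolP; split=> [a x y|a b]; rewrite !fctE.
  by rewrite Dl scalerDr !scalerA mulrC.
by rewrite DM scalerDr scalerAl scalerAr.
Qed.

HB.instance Definition _ := GRing.isSubmodClosed.Build F (A -> A)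
  derivation_pred derivation_closed.

Record derivations := Derivation_subproof {
  derivation_fun :> A -> A;
  _ : derivation_pred derivation_fun
}.

HB.instance Definition _ := [isSub for derivation_fun].
HB.instance Definition _ := [Choice of derivations by <:].
HB.instance Definition _ := [SubChoice_isSubLmodule of derivations by <:].

Definition Derivation (D : A -> A) (DP : is_derivation D) : derivations :=
  Derivation_subproof (asboolT DP).

Lemma derivationP (D : derivations) : is_derivation D.
Proof. by case: D => D /= /asboolP. Qed.

Lemma der_add (D : derivations) : {morph D : x y / x + y}.
Proof. by move=> x y; have := (derivationP D).1 1 x y; rewrite !scale1r. Qed.

Lemma der_opp (D : derivations) : {morph D : x / - x}.
Proof.
have D0 : D 0 = 0 by apply: (addrI (D 0)); rewrite -der_add !addr0.
by move=> x; apply/eqP; rewrite -addr_eq0 -der_add addNr D0.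
Qed.

Fact der_lie_subproof (D E : derivations) :
  is_derivation (fun a => D (E a) - E (D a)).
Proof.
have [[Dl DM] [El EM]] := (derivationP D, derivationP E).
split=> [a x y|a b].
  by rewrite Dl El Dl El scalerDr scalerN opprD addrACA.
have aux (q r s t u v : A) :
    q + r + (s + t) - (u + s + (r + v)) = q - u + (t - v).
  rewrite [s + t]addrC [r + v]addrC (addrACA q) (addrACA u) [s + r]addrC.
  by rewrite opprD (addrACA (q + t)) subrr addr0 opprD addrACA.
by rewrite DM EM !der_add !DM !EM mulrBl mulrBr aux.
Qed.

Definition der_lie (D E : derivations) := Derivation (der_lie_subproof D E).

Lemma derivations_eqP (D E : derivations) : (forall a, D a = E a) -> D = E.
Proof. by move=> DE; apply/val_inj/funext. Qed.

Fact der_lie_linearl E : linear (der_lie^~ E).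
Proof.
move=> c D D'; apply: derivations_eqP => a.
rewrite -[LHS]/(c *: D (E a) + D' (E a) - E (c *: D a + D' a)).
rewrite (derivationP E).1 opprD addrACA -scalerBr.
by [].
Qed.

Fact der_lie_linearr D : linear (der_lie D).
Proof.
move=> c E E'; apply: derivations_eqP => a.
rewrite -[LHS]/(D (c *: E a + E' a) - (c *: E (D a) + E' (D a))).
rewrite (derivationP D).1 opprD addrACA -scalerBr.
by [].
Qed.

Fact der_liexx D : der_lie D D = 0.
Proof. by apply: derivations_eqP => a /=; rewrite subrr. Qed.

Fact der_lie_jacobi (D E G : derivations) :
  der_lie D (der_lie E G) + der_lie E (der_lie G D) + der_lie G (der_lie D E)
  = 0.
Proof.
have aux (q r s t u v : A) :
    q - r - (s - t) + (s - u - (v - r)) + (v - t - (q - u)) = 0.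
  rewrite !opprB !(addrACA _ (- _)) -!opprD.
  rewrite [s + r]addrC subrKA [v + u]addrC subrKA [t + q]addrC.
  exact: subrr.
have derB (H : derivations) x y : H (x - y) = H x - H y.
  by rewrite der_add der_opp.
apply: derivations_eqP => a.
rewrite -[LHS]/(D (E (G a) - G (E a)) - (E (G (D a)) - G (E (D a)))
  + (E (G (D a) - D (G a)) - (G (D (E a)) - D (G (E a))))
  + (G (D (E a) - E (D a)) - (D (E (G a)) - E (D (G a))))).
rewrite !derB; exact: aux.
Qed.

HB.instance Definition _ := isLieAlgebra.Build F derivations
  der_lie_linearl der_lie_linearr der_liexx der_lie_jacobi.

End Derivations.

Section TruncatedPolynomials.
Variables (F : fieldType) (p : nat) (charFp : p \in [pchar F]) (n : nat).

(* The ideal (x_1^p, .., x_n^p). The proof argument is unused in the body: it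
   keys the instance below, where p > 0 is needed for the ideal to be proper. *)
Definition trunc_ideal (_ : p \in [pchar F]) : {pred {mpoly F[n]}} :=
  fun f => `[< exists c : 'I_n -> {mpoly F[n]}, f = \sum_i c i * 'X_i ^+ p >].

Fact trunc_ideal_closed : idealr_closed (trunc_ideal charFp).
Proof.
have p_gt0 := prime_gt0 (pcharf_prime charFp).
split.
- apply/asboolP; exists (fun=> 0); rewrite big1 // => i _; exact: mul0r.
- apply/asboolP => -[c /(congr1 (meval (fun=> 0)))].
  rewrite meval1 raddf_sum /= big1 => [/eqP|i _]; first by rewrite oner_eq0.
  by rewrite mevalM rmorphXn /= mevalXU expr0n gtn_eqF // mulr0.
move=> a u v /asboolP[b ->] /asboolP[c ->]; apply/asboolP.
exists (fun i => a * b i + c i); rewrite mulr_sumr -big_split /=.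
by apply: eq_bigr => i _; rewrite mulrDl mulrA.
Qed.

HB.instance Definition _ := isIdealr.Build {mpoly F[n]}
  (trunc_ideal charFp) trunc_ideal_closed.

Definition trunc_poly := {ideal_quot (trunc_ideal charFp)}.
Local Notation A := trunc_poly.

HB.instance Definition _ := NzRingQuotient.on A.
HB.instance Definition _ := GRing.ComNzRing.on A.

Definition trunc_pi (f : {mpoly F[n]}) : A :=
  \pi_{ideal_quot (trunc_ideal charFp)} f.

Fact trunc_pi_zmod_morphism : zmod_morphism trunc_pi.
Proof. exact: (pi_is_zmod_morphism {ideal_quot (trunc_ideal charFp)}). Qed.

HB.instance Definition _ := GRing.isZmodMorphism.Build {mpoly F[n]} A
  trunc_pi trunc_pi_zmod_morphism.

Fact trunc_pi_monoid_morphism : monoid_morphism trunc_pi.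
Proof. exact: (pi_is_monoid_morphism {ideal_quot (trunc_ideal charFp)}). Qed.

HB.instance Definition _ := GRing.isMonoidMorphism.Build {mpoly F[n]} A
  trunc_pi trunc_pi_monoid_morphism.

Definition trunc_repr (a : A) : {mpoly F[n]} := repr a.

Lemma trunc_reprK : cancel trunc_repr trunc_pi.
Proof. exact: reprK. Qed.

Lemma trunc_pi_eqP (f h : {mpoly F[n]}) :
  reflect (trunc_pi f = trunc_pi h) (f - h \in trunc_ideal charFp).
Proof. by rewrite Quotient.idealrBE; exact: eqP. Qed.

Definition trunc_scale (c : F) (a : A) : A := trunc_pi c%:MP * a.

Fact trunc_scaleA a b x : trunc_scale a (trunc_scale b x) = trunc_scale (a * b) x.
Proof. by rewrite /trunc_scale mulrA -rmorphM mpolyCM. Qed.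

Fact trunc_scale1 : left_id 1 trunc_scale.
Proof. by move=> x; rewrite /trunc_scale mpolyC1 rmorph1 mul1r. Qed.

Fact trunc_scaleDr : right_distributive trunc_scale +%R.
Proof. by move=> a x y; exact: mulrDr. Qed.

Fact trunc_scaleDl x : {morph trunc_scale^~ x : a b / a + b}.
Proof. by move=> a b; rewrite /trunc_scale mpolyCD rmorphD mulrDl. Qed.

HB.instance Definition _ := GRing.Zmodule_isLmodule.Build F A
  trunc_scaleA trunc_scale1 trunc_scaleDr trunc_scaleDl.

Fact trunc_scaleAl (c : F) (x y : A) : c *: (x * y) = (c *: x) * y.
Proof. exact: mulrA. Qed.

HB.instance Definition _ := GRing.Lmodule_isLalgebra.Build F A trunc_scaleAl.
HB.instance Definition _ := GRing.Lalgebra_isComAlgebra.Build F A.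

Lemma trunc_piZ c (f : {mpoly F[n]}) : trunc_pi (c *: f) = c *: trunc_pi f.
Proof. by rewrite -mul_mpolyC rmorphM. Qed.

(* The partial derivative d/dx_j of any representative: it is independent of
   the representative because p = 0 in F, see trunc_partial_pi. *)
Definition trunc_partial (j : 'I_n) (a : A) : A := trunc_pi (trunc_repr a)^`M(j).

Lemma trunc_partial_pi j f : trunc_partial j (trunc_pi f) = trunc_pi f^`M(j).
Proof.
apply/trunc_pi_eqP; rewrite -mderivB.
have /trunc_pi_eqP/asboolP[c ->] := trunc_reprK (trunc_pi f).
apply/asboolP; exists (fun i => (c i)^`M(j)).
rewrite raddf_sum; apply: eq_bigr => i _ /=.
rewrite mderivM mpolyXn mderivX mulmnE natrM (pcharf0 charFp).
by rewrite mulr0 scale0r mulr0 addr0.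
Qed.

Fact trunc_partial_is_derivation j : is_derivation (trunc_partial j).
Proof.
split=> [c x y|x y]; rewrite -[x]trunc_reprK -[y]trunc_reprK.
  rewrite -trunc_piZ -rmorphD !trunc_partial_pi linearP /=.
  by rewrite rmorphD /= trunc_piZ.
by rewrite -rmorphM !trunc_partial_pi mderivM rmorphD !rmorphM.
Qed.

Definition witt_jacobson : lieAlgType F := derivations A.

Definition partial (j : 'I_n) : witt_jacobson :=
  Derivation (trunc_partial_is_derivation j).

End TruncatedPolynomials.

(* Main.v *)
Require Import Defs.
From mathcomp Require Import all_boot all_order all_algebra.
From mathcomp Require Import boolp functions mpoly zify ring.

(** Write D_i for the partial derivatives and h_i for x_i D_i.

    Every derivation of W(n) is inner: since (ad D_i)^p = 0, a derivation d
    satisfies (ad D_i)^(p-1) (d D_i) = 0, which is exactly the condition for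
    solving [D_i, w] = - d D_i; what commutes with the D_i is then determined by
    its constant terms, and the weights of the h_i leave almost nothing.

    For a 2-cocycle phi the map (ad D_i)^(p-1) . phi(D_i, -) is a derivation,
    hence inner, and this is what allows phi to be changed by a coboundary until
    phi(D_i, -) = 0 for all i. As (ad h_i)^p = ad h_i, the operator
    1 - (L_(h_i))^(p-1) projects phi, within its class, on h_i-weight zero, and
    then phi(h_i, -) = 0 as well. Such a normalized phi is determined by its
    constant terms, only finitely many of which have weight zero.

    The elements u with phi(u, -) = 0 form a subalgebra. Subtracting a
    combination of the Sq(D_i) and of explicit coboundaries kills enough of the
    constant terms for the cocycle identity to put first all x_i D_j, then all
    x_i^2 D_i into this subalgebra; for n > 1 these generate W(n) with the D_i,
    and for n = 1 one more step reaches x^3 D. The classes are independent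
    because Sq(D_i)(x_i^2 D_i, x_i^(p-1) D_l) has constant term - D_l for l <> i
    and - 3 D_i for l = i, while a coboundary has none. *)

Set Implicit Arguments.
Unset Strict Implicit.
Unset Printing Implicit Defensive.

Import GRing.Theory.

Local Open Scope ring_scope.

(** * A decision procedure for identities in abelian groups *)

(** The same equation is solved at two levels. On W(n), [ad D_i] and multiplication by x_i satisfy
    the Weyl relation TM = MT + 1; so do the Lie derivative along D_i and multiplication of the
    values by x_i on 1-cochains. Under this relation Tw = v is solvable as soon as T^(p-1) v = 0,
    and w is built from v by T and M alone. Hence properties stable under T and M, such as being
    killed by another D_k, pass from v to w; this is why the D_i can be treated one at a time
    without undoing earlier work. Cartan's formula makes L_x phi the coboundary of phi(x, -), and
    (L_x)^p is again a Lie derivative, zero for D_i and L_(h_i) for h_i. Weights live in F, so they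
    give exponents only modulo p. Exponents below p are still determined, a weight -1 or -2 showing
    up as p - 1 or p - 2. Normalization is not rigid: a 1-cochain that commutes with all D_i and h_i
    and vanishes on them has a normalized coboundary. The trace maps are of this kind, which is why
    their coboundaries have to be subtracted explicitly. *)

Inductive zmod_expr :=
  | ZVar of nat | ZZero | ZAdd of zmod_expr & zmod_expr | ZOpp of zmod_expr.

Fixpoint zmod_eval (V : zmodType) (env : seq V) (x : zmod_expr) : V :=
  match x with
  | ZVar i => env`_i
  | ZZero => 0
  | ZAdd y z => zmod_eval env y + zmod_eval env z
  | ZOpp y => - zmod_eval env y
  end.

(** Positive and negative occurrences are counted separately, so that equality of integer
    coefficients is tested by additions in [nat] and computes well. *)
Fixpoint zmod_coef (i : nat) (x : zmod_expr) : nat * nat :=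
  match x with
  | ZVar j => (nat_of_bool (i == j), 0%N)
  | ZZero => (0%N, 0%N)
  | ZAdd y z => let c := zmod_coef i y in let d := zmod_coef i z in
      ((c.1 + d.1)%N, (c.2 + d.2)%N)
  | ZOpp y => let c := zmod_coef i y in (c.2, c.1)
  end.

Lemma zmod_evalE (V : zmodType) (env : seq V) x :
  zmod_eval env x = \sum_(i < size env)
    (env`_i *+ (zmod_coef i x).1 - env`_i *+ (zmod_coef i x).2).
Proof.
elim: x => [j||y IHy z IHz|y IHy] /=.
- case: (ltnP j (size env)) => jlt; last first.
    rewrite nth_default // big1 // => i _.
    by rewrite [_ == j]ltn_eqF ?subrr // (leq_trans (ltn_ord i)).
  rewrite (bigD1 (Ordinal jlt)) //= eqxx subr0 big1 ?addr0 // => i ij.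
  by rewrite -[_ == j]/(i == Ordinal jlt) (negPf ij) subrr.
- by rewrite big1 // => i _; rewrite subrr.
- rewrite IHy IHz -big_split; apply: eq_bigr => i _ /=.
  by rewrite !mulrnDr opprD addrACA.
- by rewrite IHy -sumrN; apply: eq_bigr => i _; rewrite opprB.
Qed.

Lemma zmod_eqP (V : zmodType) (env : seq V) x y :
  all (fun i => (zmod_coef i x).1 + (zmod_coef i y).2
             == (zmod_coef i y).1 + (zmod_coef i x).2)%N (iota 0 (size env)) ->
  zmod_eval env x = zmod_eval env y.
Proof.
move=> /allP xy; rewrite !zmod_evalE; apply: eq_bigr => i _.
have /xy/eqP cE : val i \in iota 0 (size env) by rewrite mem_iota ltn_ord.
by apply/eqP; rewrite subr_eq addrAC eq_sym subr_eq -!mulrnDr cE.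
Qed.

(* Atoms are compared up to conversion: the same module operation may be reached
   through several structure instances. *)
Ltac zmod_index x env :=
  match env with
  | x :: _ => constr:(0%N)
  | ?y :: _ => let _ := constr:(erefl x : x = y) in constr:(0%N)
  | _ :: ?r => let i := zmod_index x r in constr:(S i)
  end.
Ltac zmod_push x env :=
  match env with
  | _ => let i := zmod_index x env in env
  | _ => constr:(x :: env)
  end.
Ltac zmod_env t env :=
  match t with
  | ?a + ?b => let r := zmod_env a env in zmod_env b r
  | - ?a => zmod_env a env
  | 0 => env
  | _ => zmod_push t env
  end.
Ltac zmod_quote t env :=
  match t with
  | ?a + ?b => let x := zmod_quote a env in let y := zmod_quote b env in
      constr:(ZAdd x y)
  | - ?a => let x := zmod_quote a env in constr:(ZOpp x)
  | 0 => constr:(ZZero)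
  | _ => let i := zmod_index t env in constr:(ZVar i)
  end.
Ltac zmod :=
  match goal with |- @eq ?V ?a ?b =>
    let r := zmod_env a (@nil V) in let env := zmod_env b r in
    let x := zmod_quote a env in let y := zmod_quote b env in
    apply: (@zmod_eqP _ env x y); vm_compute; reflexivity
  end.

(** * Linear maps and operators in characteristic p *)

Section LinearFunctions.
Variables (F : fieldType) (U V : lmodType F) (f : U -> V).
Hypothesis fl : linear f.

Lemma linfD x y : f (x + y) = f x + f y.
Proof. by have := fl 1 x y; rewrite !scale1r. Qed.

Lemma linf0 : f 0 = 0.
Proof. by apply: (addrI (f 0)); rewrite -linfD !addr0. Qed.

Lemma linfZ a x : f (a *: x) = a *: f x.
Proof. by have := fl a x 0; rewrite linf0 !addr0. Qed.

Lemma linfN x : f (- x) = - f x.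
Proof. by rewrite -scaleN1r linfZ scaleN1r. Qed.

Lemma linfB x y : f (x - y) = f x - f y.
Proof. by rewrite linfD linfN. Qed.

Lemma linf_sum (I : Type) (r : seq I) (P : pred I) (E : I -> U) :
  f (\sum_(i <- r | P i) E i) = \sum_(i <- r | P i) f (E i).
Proof. exact: (big_morph f linfD linf0). Qed.

End LinearFunctions.

Section LinearCombinators.
Variables (F : fieldType).
Implicit Types U V W : lmodType F.

Lemma linear_comp U V W (f : V -> W) (g : U -> V) :
  linear f -> linear g -> linear (fun x => f (g x)).
Proof. by move=> fl gl a x y; rewrite gl fl. Qed.

Lemma linear_zero U V : linear (fun x : U => 0 : V).
Proof. by move=> a x y; rewrite scaler0 addr0. Qed.

Lemma linear_scale U V c (f : U -> V) : linear f -> linear (fun x => c *: f x).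
Proof. by move=> fl a x y; rewrite fl scalerDr !scalerA mulrC. Qed.

Lemma linear_add U V (f g : U -> V) :
  linear f -> linear g -> linear (fun x => f x + g x).
Proof. by move=> fl gl a x y; rewrite fl gl scalerDr addrACA. Qed.

Lemma linear_opp U V (f : U -> V) : linear f -> linear (fun x => - f x).
Proof. by move=> fl a x y; rewrite fl opprD scalerN. Qed.

Lemma linear_sub U V (f g : U -> V) :
  linear f -> linear g -> linear (fun x => f x - g x).
Proof. by move=> fl gl; apply: linear_add => //; apply: linear_opp. Qed.

Lemma linear_bigsum U V (I : Type) (r : seq I) (P : pred I) (f : I -> U -> V) :
  (forall i, P i -> linear (f i)) -> linear (fun x => \sum_(i <- r | P i) f i x).
Proof.
move=> fl a x y; rewrite scaler_sumr -big_split; apply: eq_bigr => i Pi.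
exact: fl.
Qed.

Lemma linear_iter U k (f : U -> U) : linear f -> linear (iter k f).
Proof. by move=> fl; elim: k => [|k IHk] a x y //=; rewrite IHk fl. Qed.

End LinearCombinators.

Section OperatorPowers.
Variables (F : fieldType) (V : lmodType F) (p : nat) (charFp : p \in [pchar F]).
Variables (A B : V -> V) (Al : linear A) (Bl : linear B).

Lemma iter_comm k v : (forall v, A (B v) = B (A v)) ->
  iter k A (B v) = B (iter k A v).
Proof. by move=> AB; elim: k => //= k ->; rewrite AB. Qed.

(** Frobenius for commuting operators: in the binomial expansion all inner coefficients are
    divisible by p. *)
Lemma iter_addP v : (forall v, A (B v) = B (A v)) ->
  iter p (fun v => A v + B v) v = iter p A v + iter p B v.
Proof.
move=> AB.
have nat_iter k : iter k (fun v => A v + B v) v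
    = \sum_(i < k.+1) iter (k - i) A (iter i B v) *+ 'C(k, i).
  elim: k => [|k IHk]; first by rewrite big_ord_recr big_ord0 /= add0r.
  rewrite iterS IHk (linf_sum Al) (linf_sum Bl).
  rewrite [X in X + _]big_ord_recl [X in _ + X]big_ord_recr /=.
  rewrite [RHS]big_ord_recl [X in _ = _ + X]big_ord_recr /= !subn0 !bin0 !mulr1n.
  have linMn (C : V -> V) (Cl : linear C) (x : V) m : C (x *+ m) = C x *+ m.
    by rewrite -!scaler_nat (linfZ Cl).
  rewrite -addrA; congr (_ + _); rewrite addrA; congr (_ + _); last first.
    by rewrite /bump /= add1n !subnn !binn /= !mulr1n.
  rewrite -big_split; apply: eq_bigr => i _ /=; rewrite /bump /= add1n subSS.
  rewrite binS mulrnDr (linMn A Al) (linMn B Bl) -[A (iter _ A _)]iterS subnSK // add0n.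
  by congr (_ + _ *+ _); rewrite [RHS]iter_comm.
have p_pr := pcharf_prime charFp; have p_gt0 := prime_gt0 p_pr.
rewrite nat_iter; case: p p_pr charFp => [//|q] q_pr charq.
rewrite big_ord_recl big_ord_recr /= /bump add1n /= subnn bin0 binn !mulr1n.
rewrite add0n big1 ?add0r // => i _; rewrite -scaler_nat.
have /dvdnP[m ->] : (q.+1 %| 'C(q.+1, 1 + i))%N.
  by apply: prime_dvd_bin => //=; rewrite ltnS ltn_ord.
by rewrite natrM (pcharf0 charq) mulr0 scale0r.
Qed.

Lemma iter_oppP v : odd p -> iter p (fun v => - A v) v = - iter p A v.
Proof.
have gen k : iter k (fun v => - A v) v = (-1) ^+ k *: iter k A v.
  elim: k => [|k IHk] /=; first by rewrite expr0 scale1r.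
  by rewrite IHk (linfZ Al) exprS -scalerA scaleN1r.
by move=> odd_p; rewrite gen -signr_odd odd_p expr1 scaleN1r.
Qed.

End OperatorPowers.

(** * Solving Tw = v under the Weyl relation *)

Section WeylSolution.
Variables (F : fieldType) (V : lmodType F) (p : nat) (charFp : p \in [pchar F]).
Variables (T M : V -> V) (Tl : linear T) (Ml : linear M).
Hypothesis TM : forall v, T (M v) = M (T v) + v.

(** Antiderivative by repeated integration by parts, with T the derivative and M multiplication by
    the variable; it stops before k = p, where k! ceases to be invertible. *)
Definition weyl_sol (v : V) : V :=
  \sum_(1 <= k < p) ((-1) ^+ k.-1 / k`!%:R) *: iter k M (iter k.-1 T v).

Lemma fact_neq0 k : (k < p)%N -> k`!%:R != 0 :> F.
Proof.
move=> kp; rewrite -(dvdn_pcharf charFp); apply/negP => pk.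
have := pcharf_prime charFp; elim: k kp pk => [|k IHk] kp.
  by rewrite dvdn1 => /eqP -> .
rewrite factS => pk p_pr; have := pk; rewrite Euclid_dvdM // => /orP[pk1|/IHk].
  by move: (dvdn_leq (ltn0Sn k) pk1); rewrite leqNgt kp.
by apply=> //; apply: ltnW.
Qed.

Lemma T_iterM k v : T (iter k M v) = iter k M (T v) + k%:R *: iter k.-1 M v.
Proof.
elim: k v => [|k IHk] v /=; first by rewrite scale0r addr0.
rewrite TM IHk (linfD Ml) (linfZ Ml) -addrA; congr (_ + _).
by case: k {IHk} => [|k] /=; rewrite -[in RHS]natr1 scalerDl ?scale0r ?scale1r.
Qed.

(** T maps the k-th summand to a difference of consecutive values of (-1)^k M^k T^k v / k!. The sum
    telescopes to v minus the value at k = p - 1, which the hypothesis kills. *)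
Lemma weyl_solP v : iter p.-1 T v = 0 -> T (weyl_sol v) = v.
Proof.
move=> Tv; have p_pr := pcharf_prime charFp.
have p_gt0 := prime_gt0 p_pr.
rewrite /weyl_sol (linf_sum Tl) big_add1.
pose h k := ((-1) ^+ k / k`!%:R) *: iter k M (iter k T v).
rewrite (eq_big_nat _ _ (F2 := fun k => - (h k.+1 - h k))); last first.
  move=> k /andP[_ kp1]; have kp : (k.+1 < p)%N by rewrite -(prednK p_gt0) ltnS.
  rewrite (linfZ Tl) T_iterM -iterS scalerDr scalerA /h /= opprB addrC.
  rewrite exprS factS natrM invfM; congr (_ + _).
    rewrite [k.+1%:R^-1 * _]mulrC mulrA mulfVK //.
    by apply: contraTneq (fact_neq0 kp) => k0; rewrite factS natrM k0 mul0r eqxx.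
  by rewrite mulN1r mulNr scaleNr opprK.
rewrite sumrN telescope_sumr // /h Tv (linf0 (linear_iter _ Ml)) scaler0 sub0r.
by rewrite opprK expr0 fact0 divr1 scale1r.
Qed.

(** With k = p - 1 this shows that every element of the kernel of T is a (p-1)-st derivative. *)
Lemma T_iterT_iterM k v : T v = 0 -> iter k T (iter k M v) = k`!%:R *: v.
Proof.
move=> Tv; elim: k => [|k IHk]; first by rewrite scale1r.
rewrite iterSr T_iterM Tv (linf0 (linear_iter _ Ml)) add0r.
by rewrite (linfZ (linear_iter _ Tl)) IHk scalerA -natrM factS.
Qed.

(** The solution lies in every subspace that contains v and is stable under T and M; this carries
    linearity and vanishing properties over to it. *)
Lemma weyl_sol_ind (P : V -> Prop) v : P 0 ->
    (forall a x y, P x -> P y -> P (a *: x + y)) ->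
    (forall x, P x -> P (T x)) -> (forall x, P x -> P (M x)) -> P v ->
  P (weyl_sol v).
Proof.
move=> P0 PD PT PM Pv; rewrite /weyl_sol; elim/big_ind: _ => // [x y Px Py|k _].
  by rewrite -[x]scale1r; apply: PD.
rewrite -[_ *: _]addr0; apply: PD => //.
have Piter (f : V -> V) m x : (forall y, P y -> P (f y)) -> P x -> P (iter m f x).
  by move=> Pf Px; elim: m => //= m; apply: Pf.
exact/Piter/Piter.
Qed.

End WeylSolution.

(** * Cochains of degree at most two with adjoint coefficients *)

Section LieCochains.
Variables (F : fieldType) (g : lieAlgType F).
Implicit Types (x y z : g) (psi : g -> g) (phi : g -> g -> g).

Lemma lie0x x : lie 0 x = 0. Proof. exact: (linf0 (lie_linearl x)). Qed.
Lemma liex0 x : lie x 0 = 0. Proof. exact: (linf0 (lie_linearr x)). Qed.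
Lemma lieNl x y : lie (- x) y = - lie x y.
Proof. exact: (linfN (lie_linearl y)). Qed.
Lemma lieZl a x y : lie (a *: x) y = a *: lie x y.
Proof. exact: (linfZ (lie_linearl y)). Qed.
Lemma lieZr a x y : lie x (a *: y) = a *: lie x y.
Proof. exact: (linfZ (lie_linearr x)). Qed.
Lemma lieBl x y z : lie (x - y) z = lie x z - lie y z.
Proof. exact: (linfB (lie_linearl z)). Qed.
Lemma lieBr x y z : lie x (y - z) = lie x y - lie x z.
Proof. exact: (linfB (lie_linearr x)). Qed.

Lemma lie_lie x y z : lie (lie x y) z = lie x (lie y z) - lie y (lie x z).
Proof. exact: adjoint_act_lie. Qed.

(** [lie1] and [lie2] are the Lie derivatives along x of cochains of degree 1 and 2, and [cob1] is
    the Chevalley-Eilenberg differential in degree 1. *)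
Definition lie1 x psi : g -> g := fun y => lie x (psi y) - psi (lie x y).

Definition lie2 x phi : g -> g -> g :=
  fun y z => lie x (phi y z) - phi (lie x y) z - phi y (lie x z).

Definition cob1 psi : g -> g -> g :=
  fun x y => lie x (psi y) - lie y (psi x) - psi (lie x y).

Definition cochain2 phi := [/\ forall y, linear (phi^~ y),
  forall x, linear (phi x) & forall x, phi x x = 0].

Definition cocycle2 phi := cochain2 phi /\ forall x y z,
  lie x (phi y z) + lie y (phi z x) + lie z (phi x y)
  = phi (lie x y) z + phi (lie y z) x + phi (lie z x) y.

Definition lie_derivation psi :=
  linear psi /\ forall x y, psi (lie x y) = lie (psi x) y + lie x (psi y).

Section Cochain2.
Variables (phi : g -> g -> g) (phic : cochain2 phi).

Lemma cochain2_linl y : linear (phi^~ y). Proof. by case: phic. Qed.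
Lemma cochain2_linr x : linear (phi x). Proof. by case: phic. Qed.
Lemma cochain2xx x : phi x x = 0. Proof. by case: phic. Qed.

Lemma cochain2C x y : phi x y = - phi y x.
Proof.
apply/eqP; rewrite -addr_eq0 -(cochain2xx (x + y)).
rewrite (linfD (cochain2_linl _)) !(linfD (cochain2_linr _)) !cochain2xx.
by rewrite add0r addr0.
Qed.

Lemma cochain20x x : phi 0 x = 0.
Proof. exact: (linf0 (cochain2_linl x)). Qed.

Lemma cochain2x0 x : phi x 0 = 0.
Proof. exact: (linf0 (cochain2_linr x)). Qed.

End Cochain2.

Lemma linear_lie1 x psi : linear psi -> linear (lie1 x psi).
Proof.
move=> psil; apply: linear_sub; apply: linear_comp => //; exact: lie_linearr.
Qed.

Lemma lie1_linear x : linear (lie1 x).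
Proof.
move=> a f h; apply/funext => y; rewrite /lie1 !fctE lie_linearr.
by rewrite opprD scalerBr addrACA.
Qed.

Lemma lie2_linear x : linear (lie2 x).
Proof.
move=> a f h; apply/funext => y; apply/funext => z.
rewrite -[LHS]/(lie x (a *: f y z + h y z) - (a *: f (lie x y) z + h (lie x y) z)
  - (a *: f y (lie x z) + h y (lie x z))) lie_linearr.
rewrite -[RHS]/(a *: (lie x (f y z) - f (lie x y) z - f y (lie x z))
  + (lie x (h y z) - h (lie x y) z - h y (lie x z))).
by rewrite !scalerBr; zmod.
Qed.

Lemma cochain2_cob1 psi : linear psi -> cochain2 (cob1 psi).
Proof.
move=> psil; split=> [y a u v|x a u v|x].
- by rewrite /cob1 !lieDl !lieZl !psil lie_linearr !scalerBr; zmod.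
- by rewrite /cob1 !lieDl !lieZl !(psil, lie_linearr) !scalerBr; zmod.
- by rewrite /cob1 liexx (linf0 psil) subrr subr0.
Qed.

Lemma cob1_lie1 x psi y z : linear psi ->
  cob1 (lie1 x psi) y z = lie2 x (cob1 psi) y z.
Proof.
by move=> psil; rewrite /cob1 /lie1 /lie2 !lieBr !lie_lie !(linfB psil); zmod.
Qed.

Lemma cochain2D_scale a phi phi' :
  cochain2 phi -> cochain2 phi' -> cochain2 (fun x y => a *: phi x y + phi' x y).
Proof.
move=> pc pc'; split=> [y|x|x].
- by apply: linear_add (cochain2_linl pc' y); apply/linear_scale/cochain2_linl.
- by apply: linear_add (cochain2_linr pc' x); apply/linear_scale/cochain2_linr.
- by rewrite !cochain2xx // scaler0 addr0.
Qed.

Lemma cocycle2D_scale a phi phi' :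
  cocycle2 phi -> cocycle2 phi' -> cocycle2 (fun x y => a *: phi x y + phi' x y).
Proof.
move=> [pc pz] [pc' pz']; split; first exact: cochain2D_scale.
move=> x y z; rewrite !lie_linearr.
have -> (u v w u' v' w' : g) : a *: u + u' + (a *: v + v') + (a *: w + w')
    = a *: (u + v + w) + (u' + v' + w') by rewrite !scalerDr; zmod.
by rewrite pz pz' !scalerDr; zmod.
Qed.

Lemma cocycle2_cob1 psi : linear psi -> cocycle2 (cob1 psi).
Proof.
move=> psil; split=> [|x y z]; first exact: cochain2_cob1.
have jac : psi (lie (lie x y) z) + psi (lie (lie y z) x) + psi (lie (lie z x) y) = 0.
  rewrite -!(linfD psil) -(linf0 psil); congr psi.
  rewrite -[RHS]oppr0 -(lie_jacobi x y z) ![lie (lie _ _) _]lieC; zmod.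
apply/eqP; rewrite -subr_eq0 -jac /cob1 !lieBr !lie_lie; apply/eqP; zmod.
Qed.

Section Cocycle2.
Variables (phi : g -> g -> g) (phiz : cocycle2 phi).
Let phic : cochain2 phi := phiz.1.

(** Cartan's formula L_x = d i_x + i_x d, whose last term vanishes on a cocycle. *)
Lemma cartan2 x y z : lie2 x phi y z = cob1 (phi x) y z.
Proof.
have := phiz.2 x y z; rewrite /lie2 /cob1 => /eqP; rewrite -subr_eq0 => /eqP c0.
apply/eqP; rewrite -subr_eq0 -c0.
rewrite (cochain2C phic z x) (cochain2C phic (lie y z) x).
by rewrite (cochain2C phic y (lie x z)) (lieC z x) (linfN (cochain2_linl phic _))
  lieNr; apply/eqP; zmod.
Qed.

Lemma cocycle2_ker_lie u v : (forall z, phi u z = 0) -> (forall z, phi v z = 0) ->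
  forall z, phi (lie u v) z = 0.
Proof.
move=> u0 v0 z; have := phiz.2 u v z.
rewrite u0 v0 (cochain2C phic z u) u0 (cochain2C phic _ u) u0.
by rewrite (cochain2C phic _ v) v0 oppr0 !liex0 !addr0.
Qed.

(** By Cartan's formula phi is invariant under such a u. Applied to the D_k and later to the x_r
    D_s, this gives the equivariance from which constant terms are computed. *)
Lemma cocycle2_ker_lie1 u v : (forall z, phi u z = 0) ->
  forall z, phi (lie u v) z = lie u (phi v z) - phi v (lie u z).
Proof.
move=> u0 z; have := phiz.2 u v z.
rewrite u0 (cochain2C phic z u) u0 oppr0 !liex0 !addr0.
rewrite (cochain2C phic (lie v z)) u0 oppr0 addr0 => ->.
by rewrite (lieC z u) (linfN (cochain2_linl phic v)) (cochain2C phic v (lie u z)); zmod.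
Qed.

End Cocycle2.

Lemma lie1_derivation x psi y : lie_derivation psi -> lie1 x psi y = - lie (psi x) y.
Proof. by case=> psil psiD; rewrite /lie1 psiD; zmod. Qed.

Lemma lie_derivation_cob1 psi : linear psi -> (forall x y, cob1 psi x y = 0) ->
  lie_derivation psi.
Proof.
move=> psil psi0; split=> // x y; apply/eqP; rewrite eq_sym -subr_eq0 -(psi0 x y).
by rewrite /cob1 (lieC (psi x)); apply/eqP; zmod.
Qed.

Lemma lie_derivation_ad z : lie_derivation (lie z).
Proof. by split=> [|x y]; [exact: lie_linearr | rewrite lie_lie; zmod]. Qed.

Lemma lie_derivationB f h : lie_derivation f -> lie_derivation h ->
  lie_derivation (fun x => f x - h x).
Proof.
move=> [fl fD] [hl hD]; split=> [|x y]; first exact: linear_sub.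
by rewrite fD hD lieBl lieBr; zmod.
Qed.

Section PPower.
Variables (p : nat) (charFp : p \in [pchar F]) (odd_p : odd p) (x y : g).
Hypothesis xpy : forall z, iter p (lie x) z = lie y z.

(** Here y plays the role of x^[p]. [lie1 x] is the difference of two commuting operators, [ad x]
    after and before psi, so its p-th power is computed termwise; the sign survives because p is
    odd. *)
Lemma iter_lie1 psi : linear psi -> iter p (lie1 x) psi = lie1 y psi.
Proof.
move=> psil.
pose A (f : g -> g) : g -> g := fun z => lie x (f z).
pose B (f : g -> g) : g -> g := fun z => f (lie x z).
have Al : linear A.
  by move=> a f h; apply/funext => z; rewrite /A !fctE lie_linearr.
have Bl : linear B by [].
have iterA k f z : iter k A f z = iter k (lie x) (f z).
  by elim: k z => //= k IHk z; rewrite /A IHk.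
have iterB k f z : iter k B f z = f (iter k (lie x) z).
  by elim: k z => //= k IHk z; rewrite /B IHk -iterSr.
have -> : iter p (lie1 x) psi = iter p (fun f => A f + (- B f)) psi by [].
rewrite (iter_addP charFp Al (linear_opp Bl)); last first.
  by move=> f; apply/funext => z; rewrite /A /B !fctE lieNr.
by rewrite (iter_oppP Bl) //; apply/funext => z; rewrite !fctE iterA iterB !xpy.
Qed.

Lemma iter_lie2 phi : cochain2 phi -> iter p (lie2 x) phi = lie2 y phi.
Proof.
move=> phic.
pose A (f : g -> g -> g) : g -> g -> g := fun z t => lie x (f z t).
pose B (f : g -> g -> g) : g -> g -> g := fun z t => f (lie x z) t.
pose C (f : g -> g -> g) : g -> g -> g := fun z t => f z (lie x t).
have Al : linear A.
  move=> a f h; apply/funext => z; apply/funext => t.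
  exact: (lie_linearr x a (f z t) (h z t)).
have Bl : linear B by [].
have Cl : linear C by [].
have iterA k f z t : iter k A f z t = iter k (lie x) (f z t).
  by elim: k z t => //= k IHk z t; rewrite /A IHk.
have iterB k f z t : iter k B f z t = f (iter k (lie x) z) t.
  by elim: k z t => //= k IHk z t; rewrite /B IHk -iterSr.
have iterC k f z t : iter k C f z t = f z (iter k (lie x) t).
  by elim: k z t => //= k IHk z t; rewrite /C IHk -iterSr.
have -> : iter p (lie2 x) phi = iter p (fun f => (A f + (- B f)) + (- C f)) phi by [].
rewrite (iter_addP charFp (linear_add Al (linear_opp Bl)) (linear_opp Cl)); last first.
  by move=> f; apply/funext => z; apply/funext => t; rewrite !fctE /A /B /C !fctE lieNr; zmod.
rewrite (iter_addP charFp Al (linear_opp Bl)); last first.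
  by move=> f; apply/funext => z; apply/funext => t; rewrite /A /B !fctE lieNr.
rewrite (iter_oppP Bl) // (iter_oppP Cl) //.
by apply/funext => z; apply/funext => t; rewrite !fctE iterA iterB iterC !xpy.
Qed.

End PPower.

End LieCochains.

(** * Cohomologous cocycles and commutation of Lie derivatives *)

Section CohomologousCocycles.
Variables (F : fieldType) (g : lieAlgType F).
Implicit Types (x y z : g) (psi : g -> g) (phi : g -> g -> g).

Lemma cob1_linear : linear (@cob1 F g).
Proof.
move=> a f h; apply/funext => x; apply/funext => y.
rewrite -[LHS]/(lie x (a *: f y + h y) - lie y (a *: f x + h x)
  - (a *: f (lie x y) + h (lie x y))) !lie_linearr.
rewrite -[RHS]/(a *: (lie x (f y) - lie y (f x) - f (lie x y))
  + (lie x (h y) - lie y (h x) - h (lie x y))).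
by rewrite !scalerBr; zmod.
Qed.

Lemma linear_iter_lie1 x psi k : linear psi -> linear (iter k (lie1 x) psi).
Proof. by move=> psil; elim: k => //= k; apply: linear_lie1. Qed.

Lemma iter_lie2_cob1 x psi k : linear psi ->
  iter k (lie2 x) (cob1 psi) = cob1 (iter k (lie1 x) psi).
Proof.
move=> psil; elim: k => //= k ->; apply/funext => y; apply/funext => z.
by rewrite cob1_lie1 //; apply: linear_iter_lie1.
Qed.

Lemma lie2C x y phi : lie x y = 0 -> lie2 x (lie2 y phi) = lie2 y (lie2 x phi).
Proof.
move=> xy; have xyz z : lie x (lie y z) = lie y (lie x z).
  by apply/eqP; rewrite -subr_eq0 -lie_lie xy lie0x.
apply/funext => u; apply/funext => v; rewrite /lie2 !lieBr !xyz; zmod.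
Qed.

Lemma lie1C x y psi : lie x y = 0 -> lie1 x (lie1 y psi) = lie1 y (lie1 x psi).
Proof.
move=> xy; have xyz z : lie x (lie y z) = lie y (lie x z).
  by apply/eqP; rewrite -subr_eq0 -lie_lie xy lie0x.
apply/funext => u; rewrite /lie1 !lieBr !xyz; zmod.
Qed.

Lemma iter_lie1_ad x z k : iter k (lie1 x) (lie z) = lie (iter k (lie x) z).
Proof.
elim: k => //= k ->; apply/funext => y.
by rewrite /lie1 [in RHS]lie_lie.
Qed.

Lemma cob1E psi x y : cob1 psi x y = lie1 x psi y + lie (psi x) y.
Proof. by rewrite /cob1 /lie1 (lieC (psi x)); zmod. Qed.

Definition cohomologous phi phi' :=
  exists2 psi, linear psi & phi = phi' + cob1 psi.

Lemma cohomologous_refl phi : cohomologous phi phi.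
Proof.
exists (fun => 0); first exact: linear_zero.
apply/funext => x; apply/funext => y.
by rewrite -[RHS]/(phi x y + (lie x 0 - lie y 0 - 0)) !liex0 !subr0 addr0.
Qed.

Lemma cohomologous_trans phi1 phi2 phi3 :
  cohomologous phi1 phi2 -> cohomologous phi2 phi3 -> cohomologous phi1 phi3.
Proof.
move=> [psi psil ->] [psi' psil' ->]; exists (1 *: psi + psi').
  by move=> a x y; rewrite !fctE psil psil' !scale1r scalerDr addrACA.
by rewrite cob1_linear scale1r -addrA; congr (_ + _); apply: addrC.
Qed.

Lemma cohomologous_sub phi psi : linear psi -> cohomologous phi (phi - cob1 psi).
Proof. by move=> psil; exists psi => //; rewrite subrK. Qed.

Lemma cocycle2_sub phi phi' : cocycle2 phi -> cocycle2 phi' -> cocycle2 (phi - phi').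
Proof.
move=> phiz phiz'.
have -> : phi - phi' = fun x y => (-1) *: phi' x y + phi x y.
  by apply/funext => x; apply/funext => y; rewrite !fctE scaleN1r addrC.
exact: cocycle2D_scale.
Qed.

End CohomologousCocycles.

(** * Squaring *)

Section SquaringCocycle.
Variables (F : fieldType) (p : nat) (charFp : p \in [pchar F]) (odd_p : odd p).
Variables (g : lieAlgType F) (gam : g -> g) (gamD : lie_derivation gam).
Let gaml : linear gam := gamD.1.

(** Divided powers absorb the factorials of [Sq], and their Leibniz rule has no binomial
    coefficients. *)
Definition divpow k (x : g) : g := (k`!%:R)^-1 *: iter k gam x.

Lemma divpow_linear k : linear (divpow k).
Proof. exact/linear_scale/linear_iter. Qed.

Lemma gam_divpow k x : (k.+1 < p)%N -> gam (divpow k x) = k.+1%:R *: divpow k.+1 x.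
Proof.
move=> kp; rewrite /divpow (linfZ gaml) scalerA factS natrM invfM mulrA divff ?mul1r //.
by apply: contraTneq (fact_neq0 charFp kp) => k0; rewrite factS natrM k0 mul0r eqxx.
Qed.

Lemma divpow_lie k x y : (k < p)%N ->
  divpow k (lie x y) = \sum_(i < k.+1) lie (divpow i x) (divpow (k - i) y).
Proof.
elim: k => [|k IHk] kp.
  by rewrite big_ord_recl big_ord0 addr0 /divpow fact0 invr1 !scale1r.
have k0 : k.+1%:R != 0 :> F.
  by apply: contraTneq (fact_neq0 charFp kp) => k0; rewrite factS natrM k0 mul0r eqxx.
apply: (scalerI k0); rewrite -(gam_divpow _ kp) (IHk (ltnW kp)) (linf_sum gaml).
transitivity (\sum_(i < k.+1) (i.+1%:R *: lie (divpow i.+1 x) (divpow (k - i) y)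
    + (k - i).+1%:R *: lie (divpow i x) (divpow (k.+1 - i) y))).
  apply: eq_bigr => i _; have ik := ltn_ord i.
  rewrite gamD.2 !gam_divpow ?(lieZl i.+1%:R) ?(lieZr (k - i).+1%:R); try lia.
  by rewrite subSn // -ltnS.
(* Both halves become sums of the [h i] over i <= k + 1, with weights i and k + 1 - i; the added end
   terms have weight 0, and the weights add up to k + 1. *)
pose h (i : nat) := lie (divpow i x) (divpow (k.+1 - i) y).
rewrite big_split /=.
have -> : \sum_(i < k.+1) i.+1%:R *: lie (divpow i.+1 x) (divpow (k - i) y)
    = \sum_(i < k.+2) i%:R *: h i.
  by rewrite [RHS]big_ord_recl /= scale0r add0r; apply: eq_bigr => i _.
have -> : \sum_(i < k.+1) (k - i).+1%:R *: lie (divpow i x) (divpow (k.+1 - i) y)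
    = \sum_(i < k.+2) (k.+1 - i)%:R *: h i.
  rewrite [RHS]big_ord_recr /= subnn scale0r addr0; apply: eq_bigr => i _ /=.
  by rewrite /h subSn // -ltnS.
rewrite -big_split scaler_sumr; apply: eq_bigr => i _ /=; rewrite -[lie _ _]/(h i).
by rewrite -scalerDl -natrD subnKC // -ltnS.
Qed.

Definition sq (x y : g) : g :=
  \sum_(1 <= i < p) lie (divpow i x) (divpow (p - i) y).

Lemma SqE (v : {ffun 'I_2 -> g}) : Sq p gam v = sq (v ord0) (v ord_max).
Proof.
apply: eq_bigr => i _; rewrite /divpow lieZl lieZr scalerA; congr (_ *: _).
by rewrite natrM invfM mulrC.
Qed.

(* The cocycle identity is Jacobi's summed over all i + j + k = p with i, j, k < p. *)
Let term (x y z : g) i j k :=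
  if (i + j + k == p)%N then lie (divpow i x) (lie (divpow j y) (divpow k z)) else 0.
Let triple (x y z : g) :=
  \sum_(0 <= i < p) \sum_(0 <= j < p) \sum_(0 <= k < p) term x y z i j k.

(** The part i = 0 of the triple sum is the first term on the left, and the part i > 0 is the second
    one expanded by the Leibniz rule. *)
Lemma sq_triple x y z : lie x (sq y z) + sq x (lie y z) = triple x y z.
Proof.
have p_gt0 : (0 < p)%N := prime_gt0 (pcharf_prime charFp).
have inner i j : (0 < i + j <= p)%N -> \sum_(0 <= k < p) term x y z i j k
    = lie (divpow i x) (lie (divpow j y) (divpow (p - i - j) z)).
  move=> ijp; rewrite (bigD1_seq (p - i - j)%N) ?iota_uniq ?mem_index_iota //=.
    rewrite /term ifT ?big1 ?addr0 //; last by apply/eqP; lia.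
    by move=> k kne; rewrite ifF //; apply/negP => /eqP; lia.
  by lia.
have inner0 i j : (p < i + j)%N || (i + j == 0)%N ->
    \sum_(0 <= k < p) term x y z i j k = 0.
  move=> ijp; rewrite big_nat big1 // => k kp; rewrite /term ifF //.
  by apply/negP => /eqP; lia.
rewrite /triple big_ltn //; congr (_ + _).
  rewrite big_ltn // inner0 ?orbT // add0r (linf_sum (lie_linearr x)).
  apply: eq_big_nat => j jp; rewrite inner; last by lia.
  by rewrite subn0 /divpow fact0 invr1 scale1r.
apply: eq_big_nat => i ip; rewrite divpow_lie; last by lia.
rewrite (linf_sum (lie_linearr _)) (big_cat_nat (n := (p - i).+1)) //=; last by lia.
rewrite [X in _ = _ + X]big_nat [X in _ = _ + X]big1 ?addr0 => [|j jp]; last by rewrite inner0 //; lia.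
by rewrite big_mkord; apply: eq_bigr => j _; rewrite inner //; have := ltn_ord j; lia.
Qed.

Lemma triple_jacobi x y z : triple x y z + triple y z x + triple z x y = 0.
Proof.
have -> : triple y z x
    = \sum_(0 <= i < p) \sum_(0 <= j < p) \sum_(0 <= k < p) term y z x j k i.
  rewrite /triple; under eq_bigr do rewrite exchange_big /=.
  by rewrite exchange_big.
have -> : triple z x y
    = \sum_(0 <= i < p) \sum_(0 <= j < p) \sum_(0 <= k < p) term z x y k i j.
  rewrite /triple exchange_big /=; apply: eq_bigr => i _.
  by rewrite exchange_big.
rewrite -!big_split big1 // => i _; rewrite -!big_split big1 // => j _.
rewrite -!big_split big1 // => k _ /=; rewrite /term.
have -> : (j + k + i = i + j + k)%N by lia.
have -> : (k + i + j = i + j + k)%N by lia.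
by case: ifP => _; rewrite ?lie_jacobi ?addr0.
Qed.

Lemma sqC x y : sq x y = - sq y x.
Proof.
rewrite /sq [LHS]big_nat_rev -sumrN; apply: eq_big_nat => i /andP[i_gt0 ip] /=.
by rewrite add1n subSS subKn 1?ltnW // lieC.
Qed.

Lemma cocycle2_sq : cocycle2 sq.
Proof.
have two0 : 2%:R != 0 :> F.
  rewrite -(dvdn_pcharf charFp); apply: contraTN odd_p => /dvdn_leq.
  by have := prime_gt1 (pcharf_prime charFp); lia.
split; first split.
- move=> y; apply: (linear_bigsum _ (f := fun i x => lie (divpow i x) _)) => i _.
  exact: linear_comp (lie_linearl _) (divpow_linear _).
- move=> x; apply: (linear_bigsum _ (f := fun i y => lie _ (divpow (p - i) y))) => i _.
  exact: linear_comp (lie_linearr _) (divpow_linear _).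
(* Only antisymmetry is known, so the diagonal vanishes after division by 2. *)
- move=> x; apply: (scalerI two0); rewrite scaler0 scaler_nat mulr2n.
  by rewrite {1}sqC addNr.
move=> x y z; apply/eqP; rewrite -subr_eq0 -(triple_jacobi x y z) -!sq_triple.
by rewrite (sqC (lie x y)) (sqC (lie y z)) (sqC (lie z x)); apply/eqP; zmod.
Qed.

Lemma sq_ker x y : gam x = 0 -> sq x y = 0.
Proof.
move=> x0; rewrite /sq big_nat big1 // => i /andP[]; case: i => // i _ _.
by rewrite /divpow iterSr x0 (linf0 (linear_iter _ gaml)) scaler0 lie0x.
Qed.

End SquaringCocycle.

(** * Lie algebras with a Witt-Jacobson basis *)

Definition mnm_box n p : seq 'X_{1..n} :=
  [seq [multinom (t i : nat) | i < n] | t : {ffun 'I_n -> 'I_p}].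

Lemma mem_mnm_box n p (a : 'X_{1..n}) : (a \in mnm_box n p) = [forall i, (a i < p)%N].
Proof.
apply/imageP/forallP => [[t _ ->] i|ap]; first by rewrite mnmE; exact: ltn_ord.
exists [ffun i => Ordinal (ap i)] => //.
by apply/mnmP => i; rewrite mnmE ffunE.
Qed.

Lemma mnm_box_uniq n p : uniq (mnm_box n p).
Proof.
rewrite map_inj_uniq ?enum_uniq // => t u tu; apply/ffunP => i; apply/val_inj.
by have /mnmP/(_ i) := tu; rewrite !mnmE.
Qed.

(* e a j stands for x^a D_j, and cf for the coordinates. The bracket formula needs
   no range condition: the coefficient vanishes when the subtraction truncates,
   and both sides vanish when an exponent reaches p. *)
Record witt_basis (F : fieldType) (p n : nat) (g : lieAlgType F)
    (e : 'X_{1..n} -> 'I_n -> g) (cf : 'X_{1..n} -> 'I_n -> g -> F) : Prop := {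
  cf_linear : forall a j, linear (cf a j : g -> F^o);
  cf_e : forall (a : 'X_{1..n}) j b k, (forall i, a i < p)%N ->
    cf a j (e b k) = ((a == b) && (j == k))%:R;
  e_big : forall (a : 'X_{1..n}) j i, (p <= a i)%N -> e a j = 0;
  lie_e : forall (a : 'X_{1..n}) j (b : 'X_{1..n}) k, lie (e a j) (e b k)
    = (b j)%:R *: e (a + b - U_(j))%MM k - (a k)%:R *: e (a + b - U_(k))%MM j;
  e_expand : forall z, z = \sum_(a <- mnm_box n p) \sum_j cf a j z *: e a j
}.

Ltac mnm_eval := rewrite ?(mnmDE, mnmBE, mnm1E, mnm0E, mulmnE).
Ltac neq_absurd :=
  match goal with H : is_true (?x != ?x) |- _ => by rewrite eqxx in H end.
Ltac index_simp :=
  repeat match goal with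
    | H : is_true (?x != ?y) |- context [?x == ?y] => rewrite (negPf H)
    | H : is_true (?x != ?y) |- context [?y == ?x] => rewrite (eq_sym y x) (negPf H)
    end;
  rewrite ?eqxx.
Ltac case_index :=
  index_simp; repeat (case: eqVneq => [?|?]; [subst|]; try neq_absurd; index_simp).
Ltac mnm_lia := apply/mnmP => ?; mnm_eval; case_index; try lia.

Section WittBasis.
Variables (F : fieldType) (p : nat) (charFp : p \in [pchar F]) (odd_p : odd p).
Variables (n : nat) (g : lieAlgType F).
Variables (e : 'X_{1..n} -> 'I_n -> g) (cf : 'X_{1..n} -> 'I_n -> g -> F).
Hypothesis eB : witt_basis p e cf.

Definition in_box (a : 'X_{1..n}) := forall i, (a i < p)%N.

Lemma in_boxP a : reflect (in_box a) (a \in mnm_box n p).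
Proof. rewrite mem_mnm_box; exact: forallP. Qed.

Let p_pr : prime p := pcharf_prime charFp.
Let p_gt2 : (2 < p)%N.
Proof. by have := prime_gt1 p_pr; case: p odd_p => [|[|[|]]]. Qed.

Lemma in_box0 : in_box 0%MM.
Proof. by move=> i; rewrite mnm0E prime_gt0. Qed.

Lemma e_out a j : ~ in_box a -> e a j = 0.
Proof.
move/in_boxP; rewrite mem_mnm_box negb_forall => /existsP[i].
rewrite -leqNgt; exact: (e_big eB).
Qed.

Lemma cfD a j x y : cf a j (x + y) = cf a j x + cf a j y.
Proof. exact: (linfD (cf_linear eB a j)). Qed.
Lemma cfZ a j c x : cf a j (c *: x) = c * cf a j x.
Proof. exact: (linfZ (cf_linear eB a j)). Qed.
Lemma cf0 a j : cf a j 0 = 0.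
Proof. exact: (linf0 (cf_linear eB a j)). Qed.
Lemma cfN a j x : cf a j (- x) = - cf a j x.
Proof. exact: (linfN (cf_linear eB a j)). Qed.
Lemma cfB a j x y : cf a j (x - y) = cf a j x - cf a j y.
Proof. exact: (linfB (cf_linear eB a j)). Qed.
Lemma cf_sum a j (I : Type) (r : seq I) (P : pred I) (E : I -> g) :
  cf a j (\sum_(i <- r | P i) E i) = \sum_(i <- r | P i) cf a j (E i).
Proof. exact: (linf_sum (cf_linear eB a j)). Qed.

Lemma eq_on_basis (V : lmodType F) (f h : g -> V) : linear f -> linear h ->
  (forall a j, in_box a -> f (e a j) = h (e a j)) -> f =1 h.
Proof.
move=> fl hl fh z; rewrite (e_expand eB z) (linf_sum fl) (linf_sum hl).
rewrite big_seq [RHS]big_seq; apply: eq_bigr => a /in_boxP ap.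
rewrite (linf_sum fl) (linf_sum hl); apply: eq_bigr => j _.
by rewrite (linfZ fl) (linfZ hl) fh.
Qed.

Lemma cf_inj y z : (forall a j, in_box a -> cf a j y = cf a j z) -> y = z.
Proof.
move=> yz; rewrite (e_expand eB y) (e_expand eB z).
rewrite big_seq [RHS]big_seq; apply: eq_bigr => a /in_boxP ap.
by apply: eq_bigr => j _; rewrite yz.
Qed.

Definition extend (V : lmodType F) (f : 'X_{1..n} -> 'I_n -> V) (z : g) : V :=
  \sum_(a <- mnm_box n p) \sum_j cf a j z *: f a j.

Lemma extend_linear V f : linear (@extend V f).
Proof.
move=> c x y; rewrite scaler_sumr -big_split; apply: eq_bigr => a _ /=.
rewrite scaler_sumr -big_split; apply: eq_bigr => j _ /=.
by rewrite cfD cfZ scalerDl scalerA.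
Qed.

Lemma extendE V f a j : in_box a -> @extend V f (e a j) = f a j.
Proof.
move=> ap; rewrite /extend (bigD1_seq a) ?mnm_box_uniq //=; last exact/in_boxP.
rewrite (bigD1 j) //= (cf_e eB) // !eqxx scale1r.
rewrite big1 => [|k kj]; last first.
  by rewrite (cf_e eB) // eqxx (negPf kj) scale0r.
rewrite addr0 big_seq_cond big1 ?addr0 // => b /andP[/in_boxP bp ba].
by rewrite big1 // => k _; rewrite (cf_e eB) // (negPf ba) scale0r.
Qed.

Definition pd i : g := e 0%MM i.
Definition tor i : g := e U_(i)%MM i.

Lemma lie_pd i a j : lie (pd i) (e a j) = (a i)%:R *: e (a - U_(i))%MM j.
Proof. by rewrite (lie_e eB) mnm0E scale0r subr0 add0m. Qed.

Lemma lie_tor i a j : lie (tor i) (e a j) = ((a i)%:R - (i == j)%:R) *: e a j.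
Proof.
rewrite (lie_e eB) mnm1E scalerBl addmC addmK; congr (_ - _).
case: (eqVneq i j) => [->|_]; last by rewrite !scale0r.
by rewrite addmK.
Qed.

(** Multiplication by x_i in the A(n)-module W(n), the partner of [ad D_i] in the Weyl relation. *)
Definition mulx i : g -> g := extend (fun a j => e (a + U_(i))%MM j).

Lemma mulx_linear i : linear (mulx i). Proof. exact: extend_linear. Qed.

Lemma mulxE i a j : mulx i (e a j) = e (a + U_(i))%MM j.
Proof.
have [ap|ap] := pselect (in_box a); first by rewrite /mulx extendE.
rewrite !e_out ?(linf0 (mulx_linear i)) // => ap'; apply: ap => t.
by have := ap' t; rewrite mnmDE; apply: leq_ltn_trans; rewrite leq_addr.
Qed.

Lemma pd_mulx i z : lie (pd i) (mulx i z) = mulx i (lie (pd i) z) + z.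
Proof.
have Xl := mulx_linear i; have Dl := lie_linearr (pd i).
apply: (eq_on_basis (f := fun z => lie (pd i) (mulx i z))
  (h := fun z => mulx i (lie (pd i) z) + z)) => [||a j _].
- exact: linear_comp.
- by apply: (linear_add (f := fun z => mulx i (lie (pd i) z)) (g := fun z => z));
    first exact: linear_comp.
rewrite mulxE !lie_pd (linfZ Xl) mulxE addmK mnmDE mnm1E eqxx addn1 -natr1.
rewrite scalerDl scale1r; congr (_ + _).
case: (posnP (a i)) => [->|ai]; first by rewrite !scale0r.
by congr (_ *: e _ _); mnm_lia.
Qed.

Lemma pd_mulx_neq i k z : k != i -> lie (pd k) (mulx i z) = mulx i (lie (pd k) z).
Proof.
move=> ki; have Xl := mulx_linear i; have Dl := lie_linearr (pd k).
apply: (eq_on_basis (f := fun z => lie (pd k) (mulx i z))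
  (h := fun z => mulx i (lie (pd k) z))) => [||a j _].
- exact: linear_comp.
- exact: linear_comp.
rewrite mulxE !lie_pd (linfZ Xl) mulxE mnmDE mnm1E eq_sym (negPf ki) addn0.
case: (posnP (a k)) => [->|ak]; first by rewrite !scale0r.
congr (_ *: e _ _); mnm_lia.
Qed.

Lemma lie_pd_pd i k : lie (pd i) (pd k) = 0.
Proof. by rewrite lie_pd mnm0E scale0r. Qed.

Lemma lie_pd_tor i k : lie (pd i) (tor k) = (i == k)%:R *: pd k.
Proof.
rewrite lie_pd mnm1E eq_sym; case: eqVneq => [->|_]; last by rewrite !scale0r.
by congr (_ *: e _ _); mnm_lia.
Qed.

Lemma lie_tor_tor i k : lie (tor i) (tor k) = 0.
Proof. by rewrite lie_tor mnm1E eq_sym subrr scale0r. Qed.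

Lemma lie_tor_pd i k : lie (tor i) (pd k) = - (i == k)%:R *: pd k.
Proof. by rewrite lie_tor mnm0E sub0r. Qed.

Lemma iter_lie_pd i k a j :
  iter k (lie (pd i)) (e a j) = ((a i) ^_ k)%:R *: e (a - U_(i) *+ k)%MM j.
Proof.
elim: k => [|k IHk]; first by rewrite scale1r; congr (e _ _); mnm_lia.
rewrite iterS IHk lieZr lie_pd scalerA -natrM ffactnSr; mnm_eval; rewrite eqxx mul1n.
by congr (_ *: e _ _); mnm_lia.
Qed.

(** Written with [lie 0] to match the p-power hypothesis of [iter_lie1] and [iter_lie2]. *)
Lemma iter_pd_p i z : iter p (lie (pd i)) z = lie 0 z.
Proof.
apply: eq_on_basis => [||a j ap]; [exact/linear_iter/lie_linearr|exact: lie_linearr|].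
by rewrite iter_lie_pd ffact_small // scale0r lie0x.
Qed.

Lemma natB_expp (a b : nat) : (a%:R - b%:R : F) ^+ p = a%:R - b%:R.
Proof.
rewrite -[LHS](pFrobenius_autE charFp) rmorphB /=.
by rewrite !pFrobenius_aut_nat.
Qed.

(** The basis is an eigenbasis of [ad h_i] with eigenvalues in the prime field, where c^p = c. *)
Lemma iter_tor_p i z : iter p (lie (tor i)) z = lie (tor i) z.
Proof.
apply: eq_on_basis => [||a j ap]; [exact/linear_iter/lie_linearr|exact: lie_linearr|].
rewrite lie_tor -[in RHS]natB_expp.
elim: (p) => [|k IHk]; first by rewrite scale1r.
by rewrite iterS IHk lieZr lie_tor scalerA exprSr.
Qed.

Lemma cf_lie_pd i a j z : in_box a ->
  cf a j (lie (pd i) z) = (a i).+1%:R * cf (a + U_(i))%MM j z.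
Proof.
move=> ap; have [aip|aip] := ltnP (a i).+1 p; last first.
  have -> : (a i).+1%:R = 0 :> F.
    by rewrite (_ : (a i).+1 = p) ?(pcharf0 charFp) //; have := ap i; lia.
  rewrite mul0r; apply: (eq_on_basis (V := F^o) (f := fun z => cf a j (lie (pd i) z))
      (h := fun => 0)) => [||b k bp].
  - exact: linear_comp (cf_linear eB a j) (lie_linearr _).
  - exact: linear_zero.
  rewrite lie_pd cfZ (cf_e eB) //; case: eqP => [abE|]; last by rewrite mulr0.
  have := bp i; have : (a i = b i - 1)%N by rewrite abE; mnm_eval; rewrite eqxx.
  by case: (b i) => [|m]; rewrite ?mul0r //; lia.
apply: (eq_on_basis (V := F^o) (f := fun z => cf a j (lie (pd i) z))
    (h := fun z => (a i).+1%:R *: (cf (a + U_(i))%MM j z : F^o))) => [||b k bp].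
- exact: linear_comp (cf_linear eB a j) (lie_linearr _).
- exact/linear_scale/(cf_linear eB).
have aip' : in_box (a + U_(i))%MM.
  by move=> t; mnm_eval; have := ap t; case_index; lia.
rewrite lie_pd cfZ !(cf_e eB) //; case: (posnP (b i)) => bi.
  rewrite bi mul0r; case: eqP => [abE|]; last by rewrite scaler0.
  by move: bi; rewrite -abE; mnm_eval; rewrite eqxx; lia.
have -> : (a == b - U_(i))%MM = ((a + U_(i))%MM == b).
  apply/eqP/eqP => [->|<-]; mnm_lia.
case: eqP => [<-|]; last by rewrite mulr0 scaler0.
by mnm_eval; rewrite eqxx addn1.
Qed.

Lemma cf_lie_tor i a j z : in_box a ->
  cf a j (lie (tor i) z) = ((a i)%:R - (i == j)%:R) * cf a j z.
Proof.
move=> ap; apply: (eq_on_basis (V := F^o) (f := fun z => cf a j (lie (tor i) z))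
    (h := fun z => ((a i)%:R - (i == j)%:R) *: (cf a j z : F^o))) => [||b k bp].
- exact: linear_comp (cf_linear eB a j) (lie_linearr _).
- exact/linear_scale/(cf_linear eB).
rewrite lie_tor cfZ !(cf_e eB) //.
by have [<-|_] := eqVneq a b; have [<-|_] := eqVneq j k; rewrite /= ?mulr0 ?scaler0.
Qed.

Lemma natr_neq0 k : (0 < k < p)%N -> k%:R != 0 :> F.
Proof.
move=> /andP[k0 kp]; rewrite -(dvdn_pcharf charFp).
by apply/negP => /(dvdn_leq k0); lia.
Qed.

Lemma pd_ker z : (forall i, lie (pd i) z = 0) -> z = \sum_l cf 0%MM l z *: pd l.
Proof.
move=> z0; apply: cf_inj => a j ap; rewrite cf_sum.
transitivity ((a == 0%MM)%:R * cf 0%MM j z); last first.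
  rewrite (bigD1 j) //= cfZ (cf_e eB) // eqxx andbT mulrC big1 ?addr0 // => k kj.
  by rewrite cfZ (cf_e eB) // [j == k]eq_sym (negPf kj) andbF mulr0.
case: eqVneq => [->|a_neq0]; first by rewrite mul1r.
have [i ai] : exists i, (0 < a i)%N.
  apply: contrapT => /forallNP a0; case/eqP: a_neq0; apply/mnmP => i; rewrite mnm0E.
  by have := a0 i; lia.
have := congr1 (cf (a - U_(i))%MM j) (z0 i).
have ap' : in_box (a - U_(i))%MM by move=> t; mnm_eval; have := ap t; lia.
rewrite cf_lie_pd // cf0 mul0r => /eqP; rewrite mulf_eq0.
have -> : (a - U_(i) + U_(i))%MM = a by mnm_lia.
rewrite (negPf (natr_neq0 _)) /=; first by move/eqP.
by mnm_eval; rewrite eqxx; have := ap i; lia.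
Qed.

Lemma center0 (z : g) : (forall x, lie x z = 0) -> z = 0.
Proof.
move=> z0; rewrite (pd_ker (fun i => z0 (pd i))) big1 // => l _.
have := congr1 (cf 0%MM l) (z0 (tor l)).
rewrite cf_lie_tor; last exact: in_box0.
by rewrite mnm0E eqxx cf0 sub0r mulN1r => /eqP; rewrite oppr_eq0 => /eqP ->; rewrite scale0r.
Qed.

(** Induction on the degree: once f vanishes in lower degree, all D_i kill f(x^a D_j), which is
    therefore its own constant term. *)
Lemma pd_equivariant0 (f : g -> g) : linear f ->
    (forall i y, lie (pd i) (f y) = f (lie (pd i) y)) ->
    (forall a j l, in_box a -> cf 0%MM l (f (e a j)) = 0) ->
  forall y, f y = 0.
Proof.
move=> fl fD f0; suff: f =1 (fun=> 0) by [].
apply: eq_on_basis => // [|a j]; first exact: linear_zero.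
have [m] := ubnP (mdeg a); elim: m a => // m IHm a am ap.
rewrite [LHS]pd_ker => [|i]; first by rewrite big1 // => l _; rewrite f0 ?scale0r.
rewrite fD lie_pd (linfZ fl); case: (posnP (a i)) => [->|ai]; first by rewrite scale0r.
rewrite IHm ?scaler0 //; last by move=> t; mnm_eval; have := ap t; lia.
suff : (mdeg (a - U_(i)) + 1 = mdeg a)%N by lia.
by rewrite -(mdeg1 i) -mdegD; congr mdeg; mnm_lia.
Qed.

Lemma natr_subp k : (k <= p)%N -> (p - k)%:R = - k%:R :> F.
Proof. by move=> kp; rewrite natrB // (pcharf0 charFp) sub0r. Qed.

(** This converts weight equations, which hold in F, into equalities of exponents. *)
Lemma eq_in_box a b : in_box a -> in_box b ->
  (forall i, (a i)%:R = (b i)%:R :> F) -> a = b.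
Proof.
move=> ap bp ab; apply/mnmP => i.
wlog: a b ap bp ab / (a i <= b i)%N.
  by move=> th; case: (leqP (a i) (b i)) => [|/ltnW] ?; [exact: th | symmetry; exact: th].
move=> ab_i; apply/eqP; rewrite eqn_leq ab_i leqNgt; apply/negP => ba_i.
suff : (b i - a i)%:R != 0 :> F by rewrite natrB // ab subrr eqxx.
by apply: natr_neq0; have := bp i; lia.
Qed.

Lemma mdeg_subU (a : 'X_{1..n}) i : (mdeg a <= (mdeg (a - U_(i))%MM).+1)%N.
Proof.
rewrite -addn1 -(mdeg1 i) -mdegD !mdegE; apply: leq_sum => t _; mnm_eval; lia.
Qed.

Lemma cf0_lie_deg2 a j l z : (1 < mdeg a)%N -> cf 0%MM l (lie (e a j) z) = 0.
Proof.
move=> a2; apply: (eq_on_basis (V := F^o) (f := fun z => cf 0%MM l (lie (e a j) z))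
    (h := fun => 0)) => [||b k bp].
- exact: linear_comp (cf_linear eB _ l) (lie_linearr _).
- exact: linear_zero.
have nz i : (0%MM == a + b - U_(i))%MM = false.
  apply/negP => /eqP/(congr1 (@mdeg n)); rewrite mdeg0.
  by have := mdeg_subU (a + b) i; rewrite mdegD; lia.
by rewrite (lie_e eB) cfB !cfZ !(cf_e eB) ?nz ?mulr0 ?subrr //; exact: in_box0.
Qed.

Lemma cf0_lie_deg1 r s l z :
  cf 0%MM l (lie (e U_(r)%MM s) z) = - (l == s)%:R * cf 0%MM r z.
Proof.
apply: (eq_on_basis (V := F^o) (f := fun z => cf 0%MM l (lie (e U_(r)%MM s) z))
    (h := fun z => - (l == s)%:R *: (cf 0%MM r z : F^o))) => [||b k bp].
- exact: linear_comp (cf_linear eB _ l) (lie_linearr _).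
- exact/linear_scale/(cf_linear eB).
rewrite (lie_e eB) cfB !cfZ !(cf_e eB) //; try exact: in_box0.
case: (posnP (b s)) => bs.
  rewrite bs mul0r sub0r mnm1E; case: (eqVneq r k) => [<-|_]; last first.
    by rewrite andbF mul0r oppr0 scaler0.
  rewrite addmC addmK mul1r andbT.
  by case: (eqVneq 0%MM b) => _; rewrite /= ?scaler0 ?oppr0 // -[RHS]/(_ * _) mulr1.
have nz i : (0%MM == U_(r) + b - U_(i))%MM = false.
  apply/negP => /eqP/(congr1 (@mdeg n)); rewrite mdeg0.
  have := mdeg_subU (U_(r) + b) i; rewrite mdegD mdeg1.
  suff : (0 < mdeg b)%N by lia.
  rewrite lt0n mdeg_eq0; apply: contraTneq bs => ->; by rewrite mnm0E.
rewrite !nz !mulr0 subrr; case: (eqVneq 0%MM b) => [b0|]; last by rewrite scaler0.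
by move: bs; rewrite -b0 mnm0E.
Qed.

(** * Derivations *)

(** Since d commutes with the D_k and h_k, only constant terms of weight zero can survive. Apart
    from d(D_j) = 0 these occur for x_j x_l^(p-1) D_j with l different from j, and that element is a
    multiple of a bracket with x_l^2 D_l. *)
Lemma derivation_eq0 (d : g -> g) : lie_derivation d ->
  (forall k, d (pd k) = 0) -> (forall k, d (tor k) = 0) -> forall y, d y = 0.
Proof.
move=> [dl dD] d_pd d_tor.
have dC i y : lie (pd i) (d y) = d (lie (pd i) y) by rewrite dD d_pd lie0x add0r.
apply: pd_equivariant0 => // a j l ap.
have wt b k m i : in_box b -> cf 0%MM m (d (e b k)) != 0 ->
    (b i)%:R = (i == k)%:R - (i == m)%:R :> F.
  move=> bp c0; apply: (mulIf c0); apply/eqP; rewrite -subr_eq0; apply/eqP.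
  have := congr1 (cf 0%MM m) (dD (tor i) (e b k)).
  rewrite d_tor lie0x add0r cf_lie_tor; last exact: in_box0.
  rewrite lie_tor (linfZ dl) cfZ mnm0E => E.
  transitivity (((b i)%:R - (i == k)%:R) * cf 0%MM m (d (e b k))
    - (0%:R - (i == m)%:R) * cf 0%MM m (d (e b k))); first by ring.
  by rewrite E subrr.
apply/eqP; case: eqVneq => // c0; exfalso; move/negP: c0; apply; apply/eqP.
have [//|c0] := eqVneq (cf 0%MM l (d (e a j))) 0.
case: (eqVneq j l) => [jl|jl].
  suff -> : a = 0%MM by rewrite -/(pd j) d_pd cf0.
  by apply: eq_in_box => // [|i]; [exact: in_box0 | rewrite (wt _ _ _ _ ap c0) jl subrr mnm0E].
have aE : a = (U_(j) + U_(l) *+ p.-1)%MM.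
  apply: eq_in_box => // [i|i]; first by mnm_eval; case_index; lia.
  rewrite (wt _ _ _ _ ap c0); mnm_eval.
  rewrite natrD natrM -subn1 natr_subp ?prime_gt0 // mulrN1.
  by rewrite (eq_sym i) (eq_sym i).
pose u := e (U_(l) *+ 2)%MM l; pose v := e (U_(j) + U_(l) *+ (p - 2))%MM j.
have u_box : in_box (U_(l) *+ 2)%MM by move=> t; mnm_eval; case_index; lia.
(* A constant term along D_m would need 2 = 1 or 2 = 0 in F, by the weight under h_l. *)
have du : d u = 0.
  rewrite (pd_ker (z := d u)) => [|i].
    rewrite big1 // => m _; case: (eqVneq (cf 0%MM m (d u)) 0) => [->|]; first exact: scale0r.
    move/(wt _ _ _ l u_box); mnm_eval; rewrite eqxx => E; exfalso.
    have two0 : 2%:R != 0 :> F by apply: natr_neq0; lia.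
    case: (eqVneq l m) E => _ /= E; first by rewrite E subrr eqxx in two0.
    by move/eqP: E; rewrite subr0 -subr_eq0 -natrB // oner_eq0.
  rewrite dC lie_pd (linfZ dl); mnm_eval; case: eqVneq => [->|_]; last by rewrite scale0r.
  rewrite (_ : U_(i) *+ 2 - U_(i) = U_(i))%MM ?(d_tor i) ?scaler0 //; mnm_lia.
(* d u = 0 and [u, d v] has no constant term. *)
have uv : lie u v = (p - 2)%:R *: e a j.
  rewrite (lie_e eB); mnm_eval; rewrite eqxx [l == j]eq_sym (negPf jl) add0n mul1n.
  rewrite mul0n scale0r subr0 aE; congr (_ *: e _ _); mnm_lia.
have := congr1 (cf 0%MM l) (dD u v); rewrite du lie0x add0r uv (linfZ dl) cfZ.
rewrite cf0_lie_deg2; last by rewrite mdegMn mdeg1.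
move/eqP; rewrite mulf_eq0 (negPf (natr_neq0 _)) /=; first by move/eqP.
by lia.
Qed.

Lemma weyl_sol_pd i v : iter p.-1 (lie (pd i)) v = 0 ->
  exists w, [/\ lie (pd i) w = v,
    forall k, k != i -> lie (pd k) v = 0 -> lie (pd k) w = 0 & v = 0 -> w = 0].
Proof.
move=> v0; pose w := weyl_sol p (lie (pd i)) (mulx i) v.
have Tl := lie_linearr (pd i); have Ml := mulx_linear i.
exists w; split=> [|k ki kv|v00].
- by apply: weyl_solP => //; apply: pd_mulx.
- apply: (weyl_sol_ind _ (P := fun x => lie (pd k) x = 0)) => //.
  + exact: liex0.
  + by move=> a x y x0 y0; rewrite lie_linearr x0 y0 scaler0 addr0.
  + move=> x x0; have := lie_lie (pd k) (pd i) x.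
    by rewrite lie_pd_pd x0 lie0x liex0 subr0 => <-.
  + by move=> x x0; rewrite pd_mulx_neq // x0 (linf0 Ml).
- rewrite /w v00; apply: (weyl_sol_ind _ (P := fun x => x = 0)) => // [a x y -> ->|x ->|x ->].
  + by rewrite scaler0 addr0.
  + exact: liex0.
  + exact: (linf0 Ml).
Qed.

(** The Lie derivative of d along D_i is - ad(d D_i), and its p-th iterate is zero. So the adjoint
    action of the left side vanishes, and the center is trivial. *)
Lemma derivation_pd_iter d i : lie_derivation d -> iter p.-1 (lie (pd i)) (d (pd i)) = 0.
Proof.
move=> dD; have := iter_lie1 charFp odd_p (iter_pd_p i) dD.1.
rewrite -[in iter p](prednK (prime_gt0 p_pr)) iterSr.
have -> : lie1 (pd i) d = lie (- d (pd i)).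
  by apply/funext => y; rewrite lie1_derivation // lieNl.
rewrite iter_lie1_ad => E; apply/eqP; rewrite -oppr_eq0; apply/eqP.
rewrite -(linfN (linear_iter _ (lie_linearr _))); apply: center0 => x.
by rewrite lieC E /lie1 lie0x lie0x (linf0 dD.1) subrr oppr0.
Qed.

Lemma derivation_kill_pd (d : g -> g) m : (m <= n)%N -> lie_derivation d ->
  exists w, forall k : 'I_n, (k < m)%N -> d (pd k) = lie w (pd k).
Proof.
elim: m => [|m IHm] mn dD; first by exists 0.
have [w0 w0P] := IHm (ltnW mn) dD; pose i := Ordinal mn.
pose d' y := d y - lie w0 y.
have d'D : lie_derivation d' := lie_derivationB dD (lie_derivation_ad w0).
have [w [wi wk _]] := weyl_sol_pd (derivation_pd_iter i d'D).
exists (w0 - w) => k; rewrite ltnS leq_eqVlt => /orP[/eqP km|km].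
  have -> : k = i by apply/val_inj.
  by rewrite lieBl -[lie w _]opprK -lieC wi /d'; zmod.
have d'k : d' (pd k) = 0 by rewrite /d' w0P // subrr.
rewrite lieBl [lie w _]lieC wk ?oppr0 ?oppr0 ?addr0 ?w0P //.
  by apply/eqP => ki; move: km; rewrite ki ltnn.
(* As d' kills D_k and [D_k, D_i] = 0, D_k commutes with d'(D_i), hence with the correction w. *)
have := d'D.2 (pd k) (pd i); rewrite lie_pd_pd d'k lie0x add0r => <-.
exact: (linf0 d'D.1).
Qed.

Lemma derivation_inner (d : g -> g) : lie_derivation d -> exists w, forall y, d y = lie w y.
Proof.
move=> dD; have [w0 w0P] := derivation_kill_pd (leqnn n) dD.
pose d1 y := d y - lie w0 y.
have d1D : lie_derivation d1 := lie_derivationB dD (lie_derivation_ad w0).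
have d1_pd k : d1 (pd k) = 0 by rewrite /d1 w0P // subrr.
have d1_tor i : d1 (tor i) = \sum_l cf 0%MM l (d1 (tor i)) *: pd l.
  apply: pd_ker => k; have := d1D.2 (pd k) (tor i).
  rewrite d1_pd lie0x add0r => <-; rewrite lie_pd_tor (linfZ d1D.1).
  by rewrite d1_pd scaler0.
(* From [h_i, h_k] = 0: the D_k-component of [h_i, d1(h_k)] is zero, so that of [d1(h_i), h_k] is
   too. The remaining diagonal part is inner, by a combination of the D_i. *)
have d1_tor0 i k : k != i -> cf 0%MM k (d1 (tor i)) = 0.
  move=> ki; have := congr1 (cf 0%MM k) (d1D.2 (tor i) (tor k)).
  rewrite lie_tor_tor (linf0 d1D.1) cf0 cfD (lieC (d1 _)) cfN.
  rewrite !cf_lie_tor ?mnm0E; try exact: in_box0.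
  rewrite eqxx [i == k]eq_sym (negPf ki) subr0 mul0r addr0 sub0r mulN1r opprK.
  by move=> <-.
pose w1 := \sum_i cf 0%MM i (d1 (tor i)) *: pd i.
exists (w0 + w1) => y; apply/eqP; rewrite -subr_eq0 lieDl opprD addrA; apply/eqP.
apply: (derivation_eq0 (d := fun y => d1 y - lie w1 y)) => [|k|k].
- exact/lie_derivationB/lie_derivation_ad.
- rewrite d1_pd lieC (linf_sum (lie_linearr _)) big1 ?oppr0 ?oppr0 ?addr0 // => i _.
  by rewrite lieZr lie_pd_pd scaler0.
rewrite d1_tor lieC (linf_sum (lie_linearr _)) opprK -big_split big1 // => l _ /=.
rewrite lieZr lie_tor_pd; case: (eqVneq k l) => [<-|kl].
  by rewrite scaleN1r scalerN addrN.
by rewrite (d1_tor0 k l) 1?eq_sym // !(scale0r, oppr0, scaler0) /= add0r.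
Qed.

(** * Normalization of cocycles *)

Definition left_mulx i (psi : g -> g) : g -> g := fun y => mulx i (psi y).

Lemma left_mulx_linear i : linear (left_mulx i).
Proof. by move=> a f h; apply/funext => y; apply: (mulx_linear i). Qed.

(** The Weyl relation on 1-cochains, so that [weyl_sol] applies to them as well. *)
Lemma lie1_left_mulx i psi :
  lie1 (pd i) (left_mulx i psi) = left_mulx i (lie1 (pd i) psi) + psi.
Proof.
apply/funext => y; rewrite /lie1 /left_mulx !fctE pd_mulx.
by rewrite (linfB (mulx_linear i)); zmod.
Qed.

Lemma lie1_left_mulx_neq i k psi : k != i ->
  lie1 (pd k) (left_mulx i psi) = left_mulx i (lie1 (pd k) psi).
Proof.
move=> ki; apply/funext => y; rewrite /lie1 /left_mulx pd_mulx_neq //.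
by rewrite (linfB (mulx_linear i)).
Qed.

(* The iterate is always a derivation: its class is Hochschild's obstruction to
   making phi (pd i) vanish. *)
Definition pd_exact (phi : g -> g -> g) :=
  forall i, iter p.-1 (lie1 (pd i)) (phi (pd i)) = 0.

Lemma iter_predp_pd i (x : g) : lie (pd i) x = 0 ->
  iter p.-1 (lie (pd i)) ((p.-1`!%:R)^-1 *: iter p.-1 (mulx i) x) = x.
Proof.
move=> x0; rewrite (linfZ (linear_iter _ (lie_linearr _))).
rewrite (T_iterT_iterM (lie_linearr _) (mulx_linear i) (pd_mulx i)) //.
by rewrite scalerA mulVf ?scale1r // (fact_neq0 charFp) //; have := prime_gt0 p_pr; lia.
Qed.

(** By Cartan's formula the coboundary of the iterate d_i is (L_(D_i))^p phi = 0, so d_i is a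
    derivation, hence ad z_i. Moreover z_i commutes with D_i because (L_(D_i))^p = 0 on 1-cochains,
    so z_i = (ad D_i)^(p-1) w_i for a suitable w_i. *)
Lemma pd_exact_cohomologous phi : cocycle2 phi ->
  exists2 phi', cohomologous phi phi' & cocycle2 phi' /\ pd_exact phi'.
Proof.
move=> phiz; have phic := phiz.1.
pose d i := iter p.-1 (lie1 (pd i)) (phi (pd i)).
have phil i : linear (phi (pd i)) by exact: cochain2_linr.
have d1 i : lie1 (pd i) (d i) = 0.
  rewrite /d -iterS (prednK (prime_gt0 p_pr)).
  rewrite (iter_lie1 charFp odd_p (iter_pd_p i)) //; apply/funext => y.
  by rewrite /lie1 !lie0x (linf0 (phil i)) subrr.
have dD i : lie_derivation (d i).
  apply: lie_derivation_cob1 => [|x y]; first exact: linear_iter_lie1.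
  rewrite -iter_lie2_cob1 //.
  have -> : cob1 (phi (pd i)) = lie2 (pd i) phi.
    by apply/funext => u; apply/funext => v; rewrite cartan2.
  rewrite -iterSr (prednK (prime_gt0 p_pr)).
  rewrite (iter_lie2 charFp odd_p (iter_pd_p i)) //.
  by rewrite /lie2 !lie0x (cochain20x phic) (cochain2x0 phic) !subrr.
have /choice[z zE] : forall i, exists z, d i = lie z.
  by move=> i; have [w wE] := derivation_inner (dD i); exists w; apply/funext.
have z0 i : lie (pd i) (z i) = 0.
  apply: center0 => x; rewrite lieC; have := congr1 (@^~ x) (d1 i).
  by rewrite zE -[lie1 _ _]/(iter 1 _ _) iter_lie1_ad /= => ->; rewrite oppr0.
pose w i := (p.-1`!%:R)^-1 *: iter p.-1 (mulx i) (z i).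
(* Only psi(D_i) = w_i matters: the term L_(D_i) psi of the correction is annihilated by the
   remaining p - 1 Lie derivatives. *)
pose psi := extend (fun a j => if a == 0%MM then w j else 0).
have psil : linear psi by exact: extend_linear.
have psi_pd i : psi (pd i) = w i by rewrite /psi extendE ?eqxx //; apply: in_box0.
exists (phi - cob1 psi); first exact: cohomologous_sub.
split; first by apply: cocycle2_sub => //; apply: cocycle2_cob1.
move=> i; have -> : (phi - cob1 psi) (pd i)
    = phi (pd i) - lie1 (pd i) psi - lie (w i).
  by apply/funext => y; rewrite !fctE cob1E psi_pd; zmod.
have itl := linear_iter p.-1 (lie1_linear (pd i)).
rewrite (linfB itl) (linfB itl (phi _)) -/(d i) zE iter_lie1_ad iter_predp_pd // -iterSr.
rewrite (prednK (prime_gt0 p_pr)) (iter_lie1 charFp odd_p (iter_pd_p i)) //.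
apply/funext => y; rewrite -[LHS]/(lie (z i) y - (lie 0 (psi y) - psi (lie 0 y)) - lie (z i) y).
by rewrite !lie0x (linf0 psil) subrr subr0 subrr.
Qed.

Definition pd_killed (phi : g -> g -> g) := forall k y, phi (pd k) y = 0.

Lemma lie1_pd_killed phi k x : cocycle2 phi -> lie (pd k) x = 0 ->
  (forall y, phi (pd k) y = 0) -> lie1 (pd k) (phi x) = 0.
Proof.
move=> phiz kx k0; apply/funext => y; have := cartan2 phiz (pd k) x y.
rewrite /lie2 /lie1 kx (cochain20x phiz.1) subr0 => ->.
by rewrite /cob1 !k0 !liex0 !subrr.
Qed.

(** Solve L_(D_i) psi = phi(D_i, -) for the next i. Exactness at all D_k is carried through the
    induction because the later steps need it. *)
Lemma pd_killed_upto phi m : (m <= n)%N -> cocycle2 phi -> pd_exact phi ->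
  exists2 phi', cohomologous phi phi' &
    [/\ cocycle2 phi', pd_exact phi' & forall (k : 'I_n) y, (k < m)%N -> phi' (pd k) y = 0].
Proof.
elim: m => [|m IHm] mn phiz phie.
  by exists phi; [exact: cohomologous_refl | split].
have [phi1 c1 [phi1z phi1e phi10]] := IHm (ltnW mn) phiz phie.
pose i := Ordinal mn; pose psi := weyl_sol p (lie1 (pd i)) (left_mulx i) (phi1 (pd i)).
have fl : linear (phi1 (pd i)) := cochain2_linr phi1z.1 (pd i).
have Tl := lie1_linear (pd i); have Ml := left_mulx_linear i.
have psil : linear psi.
  apply: (weyl_sol_ind _ (P := fun f => linear f)) => //.
  - exact: linear_zero.
  - by move=> a f h fl' hl; apply: linear_add => //; apply: linear_scale.
  - by move=> f fl'; apply: linear_lie1.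
  - by move=> f fl'; apply: linear_comp => //; apply: mulx_linear.
have psiE : lie1 (pd i) psi = phi1 (pd i).
  by apply: weyl_solP => //; apply: lie1_left_mulx.
pose Q k (P : g -> Prop) (f : g -> g) := linear f /\ P (f (pd k)).
(* Since [D_i, D_k] = 0, evaluation at D_k turns the Weyl pair on cochains into the one on W(n); so
   psi(D_k) inherits stable properties of phi1(D_i, D_k). *)
have psi_at k (P : g -> Prop) : P 0 -> (forall a x y, P x -> P y -> P (a *: x + y)) ->
    (forall x, P x -> P (lie (pd i) x)) -> (forall x, P x -> P (mulx i x)) ->
    P (phi1 (pd i) (pd k)) -> P (psi (pd k)).
  move=> P0 PD PT PM Pik; suff [] : Q k P psi by [].
  apply: weyl_sol_ind => //.
  - by split=> //; apply: linear_zero.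
  - move=> a f h [fl' Pf] [hl Ph]; split; last exact: PD.
    by apply: linear_add => //; apply: linear_scale.
  - move=> f [fl' Pf]; split; first exact: linear_lie1.
    by rewrite /lie1 lie_pd_pd (linf0 fl') subr0; apply: PT.
  - move=> f [fl' Pf]; split; last exact: PM.
    by apply: linear_comp => //; apply: mulx_linear.
have psi0 k : phi1 (pd i) (pd k) = 0 -> psi (pd k) = 0.
  apply: (psi_at k (fun x => x = 0)) => // [a x y -> ->|x ->|x ->].
  - by rewrite scaler0 addr0.
  - exact: liex0.
  - exact: (linf0 (mulx_linear i)).
have psi_ii : psi (pd i) = 0 by apply: psi0; rewrite cochain2xx //; case: phi1z.
pose phi' := phi1 - cob1 psi.
have phi'E k : phi' (pd k) = phi1 (pd k) - lie1 (pd k) psi - lie (psi (pd k)).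
  by apply/funext => y; rewrite /phi' !fctE cob1E; zmod.
exists phi'; first exact: cohomologous_trans c1 (cohomologous_sub _ psil).
split; first by apply: cocycle2_sub => //; apply: cocycle2_cob1.
  move=> k; rewrite phi'E.
  have itl := linear_iter p.-1 (lie1_linear (pd k)).
  rewrite (linfB itl) (linfB itl (phi1 _)) phi1e -iterSr (prednK (prime_gt0 p_pr)).
  rewrite (iter_lie1 charFp odd_p (iter_pd_p k)) // iter_lie1_ad.
  suff -> : iter p.-1 (lie (pd k)) (psi (pd k)) = 0.
    apply/funext => y; rewrite -[LHS]/(0 - (lie 0 (psi y) - psi (lie 0 y)) - lie 0 y).
    by rewrite !lie0x (linf0 psil) !subrr.
  have [->|ki] := eqVneq k i.
    by rewrite psi_ii (linf0 (linear_iter _ (lie_linearr _))).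
  have itDl := linear_iter p.-1 (lie_linearr (pd k)).
  (* For phi1(D_i, D_k) = - phi1(D_k, D_i) this is exactness at D_k evaluated at D_i; it is stable
     because D_k commutes with D_i and with multiplication by x_i. *)
  apply: (psi_at k (fun x => iter p.-1 (lie (pd k)) x = 0)).
  - exact: (linf0 itDl).
  - by move=> a x y x0 y0; rewrite itDl x0 y0 scaler0 addr0.
  - move=> x x0; rewrite iter_comm ?x0 ?liex0 // => y.
    have := lie_lie (pd k) (pd i) y; rewrite lie_pd_pd lie0x => /esym/eqP.
    by rewrite subr_eq0 => /eqP.
  - move=> x x0; rewrite iter_comm ?x0 ?(linf0 (mulx_linear i)) // => y.
    exact: pd_mulx_neq.
  have := congr1 (@^~ (pd i)) (phi1e k) => /=.
  have -> : iter p.-1 (lie1 (pd k)) (phi1 (pd k)) (pd i)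
      = iter p.-1 (lie (pd k)) (phi1 (pd k) (pd i)).
    have := cochain2_linr phi1z.1 (pd k); move: (phi1 (pd k)) => f fl'.
    elim: (p.-1) f fl' => // q IHq f fl'; rewrite !iterSr IHq; last exact: linear_lie1.
    by rewrite /lie1 lie_pd_pd (linf0 fl') subr0.
  rewrite (cochain2C phi1z.1) (linfN itDl) => /eqP; rewrite oppr_eq0 => /eqP; exact.
move=> k y; rewrite ltnS leq_eqVlt => /orP[/eqP km|km].
  have -> : k = i by apply/val_inj.
  by rewrite phi'E !fctE psiE psi_ii lie0x subrr subr0.
have ik0 : phi1 (pd i) (pd k) = 0.
  by rewrite (cochain2C phi1z.1) phi10 // oppr0.
have ki : k != i by apply/eqP => ki; move: km; rewrite ki ltnn.
rewrite phi'E !fctE (psi0 k) // lie0x subr0 phi10 // sub0r.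
suff -> : lie1 (pd k) psi = 0 by exact: oppr0.
apply: (weyl_sol_ind _ (P := fun f => lie1 (pd k) f = 0)) => //.
- exact: (linf0 (lie1_linear (pd k))).
- by move=> a f h f0 h0; rewrite lie1_linear f0 h0 scaler0 addr0.
- by move=> f f0; rewrite lie1C ?lie_pd_pd // f0 (linf0 Tl).
- by move=> f f0; rewrite lie1_left_mulx_neq // f0 (linf0 Ml).
- by apply: lie1_pd_killed => //; [exact: lie_pd_pd | move=> z; apply: phi10].
Qed.

Lemma lie2_tor_pd i (phi : g -> g -> g) : cochain2 phi -> pd_killed phi ->
  pd_killed (lie2 (tor i) phi).
Proof.
move=> phic phi0 k y; rewrite /lie2 !phi0 liex0 lie_tor_pd.
by rewrite (linfZ (cochain2_linl phic y)) phi0 scaler0 !subr0.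
Qed.

Lemma cochain2_lie2 x (phi : g -> g -> g) : cochain2 phi -> cochain2 (lie2 x phi).
Proof.
move=> phic; have ll := cochain2_linl phic; have lr := cochain2_linr phic.
split=> [y|y|y].
- apply: linear_sub; last exact: (ll (lie x y)).
  apply: linear_sub; first exact: linear_comp (lie_linearr x) (ll y).
  exact: linear_comp (ll y) (lie_linearr x).
- apply: linear_sub; last exact: linear_comp (lr y) (lie_linearr x).
  apply: linear_sub (lr (lie x y)); exact: linear_comp (lie_linearr x) (lr y).
- by rewrite /lie2 cochain2xx // liex0 (cochain2C phic _ y); zmod.
Qed.

Lemma tor_killed_upto phi m : (m <= n)%N -> cocycle2 phi -> pd_killed phi ->
  exists2 phi', cohomologous phi phi' &
    [/\ cocycle2 phi', pd_killed phi' & forall k : 'I_n, (k < m)%N -> lie2 (tor k) phi' = 0].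
Proof.
elim: m => [|m IHm] mn phiz phi0.
  by exists phi; [exact: cohomologous_refl | split].
have [phi1 c1 [phi1z phi10 phi1t]] := IHm (ltnW mn) phiz phi0.
pose i := Ordinal mn; pose H := lie2 (tor i).
have Hl : linear H := lie2_linear (tor i).
have itl := linear_iter p.-1 Hl.
(* By Cartan's formula H phi1 is the coboundary of phi1(h_i, -), so p - 2 further Lie derivatives
   exhibit H^(p-1) phi1 as a coboundary. *)
pose psi := iter p.-2 (lie1 (tor i)) (phi1 (tor i)).
have fl := cochain2_linr phi1z.1 (tor i).
have psil : linear psi by exact: linear_iter_lie1.
have psiE : cob1 psi = iter p.-1 H phi1.
  rewrite /psi -iter_lie2_cob1 //.
  have -> : cob1 (phi1 (tor i)) = H phi1.
    by apply/funext => u; apply/funext => v; rewrite /H cartan2.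
  by rewrite -iterSr (_ : p.-2.+1 = p.-1) //; lia.
exists (phi1 - cob1 psi); first exact: cohomologous_trans c1 (cohomologous_sub _ psil).
split; first by apply: cocycle2_sub => //; apply: cocycle2_cob1.
  move=> k y; rewrite !fctE phi10 psiE sub0r.
  suff [_ ->] : cochain2 (iter p.-1 H phi1) /\ pd_killed (iter p.-1 H phi1).
    by rewrite oppr0.
  elim: (p.-1) => [|q [IHc IH0]] /=; first by split=> //; case: phi1z.
  by split; [exact: cochain2_lie2 | exact: lie2_tor_pd].
move=> k; rewrite ltnS leq_eqVlt => /orP[/eqP km|km].
  have -> : k = i by apply/val_inj.
  rewrite -/H (linfB Hl) psiE -iterS (prednK (prime_gt0 p_pr)).
  by rewrite (iter_lie2 charFp odd_p (iter_tor_p i)) ?subrr //; case: phi1z.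
rewrite (linfB (lie2_linear _)) phi1t // psiE sub0r.
suff -> : lie2 (tor k) (iter p.-1 H phi1) = 0 by rewrite oppr0.
elim: (p.-1) => [|q IHq] /=; first exact: phi1t.
by rewrite lie2C ?lie_tor_tor // IHq (linf0 (lie2_linear _)).
Qed.

Definition normalized (phi : g -> g -> g) := [/\ cocycle2 phi, pd_killed phi &
  forall k y, phi (tor k) y = 0].

(** With weight zero, Cartan's formula makes phi(h_i, -) a derivation. It kills the D_k, and
    phi(h_i, h_k) is a constant field commuting with every h_l, hence zero because [h_l, D_l] = -
    D_l. *)
Lemma normalize phi : cocycle2 phi ->
  exists2 phi', cohomologous phi phi' & normalized phi'.
Proof.
move=> phiz; have [phi1 c1 [phi1z phi1e]] := pd_exact_cohomologous phiz.
have [phi2 c2 [phi2z _ phi20]] := pd_killed_upto (leqnn n) phi1z phi1e.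
have phi2k : pd_killed phi2 by move=> k y; apply: phi20.
have [phi3 c3 [phi3z phi3k phi3t]] := tor_killed_upto (leqnn n) phi2z phi2k.
exists phi3; first exact: cohomologous_trans c1 (cohomologous_trans c2 c3).
split=> // i; have phic := phi3z.1.
have fl := cochain2_linr phic (tor i).
apply: derivation_eq0 => [|k|k].
- apply: lie_derivation_cob1 => // x y.
  by rewrite -cartan2 // phi3t.
- by rewrite (cochain2C phic) phi3k oppr0.
rewrite [LHS]pd_ker => [|j].
  rewrite big1 // => l _; have := congr1 (fun f => f (tor i) (tor k)) (phi3t l (ltn_ord l)).
  rewrite /lie2 !lie_tor_tor (cochain20x phic) (cochain2x0 phic) !subr0.
  move/(congr1 (cf 0%MM l)); rewrite cf_lie_tor; last exact: in_box0.
  rewrite mnm0E eqxx cf0 sub0r mulN1r => /eqP; rewrite oppr_eq0 => /eqP ->.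
  by rewrite scale0r.
have := cartan2 phi3z (pd j) (tor i) (tor k).
rewrite /lie2 /cob1 !phi3k !liex0 !subr0 !lie_pd_tor.
rewrite (linfZ (cochain2_linl phic _)) (linfZ (cochain2_linr phic _)).
by rewrite (cochain2C phic (tor i) (pd _)) !phi3k oppr0 !scaler0 !subr0.
Qed.

(* Identities between exponents that hold whatever the coincidences between indices. *)
Ltac mnm_bool :=
  apply/mnmP => ?; mnm_eval;
  repeat match goal with |- context [nat_of_bool ?b] => move: (nat_of_bool b) => ? end;
  move: (p) p_gt2; clear; case=> [|[|[|?]]] // _;
  rewrite ?subSS ?subn0 /= ?mulnS; lia.
Ltac mdeg_lia := rewrite ?(mdegD, mdegMn, mdeg1); lia.
Ltac gl_eval := mnm_eval; index_simp;
  rewrite ?(mul0n, mul1n, mul0r, mul1r, add0n, addn0, add0r, addr0, subr0, sub0r, oppr0).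

Lemma in_box1 i : in_box U_(i)%MM.
Proof. by move=> t; mnm_eval; case: eqP => _ /=; have := p_gt2; lia. Qed.

Lemma in_box_addU (a : 'X_{1..n}) i : in_box a -> (a i < p.-1)%N -> in_box (a + U_(i))%MM.
Proof.
move=> ap ai t; mnm_eval; have := ap t.
by case: (eqVneq i t) => [<-|_]; rewrite /= ?addn0 // => _; lia.
Qed.

Lemma in_box_addMU (a : 'X_{1..n}) i (k : nat) : in_box a -> a i = 0%N -> (k < p)%N -> in_box (a + U_(i) *+ k)%MM.
Proof.
move=> ap ai kp t; mnm_eval; have := ap t.
by case: (eqVneq i t) => [<-|_] /=; rewrite ?ai ?mul1n ?mul0n ?addn0.
Qed.

Lemma in_boxMU i (k : nat) : (k < p)%N -> in_box (U_(i) *+ k)%MM.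
Proof. by move=> kp; rewrite -[(_ *+ _)%MM]add0m; apply: in_box_addMU; rewrite ?mnm0E // => t; rewrite mnm0E; lia. Qed.

Lemma ltn_predp : (p.-1 < p)%N. Proof. lia. Qed.
Lemma ltn_subp (k : nat) : (0 < k)%N -> (p - k < p)%N. Proof. lia. Qed.
Lemma bool_ltn_predp (b : bool) : (b < p.-1)%N. Proof. case: b; lia. Qed.

Ltac box :=
  lazymatch goal with
  | |- in_box (mnm_add _ (mnm_muln _ _)) => refine (in_box_addMU _ _ _);
      [box | by mnm_eval; index_simp | first [exact: ltn_predp | exact: ltn_subp]]
  | |- in_box (mnm_add _ _) => refine (in_box_addU _ _);
      [box | by mnm_eval; index_simp; apply: bool_ltn_predp]
  | |- in_box (mnm_muln _ _) =>
      refine (in_boxMU _ _); first [exact: ltn_predp | exact: ltn_subp]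
  | |- in_box (mnm1 _) => exact: in_box1
  end.

Let natp1 : p.-1%:R = -1 :> F.
Proof. by rewrite -subn1 natr_subp // prime_gt0. Qed.

Let two_neq0 : 2%:R != 0 :> F. Proof. by apply: natr_neq0; lia. Qed.

(** In F, p - 1 and p - 2 become -1 and -2, which leaves a ring identity between Kronecker
    deltas. *)
Ltac weight_ring :=
  let t := fresh in
  move=> t; mnm_eval; rewrite ?natrD ?natrM ?natp1 ?natr_subp 1?ltnW // !(eq_sym t); ring.

(** * Constant terms of normalized cocycles *)

Section NormalizedCocycle.
Variables (phi : g -> g -> g) (phiN : normalized phi).
Implicit Types (a b : 'X_{1..n}) (c d i j k l m r s t : 'I_n).
Let phiz : cocycle2 phi. Proof. by case: phiN. Qed.
Let phic : cochain2 phi := phiz.1.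
Let phi_pd : pd_killed phi. Proof. by case: phiN. Qed.
Let phi_tor k y : phi (tor k) y = 0. Proof. by case: phiN. Qed.

(* phi commutes with the D_i, hence is determined by these constant terms. *)
Definition lowest l a j b k : F := cf 0%MM l (phi (e a j) (e b k)).
Local Notation G := lowest.

Lemma lowestC l a j b k : G l a j b k = - G l b k a j.
Proof. by rewrite /lowest (cochain2C phic) cfN. Qed.

Lemma lowest_out l a j b k i : (p <= b i)%N -> G l a j b k = 0.
Proof. by move=> bi; rewrite /lowest (e_big eB _ bi) (cochain2x0 phic) cf0. Qed.

(** Invariance under h_i: the weights of the two arguments add up to the weight of D_l. *)
Lemma lowest_weight l a j b k i : G l a j b k != 0 ->
  (b i)%:R = (i == j)%:R + (i == k)%:R - (a i)%:R - (i == l)%:R :> F.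
Proof.
move=> c0; apply: (mulIf c0).
have := cartan2 phiz (tor i) (e a j) (e b k).
rewrite /cob1 !phi_tor !liex0 !subr0 /lie2 => /(congr1 (cf 0%MM l)).
rewrite cf0 !cfB cf_lie_tor ?mnm0E; last exact: in_box0.
rewrite !lie_tor (linfZ (cochain2_linl phic _)) (linfZ (cochain2_linr phic _)) !cfZ.
rewrite -/(lowest l a j b k) => E; apply/eqP; rewrite -subr_eq0 -oppr_eq0; apply/eqP.
by rewrite -[RHS]E; ring.
Qed.

(** Once the brackets [D_k, u] are in the kernel, phi(u, -) commutes with the D_k, and its constant
    terms decide. *)
Lemma lowest_eq0 u : (forall k y, phi (lie (pd k) u) y = 0) ->
  (forall l b k, in_box b -> cf 0%MM l (phi u (e b k)) = 0) -> forall y, phi u y = 0.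
Proof.
move=> u0 c0; apply: pd_equivariant0 => [|i y|b k m bp]; last exact: c0.
  exact: cochain2_linr.
have := cocycle2_ker_lie1 phiz u (phi_pd i) y; rewrite u0 => /esym/eqP.
by rewrite subr_eq0 => /eqP.
Qed.

Lemma lowest_lie_l l (x : 'X_{1..n}) a j (y : g) k :
  cf 0%MM l (phi (lie (e x k) (e a j)) y)
  = (a k)%:R * cf 0%MM l (phi (e (x + a - U_(k))%MM j) y)
    - (x j)%:R * cf 0%MM l (phi (e (x + a - U_(j))%MM k) y).
Proof.
have ll := cochain2_linl phic y.
by rewrite (lie_e eB) (linfB ll) !(linfZ ll) cfB !cfZ.
Qed.

Lemma lowest_lie_r l (x : 'X_{1..n}) a j (y : g) k :
  cf 0%MM l (phi y (lie (e x k) (e a j)))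
  = (a k)%:R * cf 0%MM l (phi y (e (x + a - U_(k))%MM j))
    - (x j)%:R * cf 0%MM l (phi y (e (x + a - U_(j))%MM k)).
Proof.
have lr := cochain2_linr phic y.
by rewrite (lie_e eB) (linfB lr) !(linfZ lr) cfB !cfZ.
Qed.

(* The constant term of the cocycle identity on x_r D_s, x_c D_d, x^b D_k. *)
Lemma lowest_gl l r s c d b k : (1 < mdeg b)%N ->
  (b s)%:R * G l U_(c)%MM d (U_(r) + b - U_(s))%MM k
  - (r == k)%:R * G l U_(c)%MM d b s
  - (b d)%:R * G l U_(r)%MM s (U_(c) + b - U_(d))%MM k
  + (c == k)%:R * G l U_(r)%MM s b d
  + (c == s)%:R * G l U_(r)%MM d b k - (r == d)%:R * G l U_(c)%MM s b k
  = (l == d)%:R * G c U_(r)%MM s b k - (l == s)%:R * G r U_(c)%MM d b k.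
Proof.
move=> b2; have := phiz.2 (e U_(r)%MM s) (e U_(c)%MM d) (e b k).
move/(congr1 (cf 0%MM l)); rewrite !cfD !cf0_lie_deg1 cf0_lie_deg2 // addr0.
rewrite (cochain2C phic (e b k) (e U_(r)%MM s)).
rewrite (cochain2C phic (lie (e U_(c)%MM d) _)) (lieC (e b k)).
rewrite (linfN (cochain2_linl phic _)) (cochain2C phic (lie (e U_(r)%MM s) (e b k))).
rewrite opprK !cfN lowest_lie_l !lowest_lie_r /lowest !mnm1E.
have -> : (c == s)%:R * cf 0%MM l (phi (e (U_(r) + U_(c) - U_(s))%MM d) (e b k))
    = (c == s)%:R * cf 0%MM l (phi (e U_(r)%MM d) (e b k)).
  by case: eqVneq => [->|]; rewrite ?mul0r // addmK.
have -> : (r == d)%:R * cf 0%MM l (phi (e (U_(r) + U_(c) - U_(d))%MM s) (e b k))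
    = (r == d)%:R * cf 0%MM l (phi (e U_(c)%MM s) (e b k)).
  by case: eqVneq => [->|]; rewrite ?mul0r // addmC addmK.
have -> (t m : 'I_n) x : (t == k)%:R * cf 0%MM l (phi x (e (U_(t) + b - U_(k))%MM m))
    = (t == k)%:R * cf 0%MM l (phi x (e b m)).
  by case: eqVneq => [->|]; rewrite ?mul0r // addmC addmK.
have -> (t m : 'I_n) x : (t == k)%:R * cf 0%MM l (phi x (e (U_(t) + b - U_(k))%MM m))
    = (t == k)%:R * cf 0%MM l (phi x (e b m)).
  by case: eqVneq => [->|]; rewrite ?mul0r // addmC addmK.
move=> /eqP; rewrite -subr_eq0 => /eqP E; apply/eqP; rewrite -subr_eq0; apply/eqP.
by rewrite -[RHS]oppr0 -[in RHS]E; ring.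
Qed.

(* The weights of the h_i leave these six families of constant terms of
   phi (x_i D_j, -). *)
Local Notation v1 i j l := (G l U_(i)%MM j (U_(j) + U_(l) *+ p.-1)%MM i).
Local Notation v2 i j m := (G j U_(i)%MM j (U_(m) + U_(i) *+ p.-1)%MM m).
Local Notation v3 i j l := (G l U_(i)%MM j (U_(j) + U_(i) *+ p.-1)%MM l).
Local Notation v4 i j m l :=
  (G l U_(i)%MM j (U_(m) + U_(j) + U_(i) *+ p.-1 + U_(l) *+ p.-1)%MM m).
Local Notation v5 i j := (G i U_(i)%MM j (U_(j) + U_(i) *+ p.-1)%MM i).
Local Notation v6 i j m := (G i U_(i)%MM j (U_(m) + U_(j) + U_(i) *+ (p - 2))%MM m).

(** In this and the next five lemmas the third argument of the cocycle identity is chosen so that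
    few terms remain; the others drop out because indices differ, an exponent reaches p, or some x_k
    D_k occurs. *)
Lemma v6_sym i j k m : j != i -> k != i -> m != i -> j != k ->
  (1 + (m == k))%:R * v6 i j m = (1 + (m == j))%:R * v6 i k m.
Proof.
move=> ji ki mi jk.
have := @lowest_gl i i j i k (U_(m) + U_(j) + U_(k) + U_(i) *+ (p - 3))%MM m.
gl_eval; move=> /(_ ltac:(mdeg_lia)) /=.
rewrite [(_ - U_(j))%MM](_ : _ = U_(m) + U_(k) + U_(i) *+ (p - 2))%MM; last by mnm_bool.
rewrite [(_ - U_(k))%MM](_ : _ = U_(m) + U_(j) + U_(i) *+ (p - 2))%MM; last by mnm_bool.
by rewrite ![((_ == _) + _)%N]addnC => /eqP; rewrite subr_eq0 => /eqP.
Qed.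

Let lowest_tor l k b j : G l U_(k)%MM k b j = 0.
Proof. by rewrite /lowest phi_tor cf0. Qed.

Lemma v2E i j m : j != i -> m != i -> v2 i j m = v6 i j m + (j == m)%:R * v5 i j.
Proof.
move=> ji mi.
have := @lowest_gl i j i i j (U_(m) + U_(i) *+ p.-1)%MM m.
gl_eval; move=> /(_ ltac:(mdeg_lia)) /=.
rewrite [G _ _ _ (_ - U_(j))%MM _](lowest_out _ _ _ _ (i := i)); last first.
  by mnm_eval; index_simp; lia.
rewrite natp1 !lowest_tor.
rewrite [(_ - U_(i))%MM](_ : _ = U_(m) + U_(j) + U_(i) *+ (p - 2))%MM; last by mnm_bool.
by case: (eqVneq j m) => [<-|_] E; rewrite -[LHS]opprK -E /=; ring.
Qed.

Lemma v3E i j l : j != i -> l != i -> l != j -> v3 i j l = v5 i j + v2 i l j.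
Proof.
move=> ji li lj.
have := @lowest_gl l i l i j (U_(j) + U_(i) *+ p.-1)%MM i.
gl_eval; move=> /(_ ltac:(mdeg_lia)) /=.
rewrite [G _ _ _ (_ - U_(j))%MM _](lowest_out _ _ _ _ (i := i)); last first.
  by mnm_eval; index_simp; lia.
by move=> E; rewrite -[LHS]opprK -(opprK (v5 i j)) -E /=; ring.
Qed.

Lemma v1E i j l : j != i -> l != i -> l != j ->
  2%:R * v1 i j l = 2%:R * v6 l j i - v6 l j j.
Proof.
move=> ji li lj.
have := @lowest_gl l l j i j (U_(j) + U_(j) + U_(l) *+ (p - 2))%MM i.
gl_eval; move=> /(_ ltac:(mdeg_lia)) /=.
rewrite [(U_(l) + _ - U_(j))%MM](_ : _ = U_(j) + U_(l) *+ p.-1)%MM; last by mnm_bool.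
rewrite [(U_(i) + _ - U_(j))%MM](_ : _ = U_(i) + U_(j) + U_(l) *+ (p - 2))%MM; last by mnm_bool.
move=> E; apply/eqP; rewrite -subr_eq0; apply/eqP; rewrite -[RHS]E; ring.
Qed.

Lemma v5_sym i j k : j != i -> k != i -> j != k -> v5 i j = v1 k j i + v5 i k.
Proof.
move=> ji ki jk.
have := @lowest_gl i k j i k (U_(j) + U_(i) *+ p.-1)%MM i.
gl_eval; move=> /(_ ltac:(mdeg_lia)) /=.
rewrite [(U_(k) + _ - U_(j))%MM](_ : _ = U_(k) + U_(i) *+ p.-1)%MM; last by mnm_bool.
by move=> E; apply/eqP; rewrite -subr_eq0 -oppr_eq0; apply/eqP; rewrite -[RHS]E; ring.
Qed.

Lemma v4_eq0 i j m l : j != i -> l != i -> l != j -> m != i -> m != l -> v4 i j m l = 0.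
Proof.
move=> ji li lj mi ml.
have := @lowest_gl l l m i j
  (U_(m) + U_(j) + U_(i) *+ p.-1 + U_(l) *+ p.-1)%MM l.
gl_eval; move=> /(_ ltac:(mdeg_lia)) /=.
rewrite [G _ _ _ (_ - U_(m))%MM _](lowest_out _ _ _ _ (i := l)); last first.
  by mnm_eval; index_simp; lia.
rewrite [G _ _ _ (_ - U_(j))%MM _](lowest_out _ _ _ _ (i := i)); last first.
  by mnm_eval; index_simp; lia.
by move=> E; apply/eqP; rewrite -oppr_eq0; apply/eqP; rewrite -[RHS]E; ring.
Qed.

(** * Putting the x_i D_j into the kernel *)

Section GlKilled.
Hypothesis v6_diag : forall i m, m != i -> v6 i m m = 0.

(** For j different from m, [v6_sym] gives 2 v6(i,j,m) = v6(i,m,m), so the diagonal values suffice.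
    Those are the ones the trace coboundaries adjust. *)
Lemma v6_eq0 i j m : j != i -> m != i -> v6 i j m = 0.
Proof.
move=> ji mi; have [->|mj] := eqVneq m j; first exact: v6_diag.
have := v6_sym ji mi mi _; rewrite eq_sym => /(_ mj); rewrite eqxx v6_diag // mulr0.
by move/eqP; rewrite mulf_eq0 (negPf two_neq0) => /eqP.
Qed.

Lemma v1_eq0 i j l : j != i -> l != i -> l != j -> v1 i j l = 0.
Proof.
move=> ji li lj; apply: (mulfI two_neq0); rewrite v1E // !v6_eq0 1?eq_sym //.
by rewrite mulr0 subr0.
Qed.

Hypothesis v5_some : forall i, exists2 j, j != i & v5 i j = 0.

(** Once v1 = 0, v5(i,j) does not depend on j; so one scalar per i, the coefficient of Sq(D_i), is
    enough to remove it. *)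
Lemma v5_eq0 i j : j != i -> v5 i j = 0.
Proof.
move=> ji; have [k ki v5k] := v5_some i; have [<-//|kj] := eqVneq k j.
by rewrite (v5_sym ji ki) 1?eq_sym // v5k v1_eq0 1?eq_sym // addr0.
Qed.

Lemma v2_eq0 i j m : j != i -> m != i -> v2 i j m = 0.
Proof. by move=> ji mi; rewrite v2E // v6_eq0 // v5_eq0 // mulr0 addr0. Qed.

Lemma v3_eq0 i j l : j != i -> l != i -> l != j -> v3 i j l = 0.
Proof. by move=> ji li lj; rewrite v3E // v5_eq0 // v2_eq0 // addr0. Qed.

Lemma gl_killed i j y : phi (e U_(i)%MM j) y = 0.
Proof.
have [<-|ij] := eqVneq i j; first exact: phi_tor.
have ji : j != i by rewrite eq_sym.
apply: lowest_eq0 => [k z|l b m bp].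
  rewrite lie_pd mnm1E (linfZ (cochain2_linl phic z)); case: (eqVneq i k) => [->|_].
    rewrite (_ : U_(k) - U_(k) = 0)%MM ?phi_pd ?scaler0 //.
    by apply/mnmP => t; mnm_eval; rewrite subnn.
  by rewrite scale0r.
rewrite -[LHS]/(G l U_(i)%MM j b m); apply/eqP; apply: contraT => W.
(* For given l and m the weights leave a single exponent b; the coincidences among i, j, l, m select
   the family it belongs to. *)
have bE b' : in_box b' -> (forall t, (b' t)%:R
    = (t == j)%:R + (t == m)%:R - (t == i)%:R - (t == l)%:R :> F) -> b = b'.
  move=> bp' b't; apply: eq_in_box => // t; rewrite b't (lowest_weight _ W) mnm1E.
  by rewrite (eq_sym i).
have [li|li] := eqVneq l i.
  rewrite li in W bE; have [mi|mi] := eqVneq m i.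
    rewrite mi in W bE; rewrite (bE (U_(j) + U_(i) *+ p.-1)%MM) in W.
    - by rewrite v5_eq0 ?eqxx in W.
    - by box.
    - weight_ring.
  rewrite (bE (U_(m) + U_(j) + U_(i) *+ (p - 2))%MM) in W.
  - by rewrite v6_eq0 ?eqxx in W.
  - by box.
  - weight_ring.
have [mi|mi] := eqVneq m i.
  rewrite mi in W bE; have [lj|lj] := eqVneq l j.
    (* Here the second argument is D_i itself, which is already in the kernel. *)
    rewrite lj in W bE; rewrite (bE 0%MM) in W.
    - by rewrite lowestC /lowest phi_pd cf0 oppr0 eqxx in W.
    - exact: in_box0.
    - weight_ring.
  rewrite (bE (U_(j) + U_(l) *+ p.-1)%MM) in W.
  - by rewrite v1_eq0 ?eqxx in W.
  - by box.
  - weight_ring.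
have [lj|lj] := eqVneq l j.
  rewrite lj in W bE; rewrite (bE (U_(m) + U_(i) *+ p.-1)%MM) in W.
  - by rewrite v2_eq0 ?eqxx in W.
  - by box.
  - weight_ring.
have [ml|ml] := eqVneq m l.
  rewrite ml in W bE; rewrite (bE (U_(j) + U_(i) *+ p.-1)%MM) in W.
  - by rewrite v3_eq0 ?eqxx in W.
  - by box.
  - weight_ring.
rewrite (bE (U_(m) + U_(j) + U_(i) *+ p.-1 + U_(l) *+ p.-1)%MM) in W.
- by rewrite v4_eq0 ?eqxx in W.
- by box.
- weight_ring.
Qed.

End GlKilled.

(** * Putting the x_i^2 D_i into the kernel *)

Section GlEquivariant.
Hypothesis glk : forall i j y, phi (e U_(i)%MM j) y = 0.

Lemma lowest_equiv l r s a j b k :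
  (a s)%:R * G l (U_(r) + a - U_(s))%MM j b k - (r == j)%:R * G l a s b k
  + (b s)%:R * G l a j (U_(r) + b - U_(s))%MM k - (r == k)%:R * G l a j b s
  = - (l == s)%:R * G r a j b k.
Proof.
have := cocycle2_ker_lie1 phiz (e a j) (glk r s) (e b k).
move/(congr1 (cf 0%MM l)); rewrite cfB cf0_lie_deg1 lowest_lie_l lowest_lie_r !mnm1E.
rewrite -/(lowest r a j b k) -!/(lowest _ _ _ _ _).
have -> : (r == j)%:R * G l (U_(r) + a - U_(j))%MM s b k = (r == j)%:R * G l a s b k.
  by case: eqVneq => [->|]; rewrite ?mul0r // addmC addmK.
have -> : (r == k)%:R * G l a j (U_(r) + b - U_(k))%MM s = (r == k)%:R * G l a j b s.
  by case: eqVneq => [->|]; rewrite ?mul0r // addmC addmK.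
move=> E; apply/eqP; rewrite -subr_eq0; move/eqP: E; rewrite -subr_eq0 => /eqP E.
by apply/eqP; rewrite -[RHS]E; ring.
Qed.

(* The same for phi (x_i^2 D_i, -). *)
Local Notation s1 i := (G i (U_(i) *+ 2)%MM i (U_(i) *+ p.-1)%MM i).
Local Notation s2 i m := (G i (U_(i) *+ 2)%MM i (U_(m) + U_(i) *+ (p - 2))%MM m).
Local Notation s3 i l := (G l (U_(i) *+ 2)%MM i (U_(l) *+ p.-1)%MM i).
Local Notation s4 i l := (G l (U_(i) *+ 2)%MM i (U_(i) *+ p.-1)%MM l).
Local Notation s5 i m l :=
  (G l (U_(i) *+ 2)%MM i (U_(m) + U_(i) *+ p.-1 + U_(l) *+ p.-1)%MM m).
Local Notation q i m := (G i (U_(i) *+ 2)%MM m (U_(m) *+ 2 + U_(i) *+ (p - 3))%MM m).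

Lemma s2E i m : m != i -> 2%:R * s2 i m = q i m.
Proof.
move=> mi; have := lowest_equiv i i m (U_(i) *+ 2)%MM i
  (U_(m) *+ 2 + U_(i) *+ (p - 3))%MM m.
gl_eval; rewrite /=.
rewrite [(U_(i) + (_ + _) - U_(m))%MM](_ : _ = U_(m) + U_(i) *+ (p - 2))%MM; last by mnm_bool.
by move=> E; apply/eqP; rewrite -subr_eq0; apply/eqP; rewrite -[RHS]E; ring.
Qed.

Lemma s3_char3 i l : l != i -> p = 3%N -> s3 i l = 0.
Proof.
move=> li p3; have := lowest_equiv l l i (U_(i) *+ 2)%MM i (U_(i) + U_(l))%MM i.
gl_eval; rewrite /=.
rewrite [(U_(l) + U_(i) *+ 2 - U_(i))%MM](_ : _ = U_(i) + U_(l))%MM; last by mnm_bool.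
rewrite [(U_(l) + (_ + _) - U_(i))%MM](_ : _ = U_(l) *+ p.-1)%MM; last by rewrite p3; mnm_bool.
by rewrite {1}/lowest (cochain2xx phic) cf0 mulr0 add0r => ->; rewrite ?oppr0 ?mul0r.
Qed.

(** For p > 3 equivariance gives 3 q = 0. For p = 3 that factor vanishes, but then q(i,m) = -
    s3(m,i), which [s3_char3] kills by alternation on x_i x_l D_i. *)
Lemma q_eq0 i m : m != i -> q i m = 0.
Proof.
move=> mi; have [p3|p3] := eqVneq p 3%N.
  rewrite lowestC p3 subnn (_ : U_(m) *+ 2 + U_(i) *+ 0 = U_(m) *+ 2)%MM; last by mnm_bool.
  by have := @s3_char3 m i; rewrite p3 eq_sym => -> //; rewrite oppr0.
have := lowest_equiv i i m (U_(i) *+ 2)%MM m (U_(m) *+ 3 + U_(i) *+ (p - 4))%MM m.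
gl_eval; rewrite /=.
have p4 : (3 < p)%N by lia.
rewrite [(U_(i) + (_ + _) - U_(m))%MM](_ : _ = U_(m) *+ 2 + U_(i) *+ (p - 3))%MM; last first.
  by apply/mnmP => t; mnm_eval; rewrite (_ : p - 3 = (p - 4).+1)%N ?mulnS; lia.
by move/eqP; rewrite mulf_eq0 (negPf (natr_neq0 _)) => [/eqP|] //; lia.
Qed.

Lemma s2_eq0 i m : m != i -> s2 i m = 0.
Proof. by move=> mi; apply: (mulfI two_neq0); rewrite s2E // q_eq0 // mulr0. Qed.

(** In the cocycle identity for x_i^2 D_i, x_l^2 D_l, x_l^(p-2) D_i the first two commute and the
    outer brackets have no D_l constant term; what remains is a multiple of s3 and a vanishing
    s2. *)
Lemma s3_eq0 i l : l != i -> s3 i l = 0.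
Proof.
move=> li.
have := phiz.2 (e (U_(i) *+ 2)%MM i) (e (U_(l) *+ 2)%MM l) (e (U_(l) *+ (p - 2))%MM i).
move/(congr1 (cf 0%MM l)); rewrite !cfD.
rewrite [cf 0%MM l (lie (e (U_(i) *+ 2)%MM i) _)]cf0_lie_deg2; last by mdeg_lia.
rewrite [cf 0%MM l (lie (e (U_(l) *+ 2)%MM l) _)]cf0_lie_deg2; last by mdeg_lia.
have -> z : cf 0%MM l (lie (e (U_(l) *+ (p - 2))%MM i) z) = 0.
  (* For p = 3 this field is x_l D_i, of degree one; its brackets have constant terms along D_i
     only. *)
  have [p3|p3] := eqVneq p 3%N; last by rewrite cf0_lie_deg2 //; mdeg_lia.
  by rewrite p3 cf0_lie_deg1 (negPf li) oppr0 mul0r.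
rewrite !lowest_lie_l; gl_eval; rewrite /=.
rewrite [(U_(l) *+ 2 + _ - U_(l))%MM](_ : _ = U_(l) *+ p.-1)%MM; last by mnm_bool.
rewrite [(_ + U_(i) *+ 2 - U_(i))%MM](_ : _ = U_(i) + U_(l) *+ (p - 2))%MM; last by mnm_bool.
rewrite -!/(lowest _ _ _ _ _) ![G _ _ _ (U_(_) *+ 2)%MM _]lowestC s2_eq0 1?eq_sym //.
rewrite natr_subp 1?ltnW // => E; apply: (mulfI two_neq0).
by rewrite mulr0 [RHS]E; ring.
Qed.

Lemma s4_eq0 i l : l != i -> s4 i l = 0.
Proof.
move=> li; have := lowest_equiv l i l (U_(i) *+ 2)%MM i (U_(l) + U_(i) *+ (p - 2))%MM l.
gl_eval; rewrite /= s2_eq0 // mulr0.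
rewrite [(U_(i) + (_ + _) - U_(l))%MM](_ : _ = U_(i) *+ p.-1)%MM; last by mnm_bool.
have := lowest_equiv l i l (U_(i) *+ 2)%MM l (U_(l) *+ 2 + U_(i) *+ (p - 3))%MM l.
gl_eval; rewrite /= q_eq0 // mulr0.
rewrite [(U_(i) + (_ + _) - U_(l))%MM](_ : _ = U_(l) + U_(i) *+ (p - 2))%MM; last by mnm_bool.
move/eqP; rewrite mulf_eq0 (negPf two_neq0) => /eqP ->.
by rewrite ?mulr0 ?oppr0 ?add0r ?mul1r.
Qed.

(** A second variable is what makes s1 vanish; for n = 1 it must be removed by subtracting a
    multiple of Sq(D_i). *)
Lemma s1_eq0 i l : l != i -> s1 i = 0.
Proof.
move=> li; have := lowest_equiv i i l (U_(i) *+ 2)%MM i (U_(l) + U_(i) *+ (p - 2))%MM i.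
gl_eval; rewrite /= s2_eq0 // ?mulr0.
rewrite [(U_(i) + (_ + _) - U_(l))%MM](_ : _ = U_(i) *+ p.-1)%MM; last by mnm_bool.
have := lowest_equiv i i l (U_(i) *+ 2)%MM l (U_(l) *+ 2 + U_(i) *+ (p - 3))%MM i.
gl_eval; rewrite /= q_eq0 // ?mulr0.
rewrite [(U_(i) + (_ + _) - U_(l))%MM](_ : _ = U_(l) + U_(i) *+ (p - 2))%MM; last by mnm_bool.
rewrite ?subr0 => /eqP; rewrite mulf_eq0 (negPf two_neq0) => /eqP ->.
by rewrite ?mulr0 ?oppr0 ?add0r ?subr0 ?mul1r.
Qed.

Lemma s5_eq0 i m l : l != i -> m != i -> m != l -> s5 i m l = 0.
Proof.
move=> li mi ml; have := lowest_equiv l l m (U_(i) *+ 2)%MM i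
  (U_(m) + U_(i) *+ p.-1 + U_(l) *+ p.-1)%MM l.
gl_eval; rewrite /=.
rewrite [G _ _ _ (_ - U_(m))%MM _](lowest_out _ _ _ _ (i := l)); last first.
  by mnm_eval; index_simp; lia.
by rewrite ?mulr0 ?mul1r ?sub0r => /eqP; rewrite oppr_eq0 => /eqP.
Qed.

Lemma square_killed i y : s1 i = 0 -> phi (e (U_(i) *+ 2)%MM i) y = 0.
Proof.
move=> s10; apply: lowest_eq0 => [k z|l b m bp].
  rewrite lie_pd (linfZ (cochain2_linl phic z)); mnm_eval.
  case: (eqVneq i k) => [->|_]; last by rewrite scale0r.
  by rewrite (_ : U_(k) *+ 2 - U_(k) = U_(k))%MM ?phi_tor ?scaler0 //; mnm_bool.
rewrite -[LHS]/(G l (U_(i) *+ 2)%MM i b m); apply/eqP; apply: contraT => W.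
have bE b' : in_box b' -> (forall t, (b' t)%:R
    = (t == m)%:R - (t == i)%:R - (t == l)%:R :> F) -> b = b'.
  move=> bp' b't; apply: eq_in_box => // t; rewrite b't (lowest_weight _ W); mnm_eval.
  by rewrite (eq_sym i) natrM; ring.
have [li|li] := eqVneq l i.
  rewrite li in W bE; have [mi|mi] := eqVneq m i.
    rewrite mi in W bE; rewrite (bE (U_(i) *+ p.-1)%MM) in W.
    - by rewrite s10 ?eqxx in W.
    - by box.
    - weight_ring.
  rewrite (bE (U_(m) + U_(i) *+ (p - 2))%MM) in W.
  - by rewrite s2_eq0 ?eqxx in W.
  - by box.
  - weight_ring.
have [mi|mi] := eqVneq m i.
  rewrite mi in W bE; rewrite (bE (U_(l) *+ p.-1)%MM) in W.
  - by rewrite s3_eq0 ?eqxx in W.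
  - by box.
  - weight_ring.
have [ml|ml] := eqVneq m l.
  rewrite ml in W bE; rewrite (bE (U_(i) *+ p.-1)%MM) in W.
  - by rewrite s4_eq0 ?eqxx in W.
  - by box.
  - weight_ring.
rewrite (bE (U_(m) + U_(i) *+ p.-1 + U_(l) *+ p.-1)%MM) in W.
- by rewrite s5_eq0 ?eqxx in W.
- by box.
- weight_ring.
Qed.

End GlEquivariant.

(** * Generation *)

Section Generation.

Let K (x : g) := forall y, phi x y = 0.

Let K_lie u v : K u -> K v -> K (lie u v). Proof. exact: cocycle2_ker_lie. Qed.

Let K_scale (c : F) u : c != 0 -> K (c *: u) -> K u.
Proof.
move=> c0 Ku y; apply: (scalerI c0).
by rewrite -(linfZ (cochain2_linl phic y)) Ku scaler0.
Qed.

Let KB u v : K u -> K (v - u) -> K v.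
Proof. by move=> Ku Kv y; rewrite -[v](subrK u) (linfD (cochain2_linl phic y)) Ku Kv addr0. Qed.

Let KZ (c : F) u : K u -> K (c *: u).
Proof. by move=> Ku y; rewrite (linfZ (cochain2_linl phic y)) Ku scaler0. Qed.

Let K_out a j : ~ in_box a -> K (e a j).
Proof. by move=> ap y; rewrite e_out // cochain20x. Qed.

Section SeveralVariables.
Hypothesis other : forall i : 'I_n, exists k, k != i.
Hypothesis glk : forall i j, K (e U_(i)%MM j).
Hypothesis sqk : forall i, K (e (U_(i) *+ 2)%MM i).

Let Ksq i j : K (e (U_(i) *+ 2)%MM j).
Proof.
have [<-//|ij] := eqVneq i j.
apply: (K_scale (c := -1)); first by rewrite oppr_eq0 oner_eq0.
have := K_lie (glk i j) (sqk i); rewrite (lie_e eB); gl_eval; rewrite /= scale0r add0r.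
by rewrite addmC addmK scaleN1r scale1r.
Qed.

Let Kdeg2 i k j : K (e (U_(i) + U_(k))%MM j).
Proof.
have [<-|ik] := eqVneq i k.
  by rewrite (_ : U_(i) + U_(i) = U_(i) *+ 2)%MM //; mnm_bool.
wlog ij : i k ik / k != j => [th|].
  have [kj|] := eqVneq k j; last exact: th.
  by rewrite addmC; apply: th; [rewrite eq_sym | rewrite -kj].
apply: (K_scale two_neq0); have := K_lie (glk k i) (Ksq i j).
rewrite (lie_e eB); gl_eval; rewrite /= scale0r subr0.
by rewrite (_ : U_(k) + U_(i) *+ 2 - U_(i) = U_(i) + U_(k))%MM //; mnm_bool.
Qed.

(** [x_i^2 D_i, x^(a - U_i) D_j] is x^a D_j times a_i - 1 for i different from j, and times a_i - 3
    for i = j; within the given range only a_i = 3 with i = j is bad. *)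
Let Kstep a i j : (forall b k, (mdeg b < mdeg a)%N -> K (e b k)) -> in_box a ->
  (1 < a i)%N -> (i != j) || (a i != 3%N) -> K (e a j).
Proof.
move=> IH ap ai ij.
have bm : (mdeg (a - U_(i))%MM < mdeg a)%N.
  suff : (mdeg (a - U_(i))%MM + 1 = mdeg a)%N by lia.
  rewrite -(mdeg1 i) -mdegD; congr mdeg; mnm_lia.
have := K_lie (sqk i) (IH _ j bm).
rewrite (lie_e eB); mnm_eval; rewrite eqxx /=.
rewrite (_ : U_(i) *+ 2 + (a - U_(i)) - U_(i) = a)%MM; last by mnm_lia.
have ap_i := ap i.
have [ij'|ij'] := eqVneq i j; last first.
  rewrite mul0n scale0r subr0; apply: K_scale; apply: natr_neq0; lia.
rewrite -ij' (_ : U_(i) *+ 2 + (a - U_(i)) - U_(i) = a)%MM; last by mnm_lia.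
rewrite /= mul1n -scalerBl; apply: K_scale; rewrite natrB; last by lia.
have [->|a2] := eqVneq (a i) 2%N; first by rewrite addrAC subrr sub0r oppr_eq0 oner_eq0.
move: ij; rewrite ij' eqxx -ij' /= => a3.
rewrite (_ : (a i)%:R - 1 - 2%:R = (a i - 3)%:R); first by apply: natr_neq0; lia.
by rewrite natrB; [ring | lia].
Qed.

Let subUK a i : (0 < a i)%N -> (U_(i) + (a - U_(i)))%MM = a.
Proof.
by move=> ai; apply/mnmP => t; mnm_eval; case: (eqVneq i t) ai => [<-|_]; clear; lia.
Qed.

Let mdeg_sub a i : (0 < a i)%N -> (mdeg (a - U_(i))%MM < mdeg a)%N.
Proof.
by move=> ai; rewrite -[in X in (_ < X)%N](subUK ai) mdegD mdeg1 add1n.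
Qed.

Lemma all_killed a j : K (e a j).
Proof.
have [m] := ubnP (mdeg a); elim: m a j => // m IHm a j am.
have IH b k : (mdeg b < mdeg a)%N -> K (e b k) by move=> ba; apply: IHm; lia.
have [ap|] := pselect (in_box a); last exact: K_out.
have [[i [ai ij]]|no_i] := pselect (exists i, (1 < a i)%N /\ (i != j) || (a i != 3%N)).
  exact: Kstep ai ij.
have small i : (1 < a i)%N -> i = j /\ a i = 3%N.
  move=> ai; split; apply/eqP; apply: contra_notT no_i => h; exists i; split=> //.
    by rewrite h.
  by rewrite h orbT.
have [aj|aj] := eqVneq (a j) 3%N.
  (* The bad exponent is reached through a second variable: [x_j^2 D_k, x^(a - 2U_j + U_k) D_j] =
     (a_k + 1) x^a D_j - 2 x^(a - U_j + U_k) D_k, where [Kstep] covers the last term and a_k + 1 is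
     1 or 2. *)
  have [k kj] := other j.
  have ak : (a k <= 1)%N.
    by rewrite leqNgt; apply/negP => /small[kj' _]; rewrite kj' eqxx in kj.
  have := K_lie (Ksq j k) (IH (a - U_(j) *+ 2 + U_(k))%MM j _).
  have -> : (mdeg (a - U_(j) *+ 2 + U_(k))%MM < mdeg a)%N.
    have : (mdeg (a - U_(j) *+ 2 + U_(k))%MM + 2 = mdeg (a + U_(k))%MM)%N.
      rewrite -[X in (_ + X)%N](_ : mdeg (U_(j) *+ 2)%MM = 2)%N; last by mdeg_lia.
      by rewrite -mdegD; congr mdeg; mnm_lia.
    by rewrite (mdegD a) mdeg1; lia.
  move=> /(_ isT); rewrite (lie_e eB); mnm_eval; index_simp.
  rewrite (_ : U_(j) *+ 2 + (a - U_(j) *+ 2 + U_(k)) - U_(k) = a)%MM; last by mnm_lia.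
  rewrite (_ : U_(j) *+ 2 + (a - U_(j) *+ 2 + U_(k)) - U_(j) = a - U_(j) + U_(k))%MM;
    last by mnm_lia.
  move=> Kb; apply: (K_scale (c := (a k + 1)%:R)); first by apply: natr_neq0; lia.
  have Ka' : K (e (a - U_(j) + U_(k))%MM k).
    have [ap'|] := pselect (in_box (a - U_(j) + U_(k))%MM); last exact: K_out.
    apply: (Kstep (i := j)) => //; last by rewrite eq_sym kj.
      move=> b t bm; apply: IH; apply: leq_trans bm _.
      rewrite mdegD mdeg1 addn1; apply: mdeg_sub; lia.
    by mnm_eval; index_simp; lia.
  rewrite /= mul0n subn0 mul1n in Kb.
  by apply: (KB (u := 2%:R *: e (a - U_(j) + U_(k))%MM k)) => //; apply: KZ.
have small1 i : (a i <= 1)%N.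
  by rewrite leqNgt; apply/negP => ai; have [ij] := small i ai; rewrite ij; apply/eqP.
have [[i ai]|no] := pselect (exists i, (0 < a i)%N); last first.
  rewrite (_ : a = 0%MM); first exact: phi_pd.
  apply/mnmP => t; rewrite mnm0E; apply/eqP; rewrite -leqn0 leqNgt; apply/negP => t0.
  by apply: no; exists t.
have [[k [ki ak]]|no] := pselect (exists k, k != i /\ (0 < a k)%N); last first.
  rewrite (_ : a = U_(i)%MM); first exact: glk.
  apply/mnmP => t; rewrite mnm1E; have [<-|it] := eqVneq i t.
    by have := small1 i; lia.
  apply/eqP; rewrite -leqn0 leqNgt; apply/negP => t0.
  by apply: no; exists t; rewrite eq_sym.
have [[t [[ti tk] at0]]|no] := pselect (exists t, (t != i /\ t != k) /\ (0 < a t)%N);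
    last first.
  rewrite (_ : a = U_(i) + U_(k))%MM; first exact: Kdeg2.
  apply/mnmP => t; rewrite mnmDE !mnm1E; have [<-|it] := eqVneq i t.
    by rewrite (negPf ki); have := small1 i; lia.
  have [<-|kt] := eqVneq k t; first by have := small1 k; lia.
  apply/eqP; rewrite -leqn0 leqNgt; apply/negP => t0.
  by apply: no; exists t; split=> //; split; rewrite eq_sym.
(* A squarefree monomial in at least three variables has two of them distinct from j, and
   [x_i' x_k' D_k', x^(a - U_i') D_j] = x^a D_j. *)
have Kpair i' k' : i' != j -> k' != j -> k' != i' -> (0 < a i')%N -> (0 < a k')%N ->
    K (e a j).
  move=> ij kj ki' ai' ak'; have := K_lie (Kdeg2 i' k' k') (IH _ j (mdeg_sub ai')).
  rewrite (lie_e eB); mnm_eval; index_simp.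
  rewrite [(U_(i') + _)%MM]addmC -addmA subUK // addmC addmK.
  rewrite (_ : a k' = 1)%N /= ?subn0 ?addn0 ?scale0r ?subr0 ?scale1r //.
  by apply/eqP; rewrite eqn_leq small1 ak'.
have [ij|ij] := eqVneq i j.
  by apply: (Kpair k t) => //; rewrite -?ij.
have [kj|kj] := eqVneq k j.
  by apply: (Kpair i t) => //; rewrite -?kj.
exact: (Kpair i k).
Qed.

End SeveralVariables.

Section OneVariable.
Variable i : 'I_n.
Hypothesis only : forall k : 'I_n, k = i.
Hypothesis sqk : K (e (U_(i) *+ 2)%MM i).

Let c (m k : nat) := G i (U_(i) *+ m)%MM i (U_(i) *+ k)%MM i.

Let c_step (m k : nat) : (1 < m)%N -> (1 < k)%N ->
  (m%:R - 2%:R) * c m.+1 k + (k%:R - 2%:R) * c m k.+1 = 0.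
Proof.
move=> m1 k1; have := cocycle2_ker_lie1 phiz (e (U_(i) *+ m)%MM i) sqk (e (U_(i) *+ k)%MM i).
move/(congr1 (cf 0%MM i)); rewrite cfB cf0_lie_deg2; last by mdeg_lia.
rewrite lowest_lie_l lowest_lie_r; mnm_eval; rewrite !eqxx /= !mul1n.
have E (x : nat) : (1 < x)%N -> (U_(i) *+ 2 + U_(i) *+ x - U_(i) = U_(i) *+ x.+1)%MM.
  by move=> x1; apply/mnmP => t; mnm_eval; case: (i == t) => /=; lia.
rewrite !E // -!/(lowest _ _ _ _ _) -!/(c _ _) => H.
have -> : (m%:R - 2%:R) * c m.+1 k + (k%:R - 2%:R) * c m k.+1
  = (m%:R * c m.+1 k - 2%:R * c m.+1 k) - (0 - (k%:R * c m k.+1 - 2%:R * c m k.+1)).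
  by ring.
by rewrite H subrr.
Qed.

(* Going down from the middle, where the alternating form vanishes. *)
Let c3 : (3 < p)%N -> c 3 (p - 2) = 0.
Proof.
(* By weight the exponents add up to p + 1; [c_step] moves from the middle pair (h, h) outwards to
   (3, p - 2). *)
move=> p3; have [h hE] : exists h, (h + h = p.+1)%N.
  by exists p./2.+1; rewrite addSn addnS addnn -[RHS]addn1 -[in RHS](odd_double_half p) odd_p; lia.
suff H (d : nat) : (d <= h - 3)%N -> c (h - d) (h + d) = 0.
  have := H (h - 3)%N (leqnn _).
  have -> : (h - (h - 3) = 3)%N by move: hE p3; clear; lia.
  by have -> : (h + (h - 3) = p - 2)%N by move: hE p3; clear; lia.
elim: d => [|d IHd] dh.
  by rewrite subn0 addn0 /c lowestC /lowest (cochain2xx phic) cf0 oppr0.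
have := @c_step (h - d.+1) (h + d).
rewrite (_ : (h - d.+1).+1 = h - d)%N; last by lia.
rewrite IHd ?mulr0 ?add0r; last by lia.
move=> /(_ _ _)/eqP; rewrite mulf_eq0 -natrB ?(negPf (natr_neq0 _)) /= ?addnS; try lia.
by move=> E; apply/eqP; apply: E; lia.
Qed.

(** Since [x^2 D, x^2 D] = 0, brackets do not lead from x^2 D to x^3 D, and its constant term must
    be computed. Weight leaves only the one against x^(p-2) D. *)
Let cube : (3 < p)%N -> K (e (U_(i) *+ 3)%MM i).
Proof.
move=> p3; apply: lowest_eq0 => [k z|l b m bp].
  rewrite (only k) lie_pd (linfZ (cochain2_linl phic z)); mnm_eval; rewrite eqxx.
  rewrite (_ : U_(i) *+ 3 - U_(i) = U_(i) *+ 2)%MM ?sqk ?scaler0 //; mnm_bool.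
rewrite (only m) (only l) -[LHS]/(G i (U_(i) *+ 3)%MM i b i).
have [//|W] := eqVneq (G i (U_(i) *+ 3)%MM i b i) 0.
rewrite (_ : b = U_(i) *+ (p - 2))%MM; first exact: c3.
apply: eq_in_box => // [|t]; first by box.
rewrite (lowest_weight _ W) (only t); mnm_eval; rewrite eqxx !mul1n natr_subp 1?ltnW //.
by rewrite /=; ring.
Qed.

Lemma all_killed1 a j : K (e a j).
Proof.
have -> : a = (U_(i) *+ (a i))%MM.
  by apply/mnmP => t; rewrite (only t); mnm_eval; rewrite eqxx mul1n.
rewrite (only j); elim: (a i) => [|m IHm]; first exact: phi_pd.
case: m IHm => [|[|[|m]]] IHm; [exact: phi_tor | exact: sqk | |].
  have [p3|p3] := ltnP 3 p; first exact: cube.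
  by apply: K_out => /(_ i); mnm_eval; rewrite eqxx; lia.
have [mp|mp] := ltnP m.+4 p; last first.
  by apply: K_out => /(_ i); mnm_eval; rewrite eqxx; lia.
have := K_lie sqk IHm; rewrite (lie_e eB); mnm_eval; rewrite eqxx.
rewrite (_ : U_(i) *+ 2 + U_(i) *+ m.+3 - U_(i) = U_(i) *+ m.+4)%MM; last first.
  by apply/mnmP => t; mnm_eval; case: (i == t) => /=; lia.
rewrite -scalerBl -natrB ?mul1n //; apply: K_scale; apply: natr_neq0; lia.
Qed.

End OneVariable.
End Generation.

End NormalizedCocycle.

(** * Constant terms of the squarings and of the trace coboundaries *)

Lemma normalizedZD (c : F) phi phi' : normalized phi -> normalized phi' ->
  normalized (c *: phi + phi').
Proof.
move=> [z d t] [z' d' t']; split=> [|k y|k y].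
- exact: cocycle2D_scale.
- by rewrite -[LHS]/(c *: phi (pd k) y + phi' (pd k) y) d d' scaler0 addr0.
- by rewrite -[LHS]/(c *: phi (tor k) y + phi' (tor k) y) t t' scaler0 addr0.
Qed.

Lemma normalized0 : normalized 0.
Proof.
split=> //; split=> [|x y z].
  by split=> // x; apply: linear_zero.
by rewrite -[LHS]/(lie x 0 + lie y 0 + lie z 0) !liex0.
Qed.

Lemma normalizedB phi phi' : normalized phi -> normalized phi' -> normalized (phi - phi').
Proof. by move=> N N'; rewrite addrC -scaleN1r; apply: normalizedZD. Qed.

Lemma lowestD_scale (c : F) phi phi' l a j b k :
  lowest (c *: phi + phi') l a j b k = c * lowest phi l a j b k + lowest phi' l a j b k.
Proof.
rewrite /lowest -[(c *: phi + phi') _ _]/(c *: phi (e a j) (e b k) + phi' (e a j) (e b k)).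
by rewrite cfD cfZ.
Qed.

Lemma lowestB phi phi' l a j b k :
  lowest (phi - phi') l a j b k = lowest phi l a j b k - lowest phi' l a j b k.
Proof. by rewrite addrC -scaleN1r lowestD_scale mulN1r addrC. Qed.

Local Notation sqd i := (sq p (lie (pd i))).

Lemma cocycle2_sqd i : cocycle2 (sqd i).
Proof. by apply: cocycle2_sq => //; apply: lie_derivation_ad. Qed.

Lemma divpow_pd i k (a : 'X_{1..n}) j : in_box a ->
  divpow (lie (pd i)) k (e a j) = ('C(a i, k))%:R *: e (a - U_(i) *+ k)%MM j.
Proof.
move=> ap; rewrite /divpow iter_lie_pd scalerA; congr (_ *: _).
have [kp|kp] := ltnP k p.
  by rewrite -bin_ffact natrM mulrC mulfK // (fact_neq0 charFp).
by have := ap i => aip; rewrite ffact_small ?bin_small ?mulr0 //; lia.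
Qed.

Lemma sqd_small i x y : lie (pd i) (lie (pd i) (lie (pd i) x)) = 0 ->
  sqd i x y = lie (lie (pd i) x) (divpow (lie (pd i)) p.-1 y)
    + lie (divpow (lie (pd i)) 2 x) (divpow (lie (pd i)) (p - 2) y).
Proof.
move=> x3; have p2 := p_gt2; rewrite /sq big_ltn; last by lia.
rewrite big_ltn // big_nat big1 ?addr0 => [|k /andP[k2 _]].
  by rewrite subn1 {1}/divpow /= invr1 scale1r.
have -> : k = (k - 3 + 3)%N by lia.
rewrite {1}/divpow iterD /= x3.
by rewrite (linf0 (linear_iter _ (lie_linearr _))) scaler0 lie0x.
Qed.

(** As (ad D_i)^2 h_i = 0, a single term of Sq(D_i)(h_i, -) remains, and it contains (ad D_i)^p =
    0. *)
Lemma normalized_sqd i : normalized (sqd i).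
Proof.
split=> [|k y|k y]; first exact: cocycle2_sqd.
  by apply: (sq_ker _ (lie_derivation_ad _)); rewrite lie_pd_pd.
have [<-|ik] := eqVneq i k; last first.
  by apply: (sq_ker _ (lie_derivation_ad _)); rewrite lie_pd_tor (negPf ik) scale0r.
rewrite sqd_small ?lie_pd_tor ?eqxx ?scale1r ?lie_pd_pd ?liex0 //.
rewrite [divpow _ 2 _]/divpow /= lie_pd_tor eqxx scale1r lie_pd_pd scaler0 lie0x addr0.
rewrite /divpow lieZr -iterS (prednK (prime_gt0 p_pr)).
by rewrite iter_pd_p lie0x scaler0.
Qed.

Lemma lowest_sqd_neq l t (a : 'X_{1..n}) j b k : a t = 0%N -> lowest (sqd t) l a j b k = 0.
Proof.
move=> at0; rewrite /lowest (sq_ker _ (lie_derivation_ad _)) ?cf0 //.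
by rewrite lie_pd at0 scale0r.
Qed.

Lemma lie_pd_U i j : lie (pd i) (e U_(i)%MM j) = pd j.
Proof.
by rewrite lie_pd mnm1E eqxx scale1r (_ : U_(i) - U_(i) = 0)%MM //; mnm_bool.
Qed.

Lemma sqd_gl i j (b : 'X_{1..n}) k : in_box b ->
  sqd i (e U_(i)%MM j) (e b k)
    = 'C(b i, p.-1)%:R *: lie (pd j) (e (b - U_(i) *+ p.-1)%MM k).
Proof.
move=> bp; rewrite sqd_small ?lie_pd_U ?lie_pd_pd ?liex0 // divpow_pd // lieZr.
by rewrite /divpow /= lie_pd_U lie_pd_pd scaler0 lie0x addr0.
Qed.

Lemma cf0_pd l j : cf 0%MM l (pd j) = (l == j)%:R.
Proof. by rewrite (cf_e eB) ?eqxx //; apply: in_box0. Qed.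

Lemma lowest_sqd_v5 i j : j != i ->
  lowest (sqd i) i U_(i)%MM j (U_(j) + U_(i) *+ p.-1)%MM i = 1.
Proof.
move=> ji; rewrite /lowest sqd_gl; last by box.
mnm_eval; index_simp; rewrite mul1n add0n binn scale1r addmK lie_pd_U cf0_pd eqxx //.
Qed.

Lemma lowest_sqd_v6 t i m : m != i ->
  lowest (sqd t) i U_(i)%MM m (U_(m) + U_(m) + U_(i) *+ (p - 2))%MM m = 0.
Proof.
move=> mi; have [<-|it] := eqVneq i t; last by rewrite lowest_sqd_neq // mnm1E (negPf it).
rewrite /lowest sqd_gl; last by box.
by mnm_eval; index_simp; rewrite mul1n add0n bin_small ?scale0r ?cf0 //; have := p_gt2; lia.
Qed.

Lemma lowest_sqd_square i l :
  lowest (sqd i) l (U_(i) *+ 2)%MM i (U_(i) *+ p.-1)%MM l = - ((i == l)%:R * 2%:R + 1).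
Proof.
have b2 : in_box (U_(i) *+ 2)%MM by apply: in_boxMU.
have bp : in_box (U_(i) *+ p.-1)%MM by box.
have d1 : lie (pd i) (e (U_(i) *+ 2)%MM i) = 2%:R *: tor i.
  by rewrite lie_pd; mnm_eval; rewrite eqxx; congr (_ *: e _ _); mnm_bool.
rewrite /lowest sqd_small; last first.
  by rewrite d1 !lieZr lie_pd_tor eqxx scale1r lie_pd_pd scaler0.
rewrite d1 !divpow_pd //; mnm_eval; rewrite eqxx !mul1n !binn !scale1r.
have -> : 'C(p.-1, p - 2) = p.-1.
  by rewrite -bin_sub; [rewrite (_ : p.-1 - (p - 2) = 1)%N ?bin1 //; lia | lia].
rewrite natp1.
rewrite (_ : U_(i) *+ p.-1 - U_(i) *+ p.-1 = 0)%MM; last by apply/mnmP => t; mnm_eval; lia.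
rewrite (_ : U_(i) *+ p.-1 - U_(i) *+ (p - 2) = U_(i))%MM; last by mnm_bool.
rewrite (_ : U_(i) *+ 2 - U_(i) *+ 2 = 0)%MM; last by apply/mnmP => t; mnm_eval; lia.
rewrite lieZl lieZr lie_tor_pd lie_pd_U cfD !cfZ !cf0_pd eqxx.
by rewrite eq_sym; case: eqVneq => _ /=; ring.
Qed.

Implicit Types (a b : 'X_{1..n}) (i j k l m t : 'I_n).

(* sum_k f_k D_k |-> - sum_{i <> k} c_{ik} (D_i^{p-1} D_k f_k) D_i, which commutes
   with the ad D_i and the ad h_i, so that its coboundary is normalized. *)
Definition trace_term (c : 'I_n -> 'I_n -> F) a k i : g :=
  ((i != k) && (a i == p.-1))%:R *: ((c i k * (a k)%:R) *:
     e (a - U_(k) - U_(i) *+ p.-1)%MM i).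

Definition trace_cochain (c : 'I_n -> 'I_n -> F) : g -> g :=
  extend (fun a k => \sum_i trace_term c a k i).

Lemma trace_cochain_linear c : linear (trace_cochain c).
Proof. exact: extend_linear. Qed.

Lemma trace_cochainE c a k : in_box a ->
  trace_cochain c (e a k) = \sum_i trace_term c a k i.
Proof. by move=> ap; rewrite /trace_cochain extendE. Qed.

Lemma trace_term_pd c a k i t : in_box a ->
  lie (pd t) (trace_term c a k i) = (a t)%:R *: trace_term c (a - U_(t))%MM k i.
Proof.
move=> ap; rewrite /trace_term !lieZr lie_pd; mnm_eval.
have [|ik] := eqVneq i k; first by rewrite /= !scale0r scaler0.
(* For t = i both sides vanish: x_i has been divided out on the left, and a_i - 1 is never p - 1 on
   the right. *)
have [<-|ti] := eqVneq t i.
  rewrite ?eqxx /= ?mul1n; have at_ := ap t; have pt := p_gt2.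
  rewrite (_ : a t - 1 == p.-1 = false)%N /=; last by apply/negP => /eqP; lia.
  rewrite scale0r scaler0; case: eqP => [->|_]; last by rewrite scale0r.
  by rewrite (_ : p.-1 - _ - _ = 0)%N ?scale0r ?scaler0 //; lia.
rewrite /= subn0; case: eqP => _; last by rewrite !scale0r scaler0.
index_simp; rewrite ?mul0n ?subn0 !scale1r.
have -> : (a - U_(k) - U_(i) *+ p.-1 - U_(t) = a - U_(t) - U_(k) - U_(i) *+ p.-1)%MM.
  by apply/mnmP => s; mnm_eval; lia.
have E : (a k)%:R * (a t - (k == t))%:R = (a t)%:R * (a k - (t == k))%:R :> F.
  by have [<-//|kt] := eqVneq k t; rewrite !subn0 mulrC.
by rewrite !scalerA; congr (_ *: _); rewrite -mulrA E mulrCA.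
Qed.

Lemma trace_term_tor c a k i t :
  lie (tor t) (trace_term c a k i) = ((a t)%:R - (t == k)%:R) *: trace_term c a k i.
Proof.
rewrite /trace_term !lieZr lie_tor; mnm_eval.
have [|ik] := eqVneq i k; first by rewrite /= !scale0r scaler0.
case: (eqVneq (a i) p.-1) => ai; last by rewrite /= !scale0r scaler0.
rewrite /= !scale1r !scalerA; congr (_ *: _).
have [ak0|ak] := posnP (a k); first by rewrite ak0 !mulr0 !mul0r.
suff -> : (a t - (k == t) - (i == t) * p.-1)%:R - (t == i)%:R
    = (a t)%:R - (t == k)%:R :> F by rewrite mulrC.
have [ti|ti] := eqVneq t i.
  by rewrite ti (eq_sym k) (negPf ik) ?eqxx ai mul1n !subn0 subnn natp1 /=; ring.
rewrite /= mul0n subn0 subr0 (eq_sym k).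
by have [->|_] := eqVneq t k; rewrite ?subn0 ?subr0 ?natrB.
Qed.

Lemma lie1_trace_pd c t : lie1 (pd t) (trace_cochain c) = 0.
Proof.
have tl := trace_cochain_linear c.
apply/funext => y; rewrite /lie1; apply/eqP; rewrite subr_eq0; apply/eqP.
apply: (eq_on_basis (f := fun y => lie (pd t) (trace_cochain c y))
  (h := fun y => trace_cochain c (lie (pd t) y))) => [||a k ap].
- exact: linear_comp (lie_linearr _) tl.
- exact: linear_comp tl (lie_linearr _).
rewrite lie_pd (linfZ tl) !trace_cochainE //; last first.
  by move=> s; mnm_eval; have := ap s; lia.
rewrite (linf_sum (lie_linearr _)) scaler_sumr; apply: eq_bigr => i _.
exact: trace_term_pd.
Qed.

Lemma lie1_trace_tor c t : lie1 (tor t) (trace_cochain c) = 0.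
Proof.
have tl := trace_cochain_linear c.
apply/funext => y; rewrite /lie1; apply/eqP; rewrite subr_eq0; apply/eqP.
apply: (eq_on_basis (f := fun y => lie (tor t) (trace_cochain c y))
  (h := fun y => trace_cochain c (lie (tor t) y))) => [||a k ap].
- exact: linear_comp (lie_linearr _) tl.
- exact: linear_comp tl (lie_linearr _).
rewrite lie_tor (linfZ tl) !trace_cochainE //.
rewrite (linf_sum (lie_linearr _)) scaler_sumr; apply: eq_bigr => i _.
exact: trace_term_tor.
Qed.

Lemma trace_cochain_small c a k : in_box a -> (forall i, i != k -> a i != p.-1) ->
  trace_cochain c (e a k) = 0.
Proof.
move=> ap ai; rewrite trace_cochainE // big1 // => i _; rewrite /trace_term.
have [_|ik] := eqVneq i k; first by rewrite scale0r.
by rewrite (negPf (ai i ik)) scale0r.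
Qed.

Let predp_neq (m : nat) : (m < p.-1)%N -> m != p.-1. Proof. by move=> h; rewrite neq_ltn h. Qed.

(** The trace map commutes with D_k and h_k and also vanishes on them, since exponents 0 and 1 stay
    below p - 1. *)
Lemma normalized_trace c : normalized (cob1 (trace_cochain c)).
Proof.
split=> [|k y|k y]; first exact/cocycle2_cob1/trace_cochain_linear.
  rewrite cob1E lie1_trace_pd trace_cochain_small ?lie0x ?addr0 //.
    exact: in_box0.
  by move=> i _; rewrite mnm0E; apply: predp_neq; have := p_gt2; lia.
rewrite cob1E lie1_trace_tor trace_cochain_small ?lie0x ?addr0 //.
  exact: in_box1.
by move=> i _; mnm_eval; apply: predp_neq; apply: bool_ltn_predp.
Qed.

Lemma lowest_trace c i m : m != i ->
  lowest (cob1 (trace_cochain c)) i U_(i)%MM m (U_(m) + U_(m) + U_(i) *+ (p - 2))%MM m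
  = - (2%:R * c i m).
Proof.
move=> mi; rewrite /lowest /cob1.
rewrite [trace_cochain c (e U_(i)%MM m)]trace_cochain_small; last first.
- by move=> t _; mnm_eval; apply: predp_neq; apply: bool_ltn_predp.
- exact: in_box1.
rewrite trace_cochain_small; last first.
- move=> t tm; mnm_eval; index_simp; rewrite !add0n; apply: predp_neq.
  by case: (i == t); rewrite ?mul0n ?mul1n; have := p_gt2; lia.
- by box.
rewrite !liex0 subrr sub0r cfN (lie_e eB); gl_eval; rewrite /= scale0r subr0.
rewrite (linfZ (trace_cochain_linear c)) cfZ; congr (- (_ * _)).
have -> : (U_(i) + (U_(m) + U_(m) + U_(i) *+ (p - 2)) - U_(m)
    = U_(m) + U_(i) *+ p.-1)%MM by mnm_bool.
rewrite trace_cochainE; last by box.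
rewrite cf_sum (bigD1 i) //= big1 ?addr0 => [|t ti]; rewrite /trace_term !cfZ; mnm_eval.
  index_simp; rewrite add0n mul1n eqxx mul0n addn0 /= mul1r mulr1.
  rewrite (_ : U_(m) + U_(i) *+ p.-1 - U_(m) - U_(i) *+ p.-1 = 0)%MM; last first.
    by apply/mnmP => s; mnm_eval; lia.
  by rewrite -/(pd i) cf0_pd eqxx mulr1.
index_simp; rewrite mul0n addn0.
by rewrite (negPf (predp_neq (bool_ltn_predp _))) andbF mul0r.
Qed.

(** * Decomposition of cocycles and independence of the squarings *)

Definition sq_sum (c : 'I_n -> F) : g -> g -> g := \sum_i c i *: sqd i.

Lemma normalized_sq_sum c : normalized (sq_sum c).
Proof.
apply: (big_ind normalized) => [|f h Nf Nh|i _]; first exact: normalized0.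
  by rewrite -[f]scale1r; apply: normalizedZD.
by rewrite -[_ *: _]addr0; apply: normalizedZD; [apply: normalized_sqd | apply: normalized0].
Qed.

Lemma sq_sumE c x y : sq_sum c x y = \sum_i c i *: sqd i x y.
Proof. by rewrite /sq_sum !fct_sumE. Qed.

Lemma lowest_sq_sum c l a j b k :
  lowest (sq_sum c) l a j b k = \sum_i c i * lowest (sqd i) l a j b k.
Proof. by rewrite /lowest sq_sumE cf_sum; apply: eq_bigr => i _; rewrite cfZ. Qed.

Lemma normalized_eq0 phi : normalized phi ->
  (forall a j y, phi (e a j) y = 0) -> phi = 0.
Proof.
move=> [[phic _] _ _] phi0; apply/funext => x; apply/funext => y.
apply: (eq_on_basis (f := fun x => phi x y) (h := fun=> 0)) => [||a j _].
- exact: cochain2_linl.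
- exact: linear_zero.
exact: phi0.
Qed.

Lemma cocycle2_decomposition_many phi : (forall i : 'I_n, exists k, k != i) -> cocycle2 phi ->
  exists c, cohomologous phi (sq_sum c).
Proof.
move=> other phiz; have [phi1 c1 N1] := normalize phiz.
(* The factor inverts the -2 of [lowest_trace]. This comes before the squarings because they leave
   the diagonal v6 alone, whereas the trace coboundaries may change v5. *)
pose c i m := - (2%:R^-1 * lowest phi1 i U_(i)%MM m (U_(m) + U_(m) + U_(i) *+ (p - 2))%MM m).
pose phi2 := phi1 - cob1 (trace_cochain c).
have N2 : normalized phi2 := normalizedB N1 (normalized_trace c).
have v6 i m : m != i ->
    lowest phi2 i U_(i)%MM m (U_(m) + U_(m) + U_(i) *+ (p - 2))%MM m = 0.
  move=> mi; rewrite /phi2 lowestB lowest_trace // /c mulrN mulrA mulfV ?mul1r //.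
  by rewrite opprK subrr.
have /choice[f fi] := other.
pose d i := lowest phi2 i U_(i)%MM (f i) (U_(f i) + U_(i) *+ p.-1)%MM i.
pose phi3 := phi2 - sq_sum d.
have N3 : normalized phi3 := normalizedB N2 (normalized_sq_sum d).
have glk i j y : phi3 (e U_(i)%MM j) y = 0.
  apply: (gl_killed N3) => [{}i m mi|{}i].
    rewrite /phi3 lowestB v6 // lowest_sq_sum big1 ?subrr // => t _.
    by rewrite lowest_sqd_v6 // mulr0.
  exists (f i) => //; rewrite /phi3 lowestB lowest_sq_sum (bigD1 i) //= lowest_sqd_v5 //.
  rewrite mulr1 big1 ?addr0 ?subrr // => t ti.
  by rewrite lowest_sqd_neq ?mulr0 // mnm1E eq_sym (negPf ti).
have sqk i y : phi3 (e (U_(i) *+ 2)%MM i) y = 0.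
  have [l li] := other i; apply: (square_killed N3 glk).
  exact: (s1_eq0 N3 glk li).
have phi30 : phi3 = 0.
  by apply: normalized_eq0 => // a j; apply: (all_killed N3 other glk sqk).
exists d; apply: cohomologous_trans c1 _.
exists (trace_cochain c); first exact: trace_cochain_linear.
by apply/eqP; rewrite -subr_eq0 opprD addrA addrAC -/phi2 -/phi3 phi30.
Qed.

Lemma cocycle2_decomposition_one phi i : (forall k : 'I_n, k = i) -> cocycle2 phi ->
  exists2 c, cohomologous phi (sq_sum c) & p = 3%N -> c = fun=> 0.
Proof.
move=> only phiz; have [phi1 c1 N1] := normalize phiz.
pose s (f : g -> g -> g) := lowest f i (U_(i) *+ 2)%MM i (U_(i) *+ p.-1)%MM i.
(* The value of [s] on Sq(D_i) is -3. For p = 3 no correction is possible, but then x^(p-1) = x^2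
   and [s] vanishes by alternation. *)
pose d (_ : 'I_n) : F := if p == 3%N then 0 else - (s phi1 / 3%:R).
pose phi2 := phi1 - sq_sum d.
have N2 : normalized phi2 := normalizedB N1 (normalized_sq_sum d).
have s2 : s phi2 = 0.
  have [p3|p3] := eqVneq p 3%N.
    have [[phic _] _ _] := N2.
    by rewrite /s /lowest p3 (cochain2xx phic) cf0.
  rewrite /phi2 /s lowestB lowest_sq_sum (bigD1 i) //= big1 ?addr0 => [|t]; last first.
    by rewrite (only t) eqxx.
  rewrite lowest_sqd_square eqxx /d (negPf p3).
  have three0 : 3%:R != 0 :> F by apply: natr_neq0; have := p_gt2; lia.
  by rewrite -/(s phi1) /=; field.
have glk k j y : phi2 (e U_(k)%MM j) y = 0.
  by rewrite (only k) (only j); case: N2 => _ _; apply.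
have sqk y : phi2 (e (U_(i) *+ 2)%MM i) y = 0 by apply: (square_killed N2 glk).
have phi20 : phi2 = 0.
  by apply: normalized_eq0 => // a j; apply: (all_killed1 N2 only sqk).
exists d; last by move=> p3; apply/funext => t; rewrite /d p3 eqxx.
by apply: cohomologous_trans c1 _; move/eqP: phi20; rewrite subr_eq0 => /eqP ->;
  apply: cohomologous_refl.
Qed.

(** Compare constant terms at (x_i^2 D_i, x_i^(p-1) D_l). A coboundary contributes none: both
    arguments have degree at least 2, and their bracket contains x_i^p, hence is 0. *)
Lemma sq_sum_independent c psi : linear psi -> ((1 < n)%N || (p != 3%N)) ->
  sq_sum c = cob1 psi -> forall i, c i = 0.
Proof.
move=> psil np cE i.
(* For n > 1 any l other than i gives 1; for n = 1 the value is 3, invertible when p is not 3. *)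
have [l l0] : exists l, (i == l)%:R * 2%:R + 1 != 0 :> F.
  have [[l li]|no] := pselect (exists l, l != i).
    by exists l; index_simp; rewrite mul0r add0r oner_eq0.
  exists i; rewrite eqxx mul1r natr1; apply: natr_neq0.
  suff : p != 3%N by have := p_gt2; lia.
  case/orP: np => // n1; case: no.
  have i0n : (0 < n)%N by lia.
  have [i0|i0] := eqVneq (Ordinal i0n) i; last by exists (Ordinal i0n).
  by exists (Ordinal n1); rewrite -i0.
have := congr1 (fun f => lowest f l (U_(i) *+ 2)%MM i (U_(i) *+ p.-1)%MM l) cE.
rewrite /= lowest_sq_sum (bigD1 i) //= big1 ?addr0 => [|t ti]; last first.
  by rewrite lowest_sqd_neq ?mulr0 //; mnm_eval; rewrite eq_sym (negPf ti).
rewrite lowest_sqd_square /lowest /cob1 !cfB !cf0_lie_deg2 ?mdegMn ?mdeg1 //; last first.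
  by have := p_gt2; lia.
rewrite (lie_e eB) !(@e_out _ _ _) ?scaler0 ?subrr ?(linf0 psil) ?cf0 ?subrr.
- by move/eqP; rewrite mulrN oppr_eq0 mulf_eq0 (negPf l0) orbF => /eqP.
- by move=> /(_ i); mnm_eval; rewrite eqxx; case: (l == i); have := p_gt2; lia.
- by move=> /(_ i); mnm_eval; rewrite eqxx; have := p_gt2; lia.
Qed.

End WittBasis.

(** * The basis of the Witt-Jacobson algebra *)

Section TruncatedBasis.
Variables (F : fieldType) (p : nat) (charFp : p \in [pchar F]) (n : nat).
Local Notation A := (trunc_poly charFp n).
Local Notation W := (witt_jacobson charFp n).
Local Notation pi := (@trunc_pi F p charFp n).
Implicit Types (a b m : 'X_{1..n}) (i j k : 'I_n) (X Y : W) (f h : {mpoly F[n]}).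

Definition trunc_coef a (x : A) : F := (trunc_repr x)@_a.

(** Every monomial of an element of the ideal has some exponent at least p, so coefficients inside
    the box do not depend on the representative. *)
Lemma trunc_coef_pi a f : (forall i, a i < p)%N -> trunc_coef a (pi f) = f@_a.
Proof.
move=> ap; apply/eqP; rewrite -subr_eq0 -mcoeffB.
have /trunc_pi_eqP/asboolP[c ->] := trunc_reprK (pi f).
rewrite raddf_sum /= big1 // => i _; rewrite mpolyXn mcoeffMr big1 // => m /eqP aE.
rewrite mcoeffX; case: eqP => [mE|]; last by rewrite mulr0.
have /(_ i) := (mnmP _ _).1 aE; rewrite -mE mnmDE mulmnE mnm1E eqxx mul1n => ai.
by have := ap i; rewrite ai ltnNge leq_addr.
Qed.

Lemma trunc_coef_linear a : (forall i, a i < p)%N -> linear (trunc_coef a : A -> F^o).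
Proof.
move=> ap c x y; rewrite -[x]trunc_reprK -[y]trunc_reprK -trunc_piZ -rmorphD /=.
by rewrite !trunc_coef_pi // mcoeffD mcoeffZ.
Qed.

Lemma trunc_pi_out m i : (p <= m i)%N -> pi 'X_[m] = 0.
Proof.
move=> pm; rewrite -(rmorph0 pi); apply/trunc_pi_eqP; rewrite subr0; apply/asboolP.
exists (fun k => if k == i then 'X_[(m - U_(i) *+ p)%MM] else 0).
rewrite (bigD1 i) //= eqxx big1 => [|k ki]; last by rewrite (negPf ki) mul0r.
rewrite addr0 mpolyXn -mpolyXD; congr 'X_[_]; apply/mnmP => t.
by rewrite mnmDE mnmBE mulmnE mnm1E; case: eqP => [<-|_] /=; lia.
Qed.

Lemma trunc_expand (x : A) :
  x = \sum_(a <- mnm_box n p) trunc_coef a x *: pi 'X_[a].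
Proof.
rewrite -{1}[x]trunc_reprK /trunc_coef; move: (trunc_repr x) => f.
elim/mpolyind: f => [|c m f _ _ IHf].
  by rewrite rmorph0 big1 // => a _; rewrite mcoeff0 scale0r.
rewrite rmorphD /= IHf trunc_piZ.
under [RHS]eq_bigr do rewrite mcoeffD mcoeffZ mcoeffX scalerDl.
rewrite big_split /=; congr (_ + _).
have [mp|] := boolP (m \in mnm_box n p).
  rewrite (bigD1_seq m) ?mnm_box_uniq //= eqxx mulr1 big1 ?addr0 // => a am.
  by rewrite eq_sym (negPf am) mulr0 scale0r.
move=> mp; rewrite big_seq big1 => [|a ap].
  move: mp; rewrite mem_mnm_box negb_forall => /existsP[i]; rewrite -leqNgt => pm.
  by rewrite (trunc_pi_out pm) scaler0.
case: eqP => [ma|_]; last by rewrite mulr0 scale0r.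
by rewrite ma ap in mp.
Qed.

Lemma derivation1 X : X 1 = 0.
Proof.
have := (derivationP X).2 1 1; rewrite !mulr1 mul1r.
by move/eqP; rewrite -subr_eq0 opprD addrA subrr sub0r oppr_eq0 => /eqP.
Qed.

Lemma derivation_pi X f : X (pi f) = \sum_j X (pi 'X_j) * pi f^`M(j).
Proof.
have Xl := (derivationP X).1.
have monomial m : X (pi 'X_[m]) = \sum_j X (pi 'X_j) * pi ('X_[m])^`M(j).
  have [d] := ubnP (mdeg m); elim: d m => // d IHd m md.
  have [->|m0] := eqVneq m 0%MM.
    rewrite mpolyX0 rmorph1 derivation1 big1 // => j _.
    by rewrite -mpolyC1 mderivC rmorph0 mulr0.
  have [i mi] : exists i, (0 < m i)%N.
    apply: contrapT => /forallNP no; case/eqP: m0; apply/mnmP => i; rewrite mnm0E.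
    by have := no i; lia.
  have mE : m = (U_(i) + (m - U_(i)))%MM.
    apply/mnmP => t; rewrite mnmDE mnmBE mnm1E.
    by case: (eqVneq i t) mi => [<-|_] /=; lia.
  have dm : (mdeg (m - U_(i))%MM < d)%N.
    by move: md; rewrite {1}mE mdegD mdeg1; lia.
  rewrite mE mpolyXD rmorphM (derivationP X).2 (IHd _ dm) mulr_sumr.
  under [RHS]eq_bigr do rewrite mderivM rmorphD !rmorphM /= mulrDr.
  rewrite big_split /=; congr (_ + _); last first.
    by apply: eq_bigr => j _; rewrite mulrCA.
  rewrite (bigD1 i) //= big1 ?addr0 => [|j ji].
    rewrite mderivX mnm1E eqxx scale1r (_ : U_(i) - U_(i) = 0)%MM; last first.
      by apply/mnmP => t; rewrite mnmBE mnm0E subnn.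
    by rewrite mpolyX0 rmorph1 mul1r.
  by rewrite mderivX mnm1E eq_sym (negPf ji) scale0r rmorph0 mul0r mulr0.
elim/mpolyind: f => [|c m f _ _ IHf].
  rewrite rmorph0 (linf0 Xl) big1 // => j _.
  by rewrite mderiv0 rmorph0 mulr0.
rewrite rmorphD /= trunc_piZ Xl IHf monomial scaler_sumr -big_split /=.
apply: eq_bigr => j _; rewrite mderivD mderivZ rmorphD /= trunc_piZ mulrDr.
by rewrite -scalerAr.
Qed.

Lemma derivation_ext X Y : (forall j, X (pi 'X_j) = Y (pi 'X_j)) -> X = Y.
Proof.
move=> XY; apply: derivations_eqP => x; rewrite -[x]trunc_reprK !derivation_pi.
by apply: eq_bigr => j _; rewrite XY.
Qed.

Fact witt_e_subproof a j :
  is_derivation (fun x : A => pi 'X_[a] * trunc_partial j x).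
Proof.
have [pl pM] := trunc_partial_is_derivation charFp j; split=> [c x y|x y].
  by rewrite pl mulrDr -scalerAr.
by rewrite pM mulrDr mulrA mulrCA.
Qed.

Definition witt_e a j : W := Derivation (witt_e_subproof a j).

(** Set to 0 outside the box, where the coefficient would depend on the representative, whereas
    [witt_basis] asks for linearity at every exponent. *)
Definition witt_cf a j X : F :=
  if a \in mnm_box n p then trunc_coef a (X (pi 'X_j)) else 0.

Lemma witt_eE a j k : witt_e a j (pi 'X_k) = (k == j)%:R *: pi 'X_[a].
Proof.
rewrite -[LHS]/(pi 'X_[a] * trunc_partial j (pi 'X_k)) trunc_partial_pi mderivX mnm1E.
have [->|_] := eqVneq k j; last by rewrite !scale0r rmorph0 mulr0.
rewrite !scale1r (_ : U_(j) - U_(j) = 0)%MM; first by rewrite mpolyX0 rmorph1 mulr1.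
by apply/mnmP => t; rewrite mnmBE mnm0E subnn.
Qed.

Lemma witt_e_pi a j f : witt_e a j (pi f) = pi ('X_[a] * f^`M(j)).
Proof. by rewrite -[LHS]/(pi 'X_[a] * trunc_partial j (pi f)) trunc_partial_pi rmorphM. Qed.

Lemma linear_derivation_at (x : A) : linear (fun X : W => X x).
Proof. by []. Qed.

Lemma witt_basisP : witt_basis p witt_e witt_cf.
Proof.
split.
- move=> a j; have [ap|/negPf ap] := boolP (a \in mnm_box n p); last first.
    have -> : witt_cf a j = fun=> 0 by apply/funext => X; rewrite /witt_cf ap.
    exact: linear_zero.
  have -> : witt_cf a j = fun X => trunc_coef a (X (pi 'X_j)).
    by apply/funext => X; rewrite /witt_cf ap.
  move: ap; rewrite mem_mnm_box => /forallP ap.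
  exact: linear_comp (trunc_coef_linear ap) (linear_derivation_at _).
- move=> a j b k ap; rewrite /witt_cf ifT; last by rewrite mem_mnm_box; apply/forallP.
  rewrite witt_eE (linfZ (trunc_coef_linear ap)) trunc_coef_pi // mcoeffX.
  by rewrite (eq_sym b); do 2 case: eqVneq => _; rewrite /= ?scaler0 ?scale1r ?scale0r.
- move=> a j i pa; apply: derivation_ext => k.
  by rewrite witt_eE (trunc_pi_out pa) scaler0.
- move=> a j b k; apply: derivation_ext => t.
  have dZ (d : W) := linfZ (derivationP d).1.
  rewrite -[LHS]/(witt_e a j (witt_e b k (pi 'X_t)) - witt_e b k (witt_e a j (pi 'X_t))).
  rewrite (linfB (linear_derivation_at _)) !(linfZ (linear_derivation_at _)) !witt_eE.
  rewrite !dZ !witt_e_pi !mderivX -!scalerAr !trunc_piZ -!mpolyXD !scalerA.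
  (* The exponents can differ only when the subtraction truncates, that is for d_s = 0, and then the
     coefficient is 0. *)
  have shift (c d : 'X_{1..n}) s : ((d s)%:R : F) *: pi 'X_[c + (d - U_(s))] = (d s)%:R *: pi 'X_[c + d - U_(s)].
    have [->|ds] := posnP (d s); first by rewrite !scale0r.
    congr (_ *: pi 'X_[_]); apply/mnmP => r; rewrite !(mnmDE, mnmBE) mnm1E.
    by case: (eqVneq s r) ds => [<-|_] /=; lia.
  rewrite -!(scalerA _ (_ j)%:R) -!(scalerA _ (_ k)%:R) shift shift (addmC b).
  by rewrite !scalerA ![_ * (_ == _)%:R]mulrC.
move=> X; apply: derivation_ext => t; rewrite {1}[X (pi _)]trunc_expand.
rewrite (linf_sum (linear_derivation_at _)) big_seq [RHS]big_seq.
apply: eq_bigr => a ap; rewrite (linf_sum (linear_derivation_at _)).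
have ev j : (witt_cf a j X *: witt_e a j) (pi 'X_t)
    = witt_cf a j X *: ((t == j)%:R *: pi 'X_[a]).
  by rewrite -witt_eE.
under [RHS]eq_bigr do rewrite ev.
rewrite (bigD1 t) //= eqxx scale1r big1 ?addr0 => [|j jt]; first by rewrite /witt_cf ap.
by rewrite eq_sym (negPf jt) scale0r scaler0.
Qed.

Lemma witt_pd j : pd witt_e j = partial charFp j.
Proof.
apply: derivation_ext => k; rewrite /pd witt_eE -[RHS]/(trunc_partial j (pi 'X_k)).
rewrite trunc_partial_pi mderivX mnm1E trunc_piZ.
have [->|_] := eqVneq k j; last by rewrite !scale0r.
by congr (_ *: pi 'X_[_]); apply/mnmP => t; rewrite mnmBE mnm0E subnn.
Qed.

End TruncatedBasis.

(** * The second cohomology group *)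

Section CurriedCochains.
Variables (F : fieldType) (g : lieAlgType F).
Local Notation M := (adjoint g).

Definition args2 (x y : g) : {ffun 'I_2 -> g} := [ffun i => if i == ord0 then x else y].

Definition curry2 (f : {ffun 'I_2 -> g} -> M) : g -> g -> g := fun x y => f (args2 x y).

Lemma args2_eta (v : {ffun 'I_2 -> g}) : args2 (v ord0) (v ord_max) = v.
Proof.
apply/ffunP => i; rewrite ffunE; case: eqP => [->//|i0]; congr (v _); apply/val_inj.
by case: i i0 => [[|[|]]] //= h []; apply/val_inj.
Qed.

Lemma cochain2_curry2 f : is_cochain f -> cochain2 (curry2 f).
Proof.
move=> [fl fa]; split=> [y a x x'|x a y y'|x].
- have := fl (args2 0 y) ord0 a x x'.
  have E z : set_arg (args2 0 y) ord0 z = args2 z y.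
    by apply/ffunP => i; rewrite !ffunE; case: eqP.
  by rewrite !E.
- have := fl (args2 x 0) ord_max a y y'.
  have E z : set_arg (args2 x 0) ord_max z = args2 x z.
    apply/ffunP => i; rewrite !ffunE; case: eqP => [->//|i1].
    by case: i i1 => [[|[|]]] //= h []; apply/val_inj.
  by rewrite !E.
- by apply: (fa _ ord0 ord_max) => //; rewrite !ffunE.
Qed.

Lemma is_cochain2 (phi : g -> g -> g) : cochain2 phi ->
  is_cochain (M := M) (fun v : {ffun 'I_2 -> g} => phi (v ord0) (v ord_max)).
Proof.
move=> phic; split=> [v i a x y|v i j ij vij].
  rewrite !ffunE; have [->|i0] := eqVneq i ord0.
    by rewrite /= (cochain2_linl phic).
  have -> : i = ord_max.
    by apply/val_inj; case: i i0 => [[|[|]]].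
  by rewrite /= (cochain2_linr phic).
suff -> : v ord0 = v ord_max by apply: cochain2xx.
have ord2 (k : 'I_2) : k = ord0 \/ k = ord_max.
  by case: k => [[|[|]]] // h; [left|right]; apply/val_inj.
by case: (ord2 i) (ord2 j) ij vij => -> [] -> //; rewrite eqxx.
Qed.

Lemma is_cochain1 (psi : g -> g) : linear psi ->
  is_cochain (M := M) (fun v : {ffun 'I_1 -> g} => psi (v ord0)).
Proof.
move=> psil; split=> [v i a x y|v i j]; last by rewrite !ord1 eqxx.
by rewrite (ord1 i) !ffunE /= psil.
Qed.

Lemma is_cochain1_linear (h : {ffun 'I_1 -> g} -> M) : is_cochain h ->
  linear (fun x : g => h [ffun=> x] : g).
Proof.
move=> [hl _] a x y; have := hl [ffun=> 0] ord0 a x y.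
have E z : set_arg [ffun=> 0] ord0 z = [ffun=> z] :> {ffun 'I_1 -> g}.
  by apply/ffunP => i; rewrite !ffunE ord1.
by rewrite !E.
Qed.

Lemma ce_diff1E (h : {ffun 'I_1 -> g} -> M) v :
  ce_diff h v = cob1 (fun x => h [ffun=> x] : g) (v ord0) (v ord_max).
Proof.
rewrite /ce_diff /cob1 !big_ord_recl !big_ord0 /= !addr0.
have l0 : lift ord0 ord0 = ord_max :> 'I_2 by apply/val_inj.
have d0 : drop_arg v ord0 = [ffun=> v ord_max].
  by apply/ffunP => t; rewrite !ffunE (ord1 t) l0.
have d1 : drop_arg v (lift ord0 ord0) = [ffun=> v ord0].
  by apply/ffunP => t; rewrite !ffunE (ord1 t); congr (v _); apply/val_inj.
have b01 : bracket_args v ord0 ord_max = [ffun=> lie (v ord0) (v ord_max)].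
  by apply/ffunP => t; rewrite !ffunE (ord1 t).
do 2!rewrite big_mkcond !big_ord_recl !big_ord0 /=.
rewrite /bump /= !l0 b01 d0 -l0 d1 l0.
by rewrite expr0 expr1 !addr0 ?add0r !scaleN1r scale1r.
Qed.

Lemma ce_diff2E (f : {ffun 'I_2 -> g} -> M) (x y z : g) :
  cochain2 (curry2 f) ->
  ce_diff f [ffun i : 'I_3 => nth 0 [:: x; y; z] i]
  = lie x (curry2 f y z) + lie y (curry2 f z x) + lie z (curry2 f x y)
    - (curry2 f (lie x y) z + curry2 f (lie y z) x + curry2 f (lie z x) y).
Proof.
move=> fc; set v := [ffun i => _].
rewrite /ce_diff !big_ord_recl !big_ord0 /=; do 3!rewrite big_mkcond !big_ord_recl !big_ord0 /=.
have vE (i : 'I_3) : v i = nth 0 [:: x; y; z] i by rewrite ffunE.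
have ord2 (w w' : {ffun 'I_2 -> g}) : w ord0 = w' ord0 -> w ord_max = w' ord_max -> w = w'.
  by move=> w0 w1; rewrite -[w]args2_eta -[w']args2_eta w0 w1.
have dropE i a b : nth 0 [:: x; y; z] (bump i 0) = a -> nth 0 [:: x; y; z] (bump i 1) = b ->
    forall i' : 'I_3, val i' = i -> f (drop_arg v i') = curry2 f a b.
  by move=> <- <- i' <-; congr f; apply: ord2; rewrite !ffunE.
have brE i j a : nth 0 [:: x; y; z] (bump j (bump i 0)) = a -> (bump j (bump i 0) < 3)%N ->
    forall i' j' : 'I_3, val i' = i -> val j' = j ->
    f (bracket_args v i' j') = curry2 f (lie (v i') (v j')) a.
  move=> <- b3 i' j' ii jj; rewrite -ii -jj in b3 *; congr f; apply: ord2; rewrite !ffunE //=.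
  by rewrite vE inordK.
rewrite (dropE 0%N y z) // (dropE 1%N x z) // (dropE 2%N x y) //.
rewrite (brE 0%N 1%N z) // (brE 0%N 2%N y) // (brE 1%N 2%N x) // !vE /= /bump /=.
rewrite (cochain2C fc z x) lieNr (lieC z x) (linfN (cochain2_linl fc y)).
rewrite !add0r !addr0 expr0 expr1 !exprS expr0 !mulr1 !mulN1r ?opprK !scaleN1r !scale1r.
zmod.
Qed.

Lemma is_cocycle2 (f : {ffun 'I_2 -> g} -> M) :
  is_cocycle f <-> is_cochain f /\ cocycle2 (curry2 f).
Proof.
split=> [[fc fz]|[fc [c2 z2]]].
  have c2 := cochain2_curry2 fc; split=> //; split=> // x y z; apply/eqP.
  by rewrite -subr_eq0 -ce_diff2E // fz.
split=> // v.
have -> : v = [ffun i : 'I_3 => nth 0 [:: v (inord 0); v (inord 1); v (inord 2)] i].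
  apply/ffunP => i; rewrite ffunE; case: i => [[|[|[|]]]] //= h; congr (v _);
    by apply/val_inj; rewrite /= inordK.
by rewrite ce_diff2E // z2 subrr.
Qed.

End CurriedCochains.

Section SecondCohomology.
Variables (F : fieldType) (p : nat) (charFp : p \in [pchar F]) (odd_p : odd p).
Variables (n : nat) (g : lieAlgType F).
Variables (e : 'X_{1..n} -> 'I_n -> g) (cf : 'X_{1..n} -> 'I_n -> g -> F).
Hypothesis eB : witt_basis p e cf.
Local Notation M := (adjoint g).

Lemma is_cocycle_Sq (D : g) : is_cocycle (M := M) (Sq p (ad D)).
Proof.
have Dd : lie_derivation (ad D) := lie_derivation_ad D.
have -> : Sq p (ad D) = fun v => sq p (ad D) (v ord0) (v ord_max).
  by apply/funext => v; rewrite SqE.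
have sz := cocycle2_sq charFp odd_p Dd.
apply/is_cocycle2; split; first exact: (is_cochain2 sz.1).
by have -> : curry2 (fun v => sq p (ad D) (v ord0) (v ord_max)) = sq p (ad D)
  by apply/funext => x; apply/funext => y; rewrite /curry2 !ffunE.
Qed.

Lemma cohomology_class_eq (z z' : cocycles M 2) :
  cohomology_class z = cohomology_class z' <->
  exists2 psi : g -> g, linear psi &
    curry2 (z : {ffun 'I_2 -> g} -> M) = curry2 (z' : {ffun 'I_2 -> g} -> M) + cob1 psi.
Proof.
have -> : (cohomology_class z = cohomology_class z')
    <-> is_coboundary ((z - z' : cocycles M 2) : {ffun 'I_2 -> g} -> M).
  split=> [/eqP|zz]; first by rewrite -[_ == _]Quotient.idealrBE => /asboolP.
  by apply/eqP; rewrite -[_ == _]Quotient.idealrBE; apply/asboolP.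
split=> [[h hc zz]|[psi psil zz]].
  exists (fun x => h [ffun=> x]); first exact: is_cochain1_linear.
  apply/funext => x; apply/funext => y.
  have := congr1 (@^~ (args2 x y)) zz; rewrite /= ce_diff1E !ffunE /= => E.
  rewrite -[RHS]/(z' (args2 x y) + cob1 (fun x => h [ffun=> x]) x y) -E.
  by rewrite -[RHS]/(z' (args2 x y) + (z (args2 x y) - z' (args2 x y))) addrC subrK.
exists (fun v : {ffun 'I_1 -> g} => psi (v ord0) : M); first exact: is_cochain1.
apply/funext => v; rewrite ce_diff1E.
have -> : (fun x : g => psi ([ffun=> x] (ord0 : 'I_1))) = psi.
  by apply/funext => x; rewrite ffunE.
rewrite -[LHS]/(z v - z' v) -(args2_eta v).
have := congr1 (fun f => f (v ord0) (v ord_max)) zz.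
rewrite /curry2 => ->; rewrite args2_eta.
by rewrite -[(_ + _ : g -> g -> g) _ _]/(z' (args2 (v ord0) (v ord_max)) + cob1 psi (v ord0) (v ord_max))
  args2_eta addrC addKr.
Qed.

(** Only the underlying function of a cocycle is fixed, so any proof of the cocycle condition
    fits. *)
Variable Z : 'I_n -> cocycles M 2.
Hypothesis ZE : forall i, (Z i : {ffun 'I_2 -> g} -> M) = Sq p (ad (pd e i)).

Lemma curry2_sum (c : 'I_n -> F) :
  curry2 ((\sum_i c i *: Z i : cocycles M 2) : {ffun 'I_2 -> g} -> M) = sq_sum p e c.
Proof.
apply/funext => x; apply/funext => y; rewrite sq_sumE /curry2.
have ev (f h : cocycles M 2) (v : {ffun 'I_2 -> g}) : (f + h) v = f v + h v by [].
rewrite (big_morph (fun f : cocycles M 2 => f (args2 x y) : g)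
  (id1 := 0) (op1 := +%R)) //; apply: eq_bigr => i _.
by rewrite -[LHS]/(c i *: Z i (args2 x y)) ZE SqE !ffunE.
Qed.

Lemma cohomology_class_sum (c : 'I_n -> F) :
  cohomology_class (\sum_i c i *: Z i) = \sum_i c i *: cohomology_class (Z i).
Proof.
rewrite /cohomology_class raddf_sum; apply: eq_bigr => i _; exact: pi_scaleE.
Qed.

(** P carries what is known about the coefficients: nothing in the basis case, and their vanishing
    when n = 1 and p = 3. *)
Lemma cohomology_decomposition (w : cohomology M 2) (P : ('I_n -> F) -> Prop) :
    (forall phi, cocycle2 phi -> exists2 c, cohomologous phi (sq_sum p e c) & P c) ->
  exists2 c, w = \sum_i c i *: cohomology_class (Z i) & P c.
Proof.
move=> dec; pose z : cocycles M 2 := repr w.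
have zE : w = cohomology_class z by rewrite /cohomology_class /z reprK.
have /is_cocycle2[_ /dec[c [psi psil cE] Pc]] :
    is_cocycle (z : {ffun 'I_2 -> g} -> M) by exact/asboolP/(valP z).
exists c => //; rewrite -cohomology_class_sum zE; apply/cohomology_class_eq.
by exists psi; rewrite ?curry2_sum.
Qed.

Lemma Sq_basis : (0 < n)%N -> ((1 < n)%N || (p != 3%N)) ->
  is_basis (fun i => cohomology_class (Z i)).
Proof.
move=> n0 np w.
have [c wE _] : exists2 c, w = \sum_i c i *: cohomology_class (Z i) & True.
  apply: cohomology_decomposition => phi phiz.
  have [n1|n1] := ltnP 1 n.
    have [|c cE] := cocycle2_decomposition_many charFp odd_p eB _ phiz; last by exists c.
    move=> i; have [i0|i0] := eqVneq (Ordinal n0) i; last by exists (Ordinal n0).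
    by exists (Ordinal n1); rewrite -i0.
  have only (k : 'I_n) : k = Ordinal n0 by apply/val_inj => /=; have := ltn_ord k; lia.
  by have [c cE _] := cocycle2_decomposition_one charFp odd_p eB only phiz; exists c.
exists [ffun i => c i]; split; first by rewrite wE; apply: eq_bigr => i _; rewrite ffunE.
move=> d dE; apply/ffunP => i; rewrite ffunE.
have : cohomology_class (\sum_i c i *: Z i) = cohomology_class (\sum_i d i *: Z i).
  by rewrite !cohomology_class_sum -wE.
move/cohomology_class_eq => [psi psil]; rewrite !curry2_sum => E.
apply/eqP; rewrite -subr_eq0; apply/eqP.
apply: (sq_sum_independent charFp odd_p eB psil np (c := fun i => c i - d i)).
rewrite /sq_sum; under eq_bigr do rewrite scalerBl.
by rewrite sumrB -!/(sq_sum _ _ _) E addrC addKr.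
Qed.

Lemma cohomology2_eq0 : n = 1%N -> p = 3%N -> forall w : cohomology M 2, w = 0.
Proof.
move=> n1 p3 w; have n0 : (0 < n)%N by rewrite n1.
have only (k : 'I_n) : k = Ordinal n0 by apply/val_inj => /=; have := ltn_ord k; lia.
have [c -> ->] : exists2 c, w = \sum_i c i *: cohomology_class (Z i) & c = fun=> 0.
  apply: cohomology_decomposition => phi phiz.
  have [c cE c0] := cocycle2_decomposition_one charFp odd_p eB only phiz.
  by exists c => //; apply: c0.
by rewrite big1 // => i _; rewrite scale0r.
Qed.

End SecondCohomology.

Theorem theorem1p1 (F : fieldType) (p : nat) (charFp : p \in [pchar F])
    (p_neq2 : p <> 2%N) (n : nat) (n_ge1 : (1 <= n)%N) :
  exists SqP : forall i : 'I_n,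
      is_cocycle (M := adjoint (witt_jacobson charFp n))
        (Sq p (ad (partial charFp i))),
    if (n == 1%N) && (p == 3%N) then
      forall c : cohomology (adjoint (witt_jacobson charFp n)) 2, c = 0
    else
      is_basis (fun i : 'I_n => cohomology_class (Cocycle (SqP i))).
Proof.
have odd_p : odd p.
  by case: (even_prime (pcharf_prime charFp)) => // /p_neq2.
exists (fun i => is_cocycle_Sq charFp odd_p (partial charFp i)).
have ZE i : (Cocycle (is_cocycle_Sq charFp odd_p (partial charFp i)) : _ -> _)
    = Sq p (ad (pd (witt_e charFp (n := n)) i)) by rewrite witt_pd.
have eB := witt_basisP charFp n.
case: ifP => [/andP[/eqP n1 /eqP p3]|np]; first exact: (cohomology2_eq0 charFp odd_p eB ZE n1 p3).
apply: (Sq_basis charFp odd_p eB ZE n_ge1).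
move: np; have [_|n1] := eqVneq n 1%N; first by rewrite /= => ->; rewrite orbT.
by have -> : (1 < n)%N by lia.
Qed.
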